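(* Let $\Theta\subset\mathbb{R}^d$ be open, convex and bounded, and let $X_0,X_1,\ldots$ satisfy $$X_j=S(\vartheta,X_{j-1})+\varepsilon_j,\qquad j\ge 1,$$ where $(\varepsilon_j)_{j\ge1}$ are i.i.d. with known density $g$ and $\vartheta\in\Theta$ is unknown. Let $\ell(\vartheta,x,x')=\ln g\big(x'-S(\vartheta,x)\big)$ and let $\mathbb{I}(\vartheta)=\mathbf{E}_\vartheta\big[\dot\ell(\vartheta,X_0,X_1)\dot\ell(\vartheta,X_0,X_1)^{\mathbb{T}}\big]$ be the Fisher information matrix. Assume Conditions $\mathcal{R}$ (stated in the context) hold. Let $\frac12<\delta<1$, $N=[n^\delta]$, and let $\bar\vartheta_N$ be a preliminary estimator, i.e. a function of $X_0,\ldots,X_N$, such that $\sqrt{N}(\bar\vartheta_N-\vartheta)$ is tight uniformly on compacts $\mathbb{K}\subset\Theta$. For $s\in[\tau_\delta,1]$, $\tau_\delta=n^{-1+\delta}$, put $k=[sn]$, $$\Delta_k(\vartheta,X^k_N)=\frac{1}{\sqrt{k}}\sum_{j=N+1}^{k}\dot\ell(\vartheta,X_{j-1},X_j),$$ and define the one-step MLE-process $$\vartheta^\star_{s,n}=\bar\vartheta_N+\frac{1}{\sqrt{k}}\,\mathbb{I}(\bar\vartheta_N)^{-1}\Delta_k(\bar\vartheta_N,X^k_N).$$ Then for every $s\in(0,1]$, as $n\to\infty$, $$\sqrt{k}\,(\vartheta^\star_{s,n}-\vartheta)\Longrightarrow\mathcal{N}\big(0,\mathbb{I}(\vartheta)^{-1}\big),$$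 and this estimator-process is asymptotically efficient for bounded loss functions, i.e. for every $\vartheta_0\in\Theta$ and every bounded loss function $W$, $$\lim_{\rho\to0}\lim_{n\to\infty}\sup_{|\vartheta-\vartheta_0|<\rho}\mathbf{E}_\vartheta W\big(\sqrt{k}(\vartheta^\star_{s,n}-\vartheta)\big)=\mathbf{E}\,W\big(\zeta\,\mathbb{I}(\vartheta_0)^{-1/2}\big),$$ where $\zeta\sim\mathcal{N}(0,\mathbb{J})$ with $\mathbb{J}$ the $d\times d$ identity matrix.
   Context: $[a]$ denotes the integer part of $a$; a dot denotes differentiation with respect to $\vartheta$, $\mathbb{T}$ denotes transpose, and $\mathbf{P}_\vartheta,\mathbf{E}_\vartheta$ refer to the law of the process under parameter $\vartheta$. A family of random variables $\eta_n(\vartheta)$ is tight uniformly on compacts $\mathbb{K}\subset\Theta$ if for every $\varepsilon>0$ and every compact $\mathbb{K}$ there exists $C>0$ with $\sup_{\vartheta\in\mathbb{K}}\mathbf{P}_\vartheta(|\eta_n(\vartheta)|>C)\le\varepsilon$ for all $n$. A loss function $W:\mathbb{R}^d\to[0,\infty)$ is understood in the usual sense of Ibragimov–Has'minskii (e.g. $W(0)=0$, symmetric, continuous, with convex sublevel sets). Conditions $\mathcal{R}$: (1) The time series $(X_j)_{j\ge0}$ is strictly stationary and has a unique invariant distribution with density $\pi(\vartheta,x)$. (2) The preliminary estimator has the tightness property stated in the claim. (3) $S(\vartheta,x)$ is three times continuously differentiable in $\vartheta$, $g>0$ and $g\in\mathcal{C}^3$; the derivatives $\partial^i\ell(\vartheta,x,x')/\partial\vartheta^i$,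 $i=1,2,3$, satisfy $\sup_{\vartheta\in\Theta}\|\partial^i\ell(\vartheta,x,x')/\partial\vartheta^i\|\le R_i(x,x')$ with $\mathbf{E}_\vartheta|R_i(X_{j-1},X_j)|^2<C$, the constant $C>0$ not depending on $\vartheta$. (4) The law of large numbers $\frac1n\sum_{j=1}^n\dot\ell(\vartheta,X_{j-1},X_j)\dot\ell(\vartheta,X_{j-1},X_j)^{\mathbb{T}}\to\mathbb{I}(\vartheta)$ holds; the central limit theorem $\frac1{\sqrt n}\sum_{j=1}^n\dot\ell(\vartheta,X_{j-1},X_j)\Rightarrow\mathcal{N}(0,\mathbb{I}(\vartheta))$ holds; and the family $\frac1{\sqrt n}\sum_{j=1}^n[\ddot\ell(\vartheta,X_{j-1},X_j)+\mathbb{I}(\vartheta)]$ is tight uniformly on compacts $\mathbb{K}\subset\Theta$. (5) $\mathbb{I}$ is Lipschitz, $|\mathbb{I}(\vartheta_1)-\mathbb{I}(\vartheta_2)|\le L|\vartheta_1-\vartheta_2|$, and uniformly non-degenerate and bounded: $0<\inf_{\vartheta\in\Theta}\inf_{|\lambda|=1}\lambda^{\mathbb{T}}\mathbb{I}(\vartheta)\lambda$ and $\sup_{\vartheta\in\Theta}\sup_{|\lambda|=1}\lambda^{\mathbb{T}}\mathbb{I}(\vartheta)\lambda<\infty$, $\lambda\in\mathbb{R}^d$. *)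

(* Defs.v *)
From HB Require Import structures.
From mathcomp Require Import all_boot all_order all_algebra.
From mathcomp Require Import all_classical all_reals all_analysis.
Set Implicit Arguments. Unset Strict Implicit. Unset Printing Implicit Defensive.
Import Order.TTheory GRing.Theory Num.Theory.
Import numFieldNormedType.Exports.
Local Open Scope classical_set_scope.
Local Open Scope ring_scope.

Section Defs.
Variable R : realType.

Definition convex_set_cV d (A : set 'cV[R]_d) : Prop :=
  forall a b t, A a -> A b -> 0 <= t <= 1 -> A ((1 - t) *: a + t *: b).

Definition bounded_set_cV d (A : set 'cV[R]_d) : Prop :=
  exists M : R, forall t, A t -> `|t| <= M.

Definition qform d (M : 'M[R]_d) (v : 'cV[R]_d) : R := (v^T *m M *m v) 0 0.

(* symmetric positive semidefinite square root of a matrix (chosen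
   classically; it exists and is unique for symmetric PSD matrices) *)
Definition is_sqrtmx d (A M : 'M[R]_d) : Prop :=
  M^T = M /\ (forall v, 0 <= qform M v) /\ M *m M = A.
Definition sqrtmx d (A : 'M[R]_d) : 'M[R]_d := xget 0 (is_sqrtmx A).

Definition pd d (i : 'I_d) (f : 'cV[R]_d -> R) : 'cV[R]_d -> R :=
  fun t => 'D_(delta_mx i 0) f t.

Definition C3_on d (A : set 'cV[R]_d) (f : 'cV[R]_d -> R) : Prop :=
  forall t, A t ->
    {for t, continuous f} /\
    forall i j k : 'I_d,
      [/\ derivable f t (delta_mx i 0),
          derivable (pd i f) t (delta_mx j 0) &
          derivable (pd j (pd i f)) t (delta_mx k 0)] /\
      [/\ {for t, continuous (pd i f)},
          {for t, continuous (pd j (pd i f))} &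
          {for t, continuous (pd k (pd j (pd i f)))}].

Definition C3_R (g : R -> R) : Prop :=
  (forall x, [/\ derivable g x 1, derivable (derive1 g) x 1 &
                derivable (derive1 (derive1 g)) x 1]) /\
  [/\ continuous g, continuous (derive1 g), continuous (derive1 (derive1 g)) &
      continuous (derive1 (derive1 (derive1 g)))].

Definition ell d (S : 'cV[R]_d -> R -> R) (g : R -> R) (x x' : R) :
  'cV[R]_d -> R := fun t => ln (g (x' - S t x)).

Definition ldot d S g (t : 'cV[R]_d) (x x' : R) : 'cV[R]_d :=
  \col_i pd i (ell S g x x') t.
Definition lddot d S g (t : 'cV[R]_d) (x x' : R) : 'M[R]_d :=
  \matrix_(i, j) pd j (pd i (ell S g x x')) t.
Definition ldddot d S g (t : 'cV[R]_d) (x x' : R) (i j k : 'I_d) : R :=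
  pd k (pd j (pd i (ell S g x x'))) t.

Section Prob.
Context (dO : measure_display) (Omega : measurableType dO).

Definition fisher d (P : 'cV[R]_d -> probability Omega R) (X : nat -> Omega -> R)
  S g (t : 'cV[R]_d) : 'M[R]_d :=
  \matrix_(i, j) Rintegral (P t) setT
     (fun w => ldot S g t (X 0%N w) (X 1%N w) i 0 *
               ldot S g t (X 0%N w) (X 1%N w) j 0).

Definition mutual_indep (I : eqType) (Q : probability Omega R) (Y : I -> Omega -> R) :=
  forall (s : seq I) (B : I -> set R), uniq s -> (forall i, measurable (B i)) ->
    Q (\big[setI/setT]_(i <- s) (Y i @^-1` B i)) =
    (\prod_(i <- s) Q (Y i @^-1` B i))%E.

Definition has_density (Q : probability Omega R) (Y : Omega -> R) (f : R -> R) :=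
  forall A : set R, measurable A ->
    Q (Y @^-1` A) = (\int[@lebesgue_measure R]_(x in A) (f x)%:E)%E.

Definition strictly_stationary (Q : probability Omega R) (X : nat -> Omega -> R) :=
  forall (m k : nat) (B : nat -> set R), (forall i, measurable (B i)) ->
    Q (\big[setI/setT]_(i < m) (X (k + i)%N @^-1` B i)) =
    Q (\big[setI/setT]_(i < m) (X i @^-1` B i)).

Definition std_gauss_density (x : R) : R :=
  expR (- (x ^+ 2) / 2) / Num.sqrt (2 * pi).

Definition std_gauss_vec d (Q : probability Omega R) (zeta : Omega -> 'cV[R]_d) :=
  (forall i, measurable_fun setT (fun w => zeta w i 0)) /\
  mutual_indep Q (fun (i : 'I_d) w => zeta w i 0) /\
  (forall i, has_density Q (fun w => zeta w i 0) std_gauss_density).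

Definition cvg_in_prob m n (Q : probability Omega R) (Y : nat -> Omega -> 'M[R]_(m, n))
  (A : 'M[R]_(m, n)) :=
  forall e : R, 0 < e ->
    (fun k => fine (Q [set w | e < `|Y k w - A|])) @ \oo --> (0 : R).

Definition tight_unif_compacts d m n (Theta : set 'cV[R]_d)
  (P : 'cV[R]_d -> probability Omega R) (Y : nat -> 'cV[R]_d -> Omega -> 'M[R]_(m, n)) :=
  forall K : set 'cV[R]_d, compact K -> K `<=` Theta ->
  forall e : R, 0 < e -> exists C : R, 0 < C /\
    forall k t, K t -> (P t [set w | (C < `|Y k t w|)%R] <= e%:E)%E.

End Prob.

Definition cvg_in_law d (dO : measure_display) (Omega : measurableType dO)
  (Q : probability Omega R) (Y : nat -> Omega -> 'cV[R]_d)
  (dO' : measure_display) (Omega' : measurableType dO')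
  (Q' : probability Omega' R) (Z : Omega' -> 'cV[R]_d) :=
  forall f : 'cV[R]_d -> R, continuous f -> (exists M : R, forall x, `|f x| <= M) ->
    (fun n => Rintegral Q setT (f \o Y n)) @ \oo --> Rintegral Q' setT (f \o Z).

(* loss function in the sense of Ibragimov--Has'minskii *)
Definition loss_function d (W : 'cV[R]_d -> R) : Prop :=
  [/\ W 0 = 0, (forall x, 0 <= W x), (forall x, W (- x) = W x), continuous W &
      forall c : R, convex_set_cV [set x | W x <= c]].

(* invariance of a probability measure mu on R for the transition
   x |-> S(t,x) + eps, eps with density g *)
Definition invariant_for (mu : probability R R) (K : R -> R -> R) :=
  forall A : set R, measurable A ->
    mu A = (\int[mu]_x (\int[@lebesgue_measure R]_(y in A) (K x y)%:E))%E.

End Defs.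

Section Estimator.
Variable R : realType.

Definition enorm d (v : 'cV[R]_d) : R := Num.sqrt ((v^T *m v) 0 0).

Definition innov d (dO : measure_display) (Omega : measurableType dO)
  (S : 'cV[R]_d -> R -> R) (X : nat -> Omega -> R) (t : 'cV[R]_d) (j : nat) : Omega -> R :=
  fun w => if j is 0%N then X 0%N w else X j w - S t (X j.-1 w).

Definition Nof (delta : R) (n : nat) : nat := Num.truncn ((n%:R : R) `^ delta).
Definition kof (s : R) (n : nat) : nat := Num.truncn (s * n%:R).

(* preliminary estimator theta_bar_N = est N (X_0, ..., X_N) *)
Definition thetabar d (dO : measure_display) (Omega : measurableType dO)
  (est : nat -> (nat -> R) -> 'cV[R]_d) (X : nat -> Omega -> R) (N : nat) (w : Omega) :=
  est N (fun i => X i w).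

Definition Delta d (dO : measure_display) (Omega : measurableType dO)
  S g (X : nat -> Omega -> R) (N k : nat) (t : 'cV[R]_d) (w : Omega) : 'cV[R]_d :=
  (Num.sqrt (k%:R : R))^-1 *: \sum_(N.+1 <= j < k.+1) ldot S g t (X j.-1 w) (X j w).

Definition onestep d (dO : measure_display) (Omega : measurableType dO)
  (P : 'cV[R]_d -> probability Omega R) (X : nat -> Omega -> R) S g
  (est : nat -> (nat -> R) -> 'cV[R]_d) (delta s : R) (n : nat) (w : Omega) : 'cV[R]_d :=
  let N := Nof delta n in
  let k := kof s n in
  let tb := thetabar est X N w in
  tb + (Num.sqrt (k%:R : R))^-1 *: (invmx (fisher P X S g tb) *m Delta S g X N k tb w).

End Estimator.

(* Main.v *)
Require Import Defs.
From HB Require Import structures.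
From mathcomp Require Import all_boot all_order all_algebra.
From mathcomp Require Import all_classical all_reals all_analysis.
From mathcomp Require Import measurable_realfun random_variable ring lra zify.
Import Order.TTheory GRing.Theory Num.Theory.
Import numFieldNormedType.Exports.
Set Implicit Arguments. Unset Strict Implicit. Unset Printing Implicit Defensive.
Local Open Scope classical_set_scope.
Local Open Scope ring_scope.

(* Write Z_k for k^(-1/2) times the sum of the scores at theta over j <= k. A Taylor
   expansion of the score around theta shows that sqrt k (theta* - theta) differs
   from I(theta)^-1 Z_k by a remainder bounded, outside events of uniformly small
   probability, by a multiple of sqrt (N / k) + 1 / sqrt N + sqrt k / N, which tends
   to 0 because 1/2 < delta < 1. Both assertions therefore follow from the
   convergence in law of Z_k, uniformly over compact sets of parameters.

   R(4) only gives this convergence pointwise. Uniformity is proved from the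
   martingale structure: the innovations being independent, the scores are
   martingale differences and (score)(score)^T + Hessian has conditional mean 0,
   so that the uniform tightness of the normalised Hessians controls the
   conditional variances. The expectations of cos (u . Z_k + c) are then estimated
   by telescoping, and bounded continuous functions are approximated by
   trigonometric polynomials. *)

(** * Integrable random variables *)

(** The law of the observations changes with theta; the law [nu] of the innovations does not. Every
    estimate is therefore arranged to factor into a moment of the innovation score and a moment of
    the past. The conditional mean identity for the Hessian requires the integrals of g' and g'' to
    vanish. Integrability of these derivatives is not given: it is recovered from the second moment
    bounds on the derivatives of the log-likelihood and the non-degeneracy of the information,
    through the product form of the score. Conditional expectations never appear: independence of
    past and innovation is a product law on sequence space, and the martingale property is the
    vanishing of integrals against functions of the past. The uniform statement on a one-point
    compact gives the limit law. On a closed ball around theta0 it gives the limit in n of the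
    supremum, and the Lipschitz bound on the information then lets rho tend to 0. *)

Definition L1 d (T : measurableType d) (R : realType) (P : {measure set T -> \bar R})
  (f : T -> R) := P.-integrable setT (EFin \o f).

Section Expectation.
Context d (T : measurableType d) (R : realType) (P : probability T R).
Implicit Types f g : T -> R.

Lemma L1_measurable f : L1 P f -> measurable_fun setT f.
Proof. by move=> /measurable_int /measurable_EFinP. Qed.

Lemma L1_dom f g : measurable_fun setT f -> L1 P g -> (forall x, `|f x| <= g x) -> L1 P f.
Proof.
move=> mf ig fg; apply: (le_integrable _ _ _ ig) => //; first exact/measurable_EFinP.
by move=> x _ /=; rewrite lee_fin (le_trans (fg x)) ?ler_norm.
Qed.

Lemma L1_cst (c : R) : L1 P (fun=> c).
Proof. exact: finite_measure_integrable_cst. Qed.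

Lemma L1_bounded f (c : R) : measurable_fun setT f -> (forall x, `|f x| <= c) -> L1 P f.
Proof. by move=> mf; apply: L1_dom => //; exact: L1_cst. Qed.

Lemma L1D f g : L1 P f -> L1 P g -> L1 P (fun x => f x + g x).
Proof. by move=> If Ig; exact: (integrableD measurableT If Ig). Qed.

Lemma L1B f g : L1 P f -> L1 P g -> L1 P (fun x => f x - g x).
Proof. by move=> If Ig; exact: (integrableB measurableT If Ig). Qed.

Lemma L1Z (c : R) f : L1 P f -> L1 P (fun x => c * f x).
Proof. by move=> If; exact: (integrableZl measurableT c If). Qed.

Lemma L1_norm f : L1 P f -> L1 P (fun x => `|f x|).
Proof. by move=> If; exact: (integrable_norm If). Qed.

Lemma L1_sum (I : Type) (s : seq I) (Q : pred I) (F : I -> T -> R) :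
  (forall i, Q i -> L1 P (F i)) -> L1 P (fun x => \sum_(i <- s | Q i) F i x).
Proof.
move=> iF; rewrite /L1 (_ : _ \o _ = fun x => (\sum_(i <- s | Q i) (F i x)%:E)%E); last first.
  by apply/funext => x /=; rewrite sumEFin.
exact: integrable_sum.
Qed.

Lemma L1_mul_bounded (c : R) f g : measurable_fun setT f -> (forall x, `|f x| <= c) ->
  L1 P g -> L1 P (fun x => f x * g x).
Proof.
move=> mf fc ig; apply: (@L1_dom _ (fun x => c * `|g x|)).
- exact: measurable_funM mf (L1_measurable ig).
- exact/L1Z/L1_norm.
- by move=> x; rewrite normrM ler_wpM2r.
Qed.

Lemma L1M_sqr f g : measurable_fun setT f -> measurable_fun setT g ->
  L1 P (fun x => f x ^+ 2) -> L1 P (fun x => g x ^+ 2) -> L1 P (fun x => f x * g x).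
Proof.
move=> mf mg f2 g2; apply: (@L1_dom _ (fun x => f x ^+ 2 + g x ^+ 2)).
- exact: measurable_funM.
- exact: L1D.
- move=> x; rewrite normrM -(real_normK (num_real (f x))) -(real_normK (num_real (g x))).
  have := sqr_ge0 (`|f x| - `|g x|); have := normr_ge0 (f x); have := normr_ge0 (g x); nra.
Qed.

Lemma L1_sqr f : measurable_fun setT f -> L1 P (fun x => f x ^+ 2) -> L1 P f.
Proof.
move=> mf f2; apply: (@L1_dom _ (fun x => 1 + f x ^+ 2)) => //.
  exact: L1D (L1_cst 1) f2.
move=> x; rewrite -(real_normK (num_real (f x))).
by have := sqr_ge0 (`|f x| - 1); have := normr_ge0 (f x); nra.
Qed.

Lemma L1_sqrD f g : measurable_fun setT f -> measurable_fun setT g ->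
  L1 P (fun x => f x ^+ 2) -> L1 P (fun x => g x ^+ 2) -> L1 P (fun x => (f x + g x) ^+ 2).
Proof.
move=> mf mg f2 g2; apply: (@L1_dom _ (fun x => 2 * f x ^+ 2 + 2 * g x ^+ 2)).
- exact/measurable_funX/measurable_funD.
- by apply: L1D; exact: L1Z.
- by move=> x; rewrite ger0_norm ?sqr_ge0//; have := sqr_ge0 (f x - g x); nra.
Qed.

Lemma ExD f g : L1 P f -> L1 P g ->
  \int[P]_w (f w + g w) = \int[P]_w f w + \int[P]_w g w.
Proof. by move=> *; exact: RintegralD. Qed.

Lemma ExB f g : L1 P f -> L1 P g ->
  \int[P]_w (f w - g w) = \int[P]_w f w - \int[P]_w g w.
Proof. by move=> *; exact: RintegralB. Qed.

Lemma ExZ c f : L1 P f -> \int[P]_w (c * f w) = c * \int[P]_w f w.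
Proof. by move=> *; exact: RintegralZl. Qed.

Lemma Ex_cst (c : R) : \int[P]_w c = c.
Proof. by rewrite Rintegral_cst//= [X in fine X](probability_setT P) mulr1. Qed.

Lemma Ex_sum (I : Type) (s : seq I) (Q : pred I) (F : I -> T -> R) :
  (forall i, Q i -> L1 P (F i)) ->
  \int[P]_w (\sum_(i <- s | Q i) F i w) = \sum_(i <- s | Q i) \int[P]_w F i w.
Proof.
move=> iF; elim: s => [|i s IH].
  rewrite big_nil (_ : (fun _ => _) = fun=> 0) ?Ex_cst//.
  by apply/funext => x; rewrite big_nil.
rewrite big_cons -IH; case: ifPn => Qi; last first.
  by congr Rintegral; apply/funext => w; rewrite big_cons (negbTE Qi).
rewrite -ExD//; [|exact: iF|exact: L1_sum].
by congr Rintegral; apply/funext => w; rewrite big_cons Qi.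
Qed.

Lemma Ex_le f g : L1 P f -> L1 P g -> (forall x, f x <= g x) ->
  \int[P]_w f w <= \int[P]_w g w.
Proof. by move=> *; exact: le_Rintegral. Qed.

Lemma Ex_ge0 f : (forall x, 0 <= f x) -> 0 <= \int[P]_w f w.
Proof. by move=> *; exact: Rintegral_ge0. Qed.

Lemma Ex_norm f : L1 P f -> `|\int[P]_w f w| <= \int[P]_w `|f w|.
Proof. by move=> *; exact: le_normr_Rintegral. Qed.

Lemma Ex_dom f g : L1 P f -> L1 P g -> (forall x, `|f x| <= g x) ->
  `|\int[P]_w f w| <= \int[P]_w g w.
Proof.
move=> If Ig fg; apply: le_trans (Ex_norm If) _.
by apply: Ex_le => //; exact: L1_norm.
Qed.

Lemma Ex_EFin f : L1 P f -> (\int[P]_w f w)%:E = (\int[P]_w (f w)%:E)%E.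
Proof. by move=> If; rewrite fineK//; exact: integrable_fin_num. Qed.

Lemma L1_nonneg f (c : R) : measurable_fun setT f -> (forall x, 0 <= f x) ->
  (\int[P]_w (f w)%:E <= c%:E)%E -> L1 P f /\ \int[P]_w f w <= c.
Proof.
move=> mf f0 fc; have If : L1 P f.
  apply/integrableP; split; first exact/measurable_EFinP.
  apply: le_lt_trans (ltry c); apply: le_trans fc.
  by rewrite le_eqVlt; apply/orP; left; apply/eqP/eq_integral => x _ /=; rewrite ger0_norm.
by split => //; rewrite -lee_fin Ex_EFin.
Qed.

Lemma probability_fin (A : set T) : measurable A -> P A \is a fin_num.
Proof. by move=> mA; exact: fin_num_measure. Qed.

Lemma Ex_indic (A : set T) : measurable A -> \int[P]_w \1_A w = fine (P A).
Proof. by move=> mA; rewrite /Rintegral integral_indic// setIT. Qed.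

Lemma L1_indic (A : set T) : measurable A -> L1 P (\1_A).
Proof.
move=> mA; apply: (@L1_bounded _ 1); first exact: measurable_indic.
by move=> x; rewrite indicE; case: (x \in A); rewrite /= ?normr1 ?normr0.
Qed.

Lemma measurable_gt f (c : R) : measurable_fun setT f -> measurable [set w | c < f w].
Proof.
move=> mf; rewrite [X in measurable X](_ : _ = setT `&` f @^-1` `]c, +oo[%classic).
  exact: mf.
by rewrite setTI; apply/seteqP; split => x /=; rewrite in_itv/= andbT.
Qed.

Lemma Ex_markov f (a b : R) : L1 P f -> (forall x, 0 <= f x) -> 0 < a -> \int[P]_w f w <= b ->
  (P [set w | (a < f w)%R] <= (b / a)%:E)%E.
Proof.
move=> If f0 a0 fb; have mA := measurable_gt a (L1_measurable If).
rewrite -[X in (X <= _)%E]fineK ?probability_fin// lee_fin -Ex_indic// ler_pdivlMr// mulrC -ExZ ?L1_indic//.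
apply: le_trans fb; apply: Ex_le => //; first exact/L1Z/L1_indic.
move=> x; rewrite indicE; case: (boolP (x \in _)) => [/set_mem/= /ltW|_]; first by rewrite mulr1.
by rewrite mulr0.
Qed.

(** On the event where |f| exceeds e, the inequality y <= lam + y^2 / lam is used; elsewhere |f| <=
    e. This turns tightness plus a second moment into smallness in mean. *)
Lemma Ex_abs_le f (e dl c lam : R) : measurable_fun setT f -> 0 < lam -> 0 <= e ->
  L1 P (fun x => f x ^+ 2) -> \int[P]_w (f w ^+ 2) <= c ->
  (P [set w | (e < `|f w|)%R] <= dl%:E)%E ->
  \int[P]_w `|f w| <= e + lam * dl + c / lam.
Proof.
move=> mf lam0 e0 If fc Pf.
have mnf : measurable_fun setT (fun w => `|f w|) by apply: measurableT_comp.
have mA := measurable_gt e mnf.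
have I1 := L1_sqr mf If; have IA := L1_indic mA.
apply: (@le_trans _ _ (\int[P]_w (e + (lam * \1_([set w | e < `|f w|]) w + lam^-1 * f w ^+ 2)))).
  apply: Ex_le; [exact: L1_norm|by apply: L1D; [exact: L1_cst|apply: L1D; exact: L1Z]|].
  move=> x; rewrite indicE; case: (boolP (x \in _)) => [_|/negP xA]; last first.
    rewrite mulr0 add0r.
    have fe : `|f x| <= e by rewrite leNgt; apply/negP => h; apply: xA; rewrite inE.
    rewrite (le_trans fe)// lerDl.
    by have : 0 <= lam^-1 * f x ^+ 2 by rewrite mulr_ge0 ?sqr_ge0// invr_ge0 ltW.
  rewrite mulr1 -(real_normK (num_real (f x))); set y := `|f x|; have y0 : 0 <= y by exact: normr_ge0.
  move=> {mA mnf I1 IA}; suff : y <= lam + lam^-1 * y ^+ 2. by lra.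
  rewrite -(ler_pM2l lam0) mulrDr mulrA divff ?gt_eqF// mul1r.
  by have := sqr_ge0 (lam - y); nra.
rewrite ExD; [|exact: L1_cst|by apply: L1D; exact: L1Z].
rewrite ExD ?ExZ //; [|exact: L1Z|exact: L1Z].
rewrite Ex_cst Ex_indic// -addrA lerD2l lerD//; last by rewrite mulrC ler_pM2r// invr_gt0.
by rewrite ler_pM2l// -lee_fin fineK ?probability_fin.
Qed.

End Expectation.

(** * Taylor estimates for sine, cosine and the exponential *)

Section TrigTaylor.
Variable R : realType.
Implicit Types x y : R.

Lemma MVT_lip (f df : R -> R) (c x : R) :
  (forall y, is_derive y 1 f (df y)) -> (forall y, `|y| <= `|x| -> `|df y| <= c) ->
  `|f x - f 0| <= c * `|x|.
Proof.
move=> fd dfc.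
have cf : continuous f by move=> y; apply/differentiable_continuous/derivable1_diffP; exact: ex_derive.
have [x0|x0|->] := ltgtP x 0; last by rewrite subrr normr0 mulr0.
- have [|y /[!in_itv]/= /andP[xy y0] e] := @MVT R f df x 0 x0 (fun y _ => fd y).
    by move=> y; exact/continuous_subspaceT.
  rewrite distrC e normrM sub0r normrN ler_wpM2r//; apply: dfc.
  by rewrite !ltr0_norm// lerN2 ltW.
- have [|y /[!in_itv]/= /andP[y0 yx] e] := @MVT R f df 0 x x0 (fun y _ => fd y).
    by move=> y; exact/continuous_subspaceT.
  rewrite e normrM subr0 ler_wpM2r//; apply: dfc.
  by rewrite !gtr0_norm// ltW.
Qed.

Lemma norm_sin_le x : `|sin x| <= `|x|.
Proof.
have := @MVT_lip sin cos 1 x (fun y => is_derive_sin y) (fun y _ => cos_max y).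
by rewrite sin0 subr0 mul1r.
Qed.

Lemma sin_max x : `|sin x| <= 1.
Proof. by rewrite ler_norml sin_geN1 sin_le1. Qed.

Lemma one_sub_cos x : 1 - cos x = 2 * sin (x / 2) ^+ 2.
Proof.
rewrite -{1}(divfK (_ : (2:R) != 0) x)// mulr_natr cos_mulr2n cos2sin2; lra.
Qed.

Lemma norm_cosB1_le x : `|cos x - 1| <= `|x|.
Proof.
rewrite distrC one_sub_cos normrM normrX ger0_norm//.
have := sin_max (x / 2); have := norm_sin_le (x / 2).
rewrite normrM normfV (ger0_norm (_ : 0 <= 2 :> R))//.
by have := normr_ge0 (sin (x/2)); nra.
Qed.

Lemma norm_cosB1_le2 x : `|cos x - 1| <= x ^+ 2 / 2.
Proof.
rewrite distrC one_sub_cos normrM normrX ger0_norm//.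
have := norm_sin_le (x / 2).
rewrite normrM normfV (ger0_norm (_ : 0 <= 2 :> R))// -(real_normK (num_real x)).
by have := normr_ge0 (sin (x/2)); have := normr_ge0 x; nra.
Qed.

Let is_derive_sinB y : is_derive y 1 (fun z : R => sin z - z) (cos y - 1).
Proof. by have := is_deriveB (is_derive_sin y) (is_derive_id y (1:R)). Qed.

Lemma norm_sinB_le2 x : `|sin x - x| <= x ^+ 2.
Proof.
have := @MVT_lip (fun z => sin z - z) (fun y => cos y - 1) `|x| x is_derive_sinB.
rewrite sin0 !subr0 -normrM -expr2 (ger0_norm (sqr_ge0 _)); apply => y yx.
exact: le_trans (norm_cosB1_le y) yx.
Qed.

Lemma norm_sinB_le3 x : `|sin x - x| <= `|x| ^+ 3.
Proof.
have := @MVT_lip (fun z => sin z - z) (fun y => cos y - 1) (`|x| ^+ 2) x is_derive_sinB.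
rewrite sin0 !subr0 -exprSr; apply => y yx.
apply: le_trans (norm_cosB1_le2 y) _; rewrite -(real_normK (num_real y)).
by have := normr_ge0 y; nra.
Qed.

Let is_derive_cosB y : is_derive y 1 (fun z : R => cos z + z ^+ 2 / 2) (y - sin y).
Proof.
have -> : y - sin y = - sin y + y by lra.
apply: is_deriveD.
have -> : (fun z : R => z ^+ 2 / 2) = (2^-1 : R) \*: (fun z : R => z ^+ 2).
  by apply/funext => z; rewrite /= mulrC.
apply: is_derive_eq.
rewrite /GRing.scale/=. lra.
Qed.

Lemma norm_cosB_le3 x : `|cos x - 1 + x ^+ 2 / 2| <= `|x| ^+ 3.
Proof.
have := @MVT_lip (fun z => cos z + z ^+ 2 / 2) (fun y => y - sin y) (`|x| ^+ 2) x is_derive_cosB.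
rewrite cos0 expr0n/= mul0r addr0 -exprSr addrAC; apply => y yx.
rewrite distrC; apply: le_trans (norm_sinB_le2 y) _; rewrite -(real_normK (num_real y)).
by have := normr_ge0 y; nra.
Qed.

Lemma norm_cosB_le2 x : `|cos x - 1 + x ^+ 2 / 2| <= x ^+ 2 / 2.
Proof.
have := norm_cosB1_le2 x; have := cos_le1 x.
rewrite !ler_norml => ? /andP[? ?]; apply/andP; split; have := sqr_ge0 x; lra.
Qed.

(** The remainder of Lindeberg's method: the cubic bound serves for small increments, the quadratic
    one where no third moment is available. *)
Definition lrem x := Num.min (x ^+ 2) (`|x| ^+ 3).

(** By the addition formula the remainder is a combination, with coefficients cos x and sin x, of
    the remainders of cos y and sin y. Each of these two has both the quadratic and the cubic bound,
    whence the factor 2. *)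
Lemma cos_taylor x y :
  `|cos (x + y) - (cos x - y * sin x - y ^+ 2 / 2 * cos x)| <= 2 * lrem y.
Proof.
have -> : cos (x + y) - (cos x - y * sin x - y ^+ 2 / 2 * cos x) =
  cos x * (cos y - 1 + y ^+ 2 / 2) - sin x * (sin y - y).
  by rewrite cosD; ring.
have : `|cos x * (cos y - 1 + y ^+ 2 / 2) - sin x * (sin y - y)| <=
  `|cos y - 1 + y ^+ 2 / 2| + `|sin y - y|.
  apply: le_trans (ler_normB _ _) _; rewrite !normrM lerD// ler_piMl//; [exact: cos_max|exact: sin_max].
move=> /le_trans; apply.
rewrite /lrem minr_pMr// le_min; apply/andP; split.
- have := norm_cosB_le2 y; have := norm_sinB_le2 y; have := sqr_ge0 y; lra.
- have := norm_cosB_le3 y; have := norm_sinB_le3 y; lra.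
Qed.

Lemma lrem_ge0 y : 0 <= lrem y.
Proof. by rewrite /lrem le_min sqr_ge0 exprn_ge0. Qed.

Lemma lrem_le2 y : lrem y <= y ^+ 2.
Proof. by rewrite /lrem ge_min lexx. Qed.

Lemma lrem_le3 y : lrem y <= `|y| ^+ 3.
Proof. by rewrite /lrem ge_min lexx orbT. Qed.

Lemma expR_taylor (z : R) : 0 <= z -> `|expR (- z) - (1 - z)| <= z ^+ 2.
Proof.
move=> z0; have h1 := expR_ge1Dx (- z); have h2 := expR_ge1Dx z.
rewrite ger0_norm; last by lra.
have : expR (- z) * expR z = 1 by rewrite -expRD addNr expR0.
have := expR_gt0 (- z).
set a := expR (- z) in h1 *; set b := expR z in h2 * => a0 ab.
have : a * (1 + z) <= 1 by rewrite -[leRHS]ab ler_pM2l.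
move=> a1; have z3 : 0 <= z ^+ 3 by rewrite exprn_ge0.
have z1 : 0 < 1 + z by lra.
rewrite lerBlDr -(ler_pM2r z1); apply: le_trans a1 _.
have -> : (z ^+ 2 + (1 - z)) * (1 + z) = 1 + z ^+ 3 by ring.
by rewrite lerDl.
Qed.

Lemma expRN_lip x y : 0 <= x <= y -> 0 <= expR (- x) - expR (- y) <= y - x.
Proof.
move=> /andP[x0 xy]; rewrite subr_ge0 ler_expR lerN2 xy/=.
have -> : - y = - x + - (y - x) by lra.
rewrite expRD; have := expR_ge1Dx (- (y - x)); have : expR (- x) <= 1 by rewrite -expR0 ler_expR oppr_le0.
have := expR_gt0 (- x); nra.
Qed.

Lemma cos_lip x y : `|cos x - cos y| <= `|x - y|.
Proof.
have := @MVT_lip (fun z => cos (y + z)) (fun z => - sin (y + z)) 1 (x - y).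
rewrite addr0 mul1r subrKC; apply; last by move=> z _; rewrite normrN sin_max.
move=> z; have := is_derive1_comp (is_derive_cos (y + z)) (is_deriveD (is_derive_cst y z (1:R)) (is_derive_id z (1:R))).
by rewrite add0r mulr1.
Qed.

End TrigTaylor.

Lemma subn_ari (x y m : nat) : (x <= y)%N -> (y < m)%N -> (m - x.+1 - (m - y.+1) = y - x)%N.
Proof. lia. Qed.

(** * A central limit estimate for martingales *)

Section MartingaleCLT.
Context d (T : measurableType d) (R : realType) (P : probability T R).
Variables (n : nat) (xi D : nat -> T -> R) (s2 C1 C2 lam eps : R).
Hypotheses (n0 : (0 < n)%N) (s20 : 0 <= s2).
Hypotheses (mxi : forall j, measurable_fun setT (xi j))
           (mD : forall j, measurable_fun setT (D j)).
Hypotheses (xi2 : forall j, L1 P (fun w => xi j w ^+ 2))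
           (xi2C : forall j, \int[P]_w (xi j w ^+ 2) <= C1)
           (D2 : forall j, L1 P (fun w => D j w ^+ 2))
           (D2C : forall j, \int[P]_w (D j w ^+ 2) <= C2).
Let M (j : nat) w : R := (Num.sqrt (n%:R : R))^-1 * \sum_(i < j) xi i w.
(** The martingale property enters only through the test functions sine and cosine of the partial
    sums. [mart1] is the device of the section: under such an integral the conditional variance xi^2
    may be exchanged for s2 - D. [DV] then says that D is negligible once summed, though not term by
    term. *)
Hypotheses (mart0 : forall j c, (j < n)%N -> \int[P]_w (sin (M j w + c) * xi j w) = 0)
  (mart1 : forall j c, (j < n)%N -> \int[P]_w (cos (M j w + c) * (xi j w ^+ 2 + D j w - s2)) = 0)
  (mart2 : forall i j, (i < j)%N -> \int[P]_w (xi i w * xi j w) = 0)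
  (DV : forall m, (m <= n)%N -> \int[P]_w `|\sum_(k < m) D k w| <= eps * n%:R)
  (lind : \sum_(j < n) \int[P]_w lrem ((Num.sqrt (n%:R : R))^-1 * xi j w) <= lam).

Let sn : R := Num.sqrt n%:R.
Let sn0 : 0 < sn. Proof. by rewrite sqrtr_gt0 ltr0n. Qed.
Let nR0 : 0 < n%:R :> R. Proof. by rewrite ltr0n. Qed.
Let sn2 : sn ^+ 2 = n%:R. Proof. by rewrite sqr_sqrtr// ltW. Qed.
Let snV2 : sn^-1 ^+ 2 = n%:R^-1. Proof. by rewrite exprVn sn2. Qed.

Let mM j : measurable_fun setT (M j).
Proof. by apply: measurable_funM => //; apply: measurable_sum => i; exact: mxi. Qed.

Let mtrig (h : R -> R) j c : continuous h -> measurable_fun setT (fun w => h (M j w + c)).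
Proof.
move=> ch; apply: measurableT_comp; first exact: continuous_measurable_fun.
exact: measurable_funD.
Qed.
Let mcos j c := mtrig j c (@continuous_cos R).
Let msin j c := mtrig j c (@continuous_sin R).

Let xi1 j : L1 P (xi j). Proof. exact: L1_sqr. Qed.
Let D1 j : L1 P (D j). Proof. exact: L1_sqr. Qed.

(** The decay that the n - k remaining steps would add to a Gaussian characteristic function. For a
    Gaussian walk of variance s2 k / n, the product of [e k] and the expectation of cos (M_k + c)
    would not depend on k. *)
Let e k : R := expR (- ((n - k)%:R * (s2 / (2 * n%:R)))).
Let z : R := s2 / (2 * n%:R).
Let z0 : 0 <= z. Proof. by rewrite divr_ge0// mulr_ge0. Qed.

Let eS k : (k < n)%N -> e k = e k.+1 * expR (- z).
Proof. by move=> kn; rewrite /e -expRD -opprD -/z -(subnSK kn) -natr1 mulrDl mul1r. Qed.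

Let e01 k : 0 <= e k <= 1.
Proof. by rewrite expR_ge0/= -expR0 ler_expR oppr_le0 mulr_ge0. Qed.

Let lremM_L1 j : L1 P (fun w => lrem (sn^-1 * xi j w)).
Proof.
apply: (@L1_dom _ _ _ _ _ (fun w => n%:R^-1 * xi j w ^+ 2)); last 2 first.
- exact/L1Z.
- by move=> w; rewrite ger0_norm ?lrem_ge0// (le_trans (lrem_le2 _))// exprMn snV2.
apply: measurable_minr; first by apply: measurable_funX; exact: measurable_funM.
by apply: measurable_funX; apply: measurableT_comp => //; exact: measurable_funM.
Qed.

(** In the second-order expansion of cos the linear term integrates to 0 by [mart0], and [mart1]
    changes the quadratic term into s2 - D. Its s2 part cancels against expR (- z) = 1 - z up to
    z^2; the D part is the third term on the left. *)
Let step c k : (k < n)%N ->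
  `|e k.+1 * \int[P]_w cos (M k.+1 w + c) - e k * \int[P]_w cos (M k w + c)
    - e k.+1 / (2 * n%:R) * \int[P]_w (cos (M k w + c) * D k w)| <=
  2 * \int[P]_w lrem (sn^-1 * xi k w) + z ^+ 2.
Proof.
move=> kn.
have bcos j : L1 P (fun w => cos (M j w + c)).
  by apply: (@L1_bounded _ _ _ _ _ 1) => // w; exact: cos_max.
have bs : L1 P (fun w => sin (M k w + c) * xi k w).
  by apply: (@L1_mul_bounded _ _ _ _ 1) => // w; exact: sin_max.
have bD : L1 P (fun w => cos (M k w + c) * D k w).
  by apply: (@L1_mul_bounded _ _ _ _ 1) => // w; exact: cos_max.
have bm : L1 P (fun w => cos (M k w + c) * (xi k w ^+ 2 + D k w - s2)).
  apply: (@L1_mul_bounded _ _ _ _ 1) => //; first by move=> w; exact: cos_max.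
  by apply: L1B; [exact: L1D|exact: L1_cst].
rewrite (eS kn).
(* Two integrals that vanish by [mart0] and [mart1] are inserted, so that the rest is a pointwise
   bound under a single integral. *)
have -> : e k.+1 * \int[P]_w cos (M k.+1 w + c) - e k.+1 * expR (- z) * \int[P]_w cos (M k w + c)
    - e k.+1 / (2 * n%:R) * \int[P]_w (cos (M k w + c) * D k w) =
  e k.+1 * \int[P]_w (cos (M k.+1 w + c) - expR (- z) * cos (M k w + c)
    - (2 * n%:R)^-1 * (cos (M k w + c) * D k w)
    + (sn^-1 * (sin (M k w + c) * xi k w)
       + (2 * n%:R)^-1 * (cos (M k w + c) * (xi k w ^+ 2 + D k w - s2)))).
  rewrite [in RHS]ExD; [|by apply: L1B; [apply: L1B => //; exact: L1Z|exact: L1Z]|by apply: L1D; exact: L1Z].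
  rewrite [in RHS](ExD (L1Z _ bs) (L1Z _ bm)) (ExZ _ bs) (ExZ _ bm).
  rewrite mart0// mart1// !mulr0 !addr0.
  rewrite [in RHS](ExB (L1B _ _) (L1Z _ bD)) ?[in RHS](ExB _ (L1Z _ _))//; last exact: L1Z.
  by rewrite !ExZ//; ring.
have [e0 e1] := andP (e01 k.+1).
rewrite normrM (ger0_norm e0); apply: le_trans (ler_piMl _ e1) _ => //.
rewrite -[X in _ <= _ + X](@Ex_cst _ _ _ P) -ExZ// -ExD; [|exact: L1Z|exact: L1_cst].
apply: Ex_dom.
- apply: L1D; last by apply: L1D; exact: L1Z.
  by apply: L1B; [apply: L1B => //; exact: L1Z|exact: L1Z].
- by apply: L1D; [exact: L1Z|exact: L1_cst].
move=> w.
have MS : M k.+1 w + c = (M k w + c) + sn^-1 * xi k w.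
  by rewrite /M big_ord_recr/= mulrDr addrAC.
set x := M k w + c; set y := sn^-1 * xi k w in MS *.
have xi2y : y ^+ 2 / 2 = (2 * n%:R)^-1 * xi k w ^+ 2.
  by rewrite /y exprMn snV2 invfM; ring.
rewrite MS -/x.
have -> : cos (x + y) - expR (- z) * cos x - (2 * n%:R)^-1 * (cos x * D k w) +
   (sn^-1 * (sin x * xi k w) + (2 * n%:R)^-1 * (cos x * (xi k w ^+ 2 + D k w - s2))) =
  (cos (x + y) - (cos x - y * sin x - y ^+ 2 / 2 * cos x)) - (expR (- z) - (1 - z)) * cos x.
  by rewrite xi2y /y /z; field; rewrite !gt_eqF.
apply: le_trans (ler_normB _ _) _; apply: lerD; first exact: cos_taylor.
rewrite normrM; apply: le_trans (ler_piMr _ (cos_max _)) _ => //.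
exact: expR_taylor.
Qed.

Let cos_telescope c :
  `|\int[P]_w cos (M n w + c) - expR (- (s2 / 2)) * cos c
    - \sum_(k < n) (e k.+1 / (2 * n%:R) * \int[P]_w (cos (M k w + c) * D k w))| <=
  2 * lam + s2 ^+ 2 / n%:R.
Proof.
have -> : \int[P]_w cos (M n w + c) - expR (- (s2 / 2)) * cos c =
  \sum_(k < n) (e k.+1 * \int[P]_w cos (M k.+1 w + c) - e k * \int[P]_w cos (M k w + c)).
  rewrite -(big_mkord xpredT (fun k => e k.+1 * \int[P]_w cos (M k.+1 w + c) - e k * \int[P]_w cos (M k w + c))).
  rewrite (telescope_sumr (fun k => e k * \int[P]_w cos (M k w + c)))//.
  rewrite {1}/e subnn mul0r oppr0 expR0 mul1r {1}/e subn0; congr (_ - _ * _).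
    by congr (expR (- _)); field; rewrite gt_eqF.
  rewrite -[LHS](@Ex_cst _ _ _ P); apply: eq_Rintegral => w _.
  by rewrite /M big_ord0 mulr0 add0r.
rewrite -sumrB; apply: le_trans (ler_norm_sum _ _ _) _.
apply: (@le_trans _ _ (\sum_(k < n) (2 * \int[P]_w lrem (sn^-1 * xi k w) + z ^+ 2))).
  by apply: ler_sum => k _; exact: step.
rewrite big_split/= -mulr_sumr sumr_const card_ord lerD//; first by rewrite ler_pM2l.
have -> : z ^+ 2 *+ n = s2 ^+ 2 / n%:R / 4.
  by rewrite -mulr_natr /z; field; rewrite gt_eqF.
have : 0 <= s2 ^+ 2 / n%:R by rewrite divr_ge0// sqr_ge0.
lra.
Qed.

(** Adding one increment at a time, the cross terms vanish by [mart2]. With p = 0 it also bounds the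
    second moment of the normalised score. *)
Lemma orthogonal_incr k p : (p <= k)%N ->
  L1 P (fun w => (M k w - M p w) ^+ 2) /\
  \int[P]_w ((M k w - M p w) ^+ 2) <= C1 * ((k - p)%:R / n%:R).
Proof.
move=> /subnK <-; elim: (k - p)%N => [|m [IH1 IH2]].
  rewrite add0n subnn mul0r mulr0.
  have -> : (fun w => (M p w - M p w) ^+ 2) = fun=> 0.
    by apply/funext => w; rewrite subrr expr0n.
  by rewrite Ex_cst; split => //; exact: L1_cst.
rewrite addnK in IH2; rewrite addnK.
set f := (fun w => M (m + p)%N w - M p w) in IH1 IH2.
have mf : measurable_fun setT f by exact: measurable_funB.
have mx : measurable_fun setT (fun w => sn^-1 * xi (m + p)%N w) by exact: measurable_funM.
have x2 : L1 P (fun w => (sn^-1 * xi (m + p)%N w) ^+ 2).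
  rewrite (_ : (fun w => _) = (fun w => sn^-2 * xi (m + p)%N w ^+ 2)); first exact: L1Z.
  by apply/funext => w; rewrite exprMn exprVn.
have fE w : M (m.+1 + p)%N w - M p w = f w + sn^-1 * xi (m + p)%N w.
  by rewrite /f /M addSn big_ord_recr/= mulrDr addrAC.
split; first by under eq_fun do rewrite fE; exact: L1_sqrD.
have If : L1 P (fun w => f w * xi (m + p)%N w) by exact: L1M_sqr.
have -> : \int[P]_w ((M (m.+1 + p) w - M p w) ^+ 2) =
  \int[P]_w (f w ^+ 2 + (2 * sn^-1 * (f w * xi (m + p)%N w) + n%:R^-1 * xi (m + p)%N w ^+ 2)).
  by apply: eq_Rintegral => w _; rewrite fE -snV2; ring.
rewrite ExD//; last by apply: L1D; exact: L1Z.
rewrite ExD ?ExZ//; [|exact: L1Z|exact: L1Z].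
have -> : \int[P]_w (f w * xi (m + p)%N w) = 0.
  have -> : \int[P]_w (f w * xi (m + p)%N w) =
    \int[P]_w (\sum_(p <= i < m + p) sn^-1 * (xi i w * xi (m + p)%N w)).
    apply: eq_Rintegral => w _.
    rewrite /f /M -mulrBr -(big_mkord xpredT (fun i => xi i w)) -(big_mkord xpredT (fun i => xi i w)).
    rewrite (big_cat_nat (leq0n p) (leq_addl m p))/= addrAC subrr add0r.
    by rewrite -mulr_sumr -mulr_suml mulrA.
  rewrite Ex_sum; last by move=> i _; apply: L1Z; exact: L1M_sqr.
  rewrite big_nat; apply: big1 => i /andP[_ im].
  by rewrite ExZ ?mart2 ?mulr0//; exact: L1M_sqr.
rewrite mulr0 add0r -(natr1 m) mulrDl mulrDr lerD// mul1r mulrC ler_wpM2r// invr_ge0.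
Qed.

Variables (B : nat) (beta : R).
Hypotheses (B0 : (0 < B)%N) (beta0 : 0 < beta).
(** Left end of block b when the n indices are cut into B nearly equal blocks. *)
Let p b := ((b * n) %/ B)%N.

Let p_mono b : (p b <= p b.+1)%N.
Proof. by rewrite leq_div2r// leq_mul2r leqnSn orbT. Qed.

Let sum_blocks (F : nat -> R) :
  \sum_(k < n) F k = \sum_(b < B) \sum_(p b <= k < p b.+1) F k.
Proof.
have h m : \sum_(b < m) \sum_(p b <= k < p b.+1) F k = \sum_(0 <= k < p m) F k.
  elim: m => [|m IH]; first by rewrite big_ord0 /p mul0n div0n big_nil.
  by rewrite big_ord_recr/= IH [RHS](big_cat_nat (leq0n (p m)) (p_mono m)).
by rewrite h /p mulKn ?big_mkord.
Qed.

(** Bounds the relative length of a block; the summand 1 / n pays for the rounding of its ends. *)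
Let tau : R := B%:R^-1 + n%:R^-1.

Let p_len b k : (k < p b.+1)%N -> (k - p b)%:R / n%:R <= tau.
Proof.
move=> kp; rewrite ler_pdivrMr// /tau mulrDl mulVf ?gt_eqF//.
have : ((k - p b) * B <= n + B)%N.
  have h1 := leq_trunc_div (b.+1 * n) B; have h2 := ltn_ceil (b * n) B0.
  move: kp h1 h2; rewrite /p; nia.
rewrite -(ler_nat R) natrM natrD => h.
rewrite -(ler_pM2r (_ : 0 < (B%:R : R))) ?ltr0n//; apply: le_trans h _.
rewrite mulrDl mul1r lerD2r mulrAC mulVf ?mul1r// pnatr_eq0 -lt0n; exact: B0.
Qed.

(** The part with the weight frozen at the left end is bounded by [DV] at both ends of the block,
    which gives [eps]. The product of the change of weight with D is split by Young's inequality
    with parameter [beta]: a large [beta] makes C2 / beta small, and then a large B makes the block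
    increments small. *)
Let block c b : (b < B)%N ->
  `|\sum_(p b <= k < p b.+1) (e k.+1 / (2 * n%:R) * \int[P]_w (cos (M k w + c) * D k w))| <=
  eps + \sum_(p b <= k < p b.+1) n%:R^-1 * (beta * (C1 * tau + (s2 * tau) ^+ 2) + C2 / beta).
Proof.
move=> bB; set q := p b; set W := fun k w => e k.+1 * cos (M k w + c).
have pbn : (p b.+1 <= n)%N.
  by rewrite -[leqRHS](mulKn n B0); apply: leq_div2r; rewrite leq_mul2r bB orbT.
have C10 : 0 <= C1 by apply: le_trans (xi2C 0); apply: Ex_ge0 => w; exact: sqr_ge0.
have W1 k w : `|W k w| <= 1.
  have [e0 e1] := andP (e01 k.+1).
  by rewrite normrM (ger0_norm e0) (le_trans (ler_piMr _ (cos_max _))).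
have mW k : measurable_fun setT (W k) by exact: measurable_funM.
have WD j k : L1 P (fun w => W j w * D k w) by exact: L1_mul_bounded.
have sumD m : L1 P (fun w => \sum_(k < m) D k w) by exact: L1_sum.
have sumD' : L1 P (fun w => \sum_(q <= k < p b.+1) D k w) by exact: L1_sum.
have -> : \sum_(q <= k < p b.+1) (e k.+1 / (2 * n%:R) * \int[P]_w (cos (M k w + c) * D k w)) =
  (2 * n%:R)^-1 * \int[P]_w (W q w * \sum_(q <= k < p b.+1) D k w) +
  \sum_(q <= k < p b.+1) (2 * n%:R)^-1 * \int[P]_w (W k w * D k w - W q w * D k w).
  have -> : \int[P]_w (W q w * \sum_(q <= k < p b.+1) D k w) =
     \int[P]_w (\sum_(q <= k < p b.+1) W q w * D k w).
    by apply: eq_Rintegral => w _; rewrite mulr_sumr.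
  rewrite Ex_sum// mulr_sumr -big_split/=; apply: eq_bigr => k _.
  rewrite ExB// mulrBr subrKC.
  have -> : \int[P]_w (W k w * D k w) = \int[P]_w (e k.+1 * (cos (M k w + c) * D k w)).
    by apply: eq_Rintegral => w _; rewrite mulrA.
  rewrite ExZ ?mulrA ?(mulrC (e _))//.
  by apply: (@L1_mul_bounded _ _ _ _ 1) => // w; exact: cos_max.
have n2 : 0 <= (2 * n%:R)^-1 :> R by rewrite invr_ge0 mulr_ge0.
apply: le_trans (ler_normD _ _) _; apply: lerD.
  rewrite normrM (ger0_norm n2).
  apply: (@le_trans _ _ ((2 * n%:R)^-1 * (eps * n%:R + eps * n%:R))); last first.
    by rewrite le_eqVlt; apply/orP; left; apply/eqP; field; rewrite gt_eqF.
  rewrite ler_wpM2l//; apply: le_trans (lerD (DV pbn) (DV (leq_trans (p_mono b) pbn))).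
  rewrite -ExD; [|exact: L1_norm|exact: L1_norm].
  apply: Ex_dom; [by apply: L1_mul_bounded|by apply: L1D; exact: L1_norm|].
  move=> w; rewrite normrM; apply: le_trans (ler_piMl _ (W1 _ _)) _ => //.
  rewrite -(big_mkord xpredT (fun i => D i w)) -(big_mkord xpredT (fun i => D i w)).
  rewrite [X in _ <= `|X| + _](big_cat_nat (leq0n q) (p_mono b))/=.
  set a := \sum_(0 <= i < q) D i w; set bb := \sum_(q <= i < p b.+1) D i w.
  have {1}-> : bb = (a + bb) - a by ring.
  exact: ler_normB.
apply: le_trans (ler_norm_sum _ _ _) _.
rewrite big_seq_cond [leRHS]big_seq_cond; apply: ler_sum => k.
rewrite andbT mem_index_iota => /andP[qk kp].
have kq : (k - q)%:R / n%:R <= tau by exact: p_len.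
have tau0 : 0 <= tau by rewrite /tau addr_ge0.
have [incr1 incr2] := orthogonal_incr qk.
(* The weight moves through the cosine, which is 1-Lipschitz in M, and through [e], which moves by
   at most s2 tau over a block. *)
have WW w : (W k w - W q w) ^+ 2 <= 2 * (M k w - M q w) ^+ 2 + 2 * (s2 * tau) ^+ 2.
  have : `|W k w - W q w| <= `|M k w - M q w| + s2 * tau.
    have -> : W k w - W q w = e k.+1 * (cos (M k w + c) - cos (M q w + c)) + (e k.+1 - e q.+1) * cos (M q w + c).
      by rewrite /W; ring.
    have [e0 e1] := andP (e01 k.+1).
    apply: le_trans (ler_normD _ _) _; rewrite !normrM; apply: lerD.
      rewrite (ger0_norm e0); apply: le_trans (ler_piMl _ e1) _ => //.
      by apply: le_trans (cos_lip _ _) _; rewrite opprD addrACA subrr addr0.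
    apply: le_trans (ler_piMr _ (cos_max _)) _ => //.
    have kn : (k < n)%N by exact: leq_trans pbn.
    have := @expRN_lip R ((n - k.+1)%:R * z) ((n - q.+1)%:R * z).
    rewrite -/(e k.+1) -/(e q.+1) => /(_ _)/andP[].
      by rewrite mulr_ge0//= ler_wpM2r// ler_nat leq_sub2l.
    move=> h1 h2; rewrite ger0_norm//; apply: le_trans h2 _.
    rewrite -mulrBl -natrB; last by rewrite leq_sub2l.
    rewrite subn_ari//.
    rewrite /z mulrCA ler_wpM2l// invfM mulrCA.
    apply: le_trans kq; rewrite ler_piMl ?divr_ge0//; lra.
  have := normr_ge0 (W k w - W q w).
  rewrite -(real_normK (num_real (W k w - W q w))) -(real_normK (num_real (M k w - M q w))).
  move: `|W k w - W q w| `|M k w - M q w| (s2 * tau) => x y t x0 xyt.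
  apply: (@le_trans _ _ ((y + t) ^+ 2)); first by rewrite ler_pXn2r ?nnegrE// (le_trans x0).
  by have := sqr_ge0 (y - t); nra.
have IW : L1 P (fun w => W k w * D k w - W q w * D k w) by exact: L1B.
have Ib : L1 P (fun w => beta * (M k w - M q w) ^+ 2 + (beta * (s2 * tau) ^+ 2 + beta^-1 * D k w ^+ 2)).
  by apply: L1D; [exact: L1Z|apply: L1D; [exact: L1_cst|exact: L1Z]].
rewrite normrM (ger0_norm n2).
apply: (@le_trans _ _ ((2 * n%:R)^-1 * (beta * (C1 * tau + (s2 * tau) ^+ 2) + C2 / beta))); last first.
  rewrite ler_wpM2r//; last by rewrite invfM ler_piMl ?invr_ge0//; lra.
  apply: addr_ge0; first by rewrite mulr_ge0 ?(ltW beta0)// addr_ge0 ?sqr_ge0// mulr_ge0.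
  rewrite divr_ge0 ?(ltW beta0)//; apply: le_trans (D2C 0); apply: Ex_ge0 => w; exact: sqr_ge0.
rewrite ler_wpM2l//; apply: (le_trans (Ex_dom IW Ib _)).
  move=> w; rewrite -mulrBl normrM.
  have h : beta * (W k w - W q w) ^+ 2 <= beta * (2 * (M k w - M q w) ^+ 2 + 2 * (s2 * tau) ^+ 2).
    by rewrite ler_pM2l.
  have : `|W k w - W q w| * `|D k w| <= (beta * (W k w - W q w) ^+ 2 + beta^-1 * D k w ^+ 2) / 2.
    rewrite -(real_normK (num_real (W k w - W q w))) -(real_normK (num_real (D k w))).
    rewrite ler_pdivlMr// -(ler_pM2l beta0) [leRHS]mulrDr [X in _ <= _ + X]mulrA divff ?gt_eqF// mul1r.
    by have := sqr_ge0 (beta * `|W k w - W q w| - `|D k w|); nra.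
  have : 0 <= beta^-1 * D k w ^+ 2 by rewrite mulr_ge0 ?sqr_ge0// invr_ge0 ltW.
  by lra.
rewrite ExD; [|exact: L1Z|by apply: L1D; [exact: L1_cst|exact: L1Z]].
rewrite ExD; [|exact: L1_cst|exact: L1Z].
rewrite Ex_cst !ExZ// [in leRHS]mulrDr -addrA lerD//.
  by rewrite ler_pM2l//; apply: le_trans incr2 _; exact: ler_wpM2l.
by rewrite lerD2l mulrC ler_pM2r// invr_gt0.
Qed.

(* E[e^(k s2 / 2n) cos (M_k + c)] telescopes up to the terms e(k) cos (M_k + c) D_k;
   the weights of these are frozen on B blocks, where the partial sums of D are
   small in mean by DV, at the price of the increments of M over a block. *)
Lemma martingale_cos_bound c :
  `|\int[P]_w cos (M n w + c) - expR (- (s2 / 2)) * cos c| <=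
  2 * lam + s2 ^+ 2 / n%:R + B%:R * eps
    + (beta * (C1 * (B%:R^-1 + n%:R^-1) + (s2 * (B%:R^-1 + n%:R^-1)) ^+ 2) + C2 / beta).
Proof.
rewrite -[X in `|X|](subrK (\sum_(k < n) (e k.+1 / (2 * n%:R) * \int[P]_w (cos (M k w + c) * D k w)))).
apply: le_trans (ler_normD _ _) _; rewrite -[leRHS]addrA; apply: lerD; first exact: (cos_telescope c).
rewrite (sum_blocks (fun k => e k.+1 / (2 * n%:R) * \int[P]_w (cos (M k w + c) * D k w))).
apply: le_trans (ler_norm_sum _ _ _) _.
apply: (le_trans (ler_sum _ (fun b _ => block c (ltn_ord b)))).
rewrite big_split/= -(sum_blocks (fun=> _)) !sumr_const card_ord card_ord -(mulr_natl eps) lerD2l.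
by rewrite -[leLHS]mulr_natl mulrA mulfV ?mul1r// gt_eqF.
Qed.

End MartingaleCLT.

(** * Independence of the past *)

Section SequenceSpace.
Variable R : realType.

Definition box (m : nat) (B : nat -> set R) : set (nat -> R) :=
  [set h | forall i, (i < m)%N -> B i (h i)].

Definition boxes : set (set (nat -> R)) :=
  [set A | exists m B, (forall i, measurable (B i)) /\ A = box m B].

(** Sequence space with the sigma-algebra of cylinders. A whole past is one point of it, so that
    joint laws of past and innovation live on a product of two factors. *)
Definition history := g_sigma_algebraType boxes.

Lemma setI_boxes : setI_closed boxes.
Proof.
move=> _ _ [m [B [mB ->]]] [m' [B' [mB' ->]]].
exists (maxn m m'), (fun i => (if (i < m)%N then B i else setT) `&` (if (i < m')%N then B' i else setT)).
split; first by move=> i; apply: measurableI; case: ifP.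
apply/seteqP; split => h.
  move=> [hB hB'] i _; split; case: ifPn => // im; [exact: hB|exact: hB'].
move=> hB; split => i im.
  by have [] := hB i (leq_trans im (leq_maxl _ _)); rewrite im.
by have [_] := hB i (leq_trans im (leq_maxr _ _)); rewrite im.
Qed.

Lemma measurable_coord i : measurable_fun [set: history] (fun h => h i).
Proof.
move=> _ B mB; rewrite setTI; apply: sub_sigma_algebra.
exists i.+1, (fun j => if j == i then B else setT); split; first by move=> j; case: ifP.
apply/seteqP; split => h /= hB; last by have := hB i (ltnSn i); rewrite eqxx.
by move=> j _; case: eqP => // ->.
Qed.

End SequenceSpace.

Section Independence.
Context dO (Omega : measurableType dO) (R : realType) (Q : probability Omega R).
Variable Y : nat -> Omega -> R.
Hypothesis mY : forall i, measurable_fun setT (Y i).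
Hypothesis iY : mutual_indep Q Y.
Variable j : nat.

(** Padding by 0 from index j on puts the pasts of all lengths in the same space. *)
Definition past (w : Omega) : history R := fun i => if (i < j)%N then Y i w else 0.

(** On padded coordinates a box only asks whether 0 lies in its side: either the constraint is void
    or the preimage is empty. *)
Lemma past_box m (B : nat -> set R) :
  past @^-1` box m B =
    \big[setI/setT]_(i <- iota 0 j) (Y i @^-1` (if (i < m)%N then B i else setT)) \/
  past @^-1` box m B = set0.
Proof.
have [|/existsNP[i /not_implyP[im /not_implyP[ji nB]]]] :=
  pselect (forall i, (i < m)%N -> (j <= i)%N -> B i 0).
  move=> H; left; apply/seteqP; split => w.
    move=> wB; rewrite -bigcap_seq => i; rewrite /= mem_iota/= add0n => ij.
    by case: ifPn => // im; have := wB i im; rewrite /past ij.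
  rewrite -bigcap_seq => wB i im; rewrite /past; case: ifPn => [ij|]; last by rewrite -leqNgt; exact: H.
  by have := wB i; rewrite /= mem_iota/= add0n ij im; exact.
right; apply/seteqP; split => w //= wB; apply: nB.
by have := wB i im; rewrite /past ltnNge ji.
Qed.

Let mprei i (B : set R) : measurable B -> measurable (Y i @^-1` B).
Proof. by move=> mB; rewrite -[X in measurable X]setTI; exact: mY. Qed.

Lemma measurable_past : measurable_fun setT past.
Proof.
apply: (measurability (rT := history R) (@boxes R)) => //.
move=> _ [_ [m [B [mB ->]]] <-]; rewrite setTI.
have [->|->] := past_box m B; last exact: measurable0.
by apply: bigsetI_measurable => i _; apply: mprei; case: ifP.
Qed.

(** Mutual independence gives the product formula on boxes, which form a pi-system; the sets
    satisfying it form a Dynkin class. *)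
Lemma past_indep (A : set (history R)) (B : set R) : measurable A -> measurable B ->
  Q ((past @^-1` A) `&` (Y j @^-1` B)) = (Q (past @^-1` A) * Q (Y j @^-1` B))%E.
Proof.
move=> mA mB.
have mp A' : measurable A' -> measurable (past @^-1` A').
  by move=> mA'; rewrite -[X in measurable X]setTI; exact: measurable_past.
have mE := mprei j mB; set E := Y j @^-1` B in mE *.
move: A mA; apply: (@dynkin_induction _ (history R) (@boxes R)).
- by [].
- exact: setI_boxes.
- by rewrite preimage_setT setTI probability_setT mul1e.
- move=> _ [m [B' [mB' ->]]].
  have [->|->] := past_box m B'; last by rewrite set0I measure0 mul0e.
  (* With B placed at index j, the two events become one finite intersection, to which [iY]
     applies. *)
  pose C i := if (i == j)%N then B else if (i < m)%N then B' i else setT.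
  have mC i : measurable (C i) by rewrite /C; case: ifP => // _; case: ifP.
  have CE : \big[setI/setT]_(i <- iota 0 j) (Y i @^-1` (if (i < m)%N then B' i else setT)) =
    \big[setI/setT]_(i <- iota 0 j) (Y i @^-1` C i).
    by apply: eq_big_seq => i; rewrite mem_iota add0n => ij; rewrite /C ltn_eqF.
  have EC : E = Y j @^-1` C j by rewrite /C eqxx.
  rewrite CE EC setIC.
  have := iY (s := j :: iota 0 j) (B := C); rewrite /= iota_uniq mem_iota add0n ltnn/= => /(_ isT mC).
  rewrite big_cons => ->; rewrite big_cons muleC; congr (_ * _)%E.
  by rewrite -iY ?iota_uniq.
- move=> A mA IH; have -> : past @^-1` (~` A) = ~` (past @^-1` A) by [].
  rewrite setIC -setDE (@measureD _ _ _ Q E (past @^-1` A))//; [|exact: mp|by rewrite ltey_eq fin_num_measure].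
  rewrite (setIC E (past @^-1` A)) [X in (_ - X)%E](_ : _ = (Q (past @^-1` A) * Q E)%E); last exact: IH.
  rewrite probability_setC; last exact: mp.
  by rewrite muleBl ?mul1e// ?fin_num_measure//; exact: mp.
- move=> F mF tF IH.
  rewrite preimage_bigcup setI_bigcupl.
  rewrite !measure_bigcup//; last 4 first.
  + by move=> i _; exact: mp.
  + apply/trivIsetP => a b _ _ ab; have /trivIsetP/(_ a b I I ab) h := tF.
    apply/seteqP; split => w //= [wa wb].
    by have : (F a `&` F b) (past w) by []; rewrite h.
  + by move=> i _; apply: measurableI => //; exact: mp.
  + apply/trivIsetP => a b _ _ ab; have /trivIsetP/(_ a b I I ab) h := tF.
    apply/seteqP; split => w //= [[wa _] [wb _]].
    by have : (F a `&` F b) (past w) by []; rewrite h.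
  rewrite muleC -[Q E]fineK ?fin_num_measure// -nneseriesZl//.
  by apply: eq_eseriesr => n _; apply: etrans (IH n) _; rewrite muleC fineK ?fin_num_measure.
Qed.

End Independence.

Section Law.
Context d d' (T : measurableType d) (T' : measurableType d') (R : realType) (Q : probability T R).

Definition law (f : T -> T') (mf : measurable_fun setT f) : probability T' R :=
  distribution Q (mfun_Sub (mem_set mf)).

Lemma lawE f mf A : @law f mf A = Q (f @^-1` A).
Proof. by []. Qed.

Lemma ge0_integral_law f mf (F : T' -> \bar R) : measurable_fun setT F -> (forall y, (0 <= F y)%E) ->
  (\int[@law f mf]_y F y = \int[Q]_x F (f x))%E.
Proof. by move=> mF F0; rewrite [LHS]ge0_integral_distribution. Qed.

Lemma integrable_law f mf (F : T' -> R) : measurable_fun setT F ->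
  L1 Q (fun w => F (f w)) -> L1 (@law f mf) F.
Proof.
move=> mF IF; apply/integrableP; split; first exact/measurable_EFinP.
rewrite ge0_integral_law//; last by apply: measurableT_comp => //; exact/measurable_EFinP.
by move: IF => /integrableP[].
Qed.

Lemma Ex_law f mf (F : T' -> R) : measurable_fun setT F -> L1 Q (fun w => F (f w)) ->
  \int[@law f mf]_y F y = \int[Q]_w F (f w).
Proof.
move=> mF IF; rewrite /Rintegral; congr fine.
by rewrite [LHS]integral_distribution//; exact/measurable_EFinP.
Qed.

Lemma law_integrable f mf (F : T' -> R) : measurable_fun setT F ->
  L1 (@law f mf) F -> L1 Q (fun w => F (f w)).
Proof.
move=> mF IF; apply/integrableP; split; first by apply/measurable_EFinP; exact: measurableT_comp.
move: IF => /integrableP[_]; rewrite ge0_integral_law//.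
by apply: measurableT_comp => //; exact/measurable_EFinP.
Qed.

End Law.

Section FubiniPast.
Context dO (Omega : measurableType dO) (R : realType) (Q : probability Omega R).
Variable Y : nat -> Omega -> R.
Hypothesis mY : forall i, measurable_fun setT (Y i).
Hypothesis iY : mutual_indep Q Y.
Variables (j : nat) (nu : probability R R).
Hypothesis nuE : forall A, measurable A -> nu A = Q (Y j @^-1` A).
Local Notation T0 := (history R).

Let pair w : T0 * R := (past Y j w, Y j w).
Let mpair : measurable_fun setT pair.
Proof. by apply: measurable_fun_pair; [exact: measurable_past|exact: mY]. Qed.

Let mu : probability T0 R := law Q (measurable_past mY j).

(** By independence the joint law of past and innovation agrees with the product measure on
    rectangles, hence everywhere. *)
Let law_pair A : measurable A -> (mu \x nu)%E A = law Q mpair A.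
Proof.
move=> mA; apply: product_measure_unique => // B C mB mC.
transitivity (Q (past Y j @^-1` B) * Q (Y j @^-1` C))%E; first exact: (past_indep mY iY j mB mC).
congr (_ * _)%E. exact: esym (nuE mC).
Qed.

Lemma tonelli_past (F : T0 -> R -> R) : measurable_fun setT (fun z : T0 * R => F z.1 z.2) ->
  (forall h e, 0 <= F h e) ->
  (\int[Q]_w (F (past Y j w) (Y j w))%:E = \int[Q]_w \int[nu]_e (F (past Y j w) e)%:E)%E.
Proof.
move=> mF F0; have mF' : measurable_fun setT (fun z : T0 * R => (F z.1 z.2)%:E).
  exact/measurable_EFinP.
have := @fubini_tonelli1 _ _ _ _ _ mu nu (fun z => (F z.1 z.2)%:E) mF' (fun z => F0 _ _).
rewrite (eq_measure_integral (law Q mpair)); last by move=> A mA _; exact: law_pair.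
rewrite ge0_integral_law// => [|z]; last exact: F0.
move=> ->; rewrite ge0_integral_law//.
  apply: (@measurable_fun_fubini_tonelli_F _ _ _ _ _ nu (fun z => (F z.1 z.2)%:E)) => // z.
  exact: F0.
by move=> h; apply: integral_ge0 => e _; exact: F0.
Qed.

(** Supplies outcomes at which the past can be frozen while the remaining integral over the
    innovation stays finite. *)
Lemma tonelli_past_ae (F : T0 -> R -> R) : measurable_fun setT (fun z : T0 * R => F z.1 z.2) ->
  (forall h e, 0 <= F h e) -> (\int[Q]_w (F (past Y j w) (Y j w))%:E < +oo)%E ->
  {ae Q, forall w, (\int[nu]_e (F (past Y j w) e)%:E < +oo)%E}.
Proof.
move=> mF F0; rewrite tonelli_past// => foo.
have mF' : measurable_fun setT (fun z : T0 * R => (F z.1 z.2)%:E) by exact/measurable_EFinP.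
have mI : measurable_fun setT (fun w => \int[nu]_e (F (past Y j w) e)%:E)%E.
  apply: (@measurableT_comp _ _ _ _ _ _ (fun h : T0 => \int[nu]_e (F h e)%:E)%E); last exact: measurable_past.
  apply: (@measurable_fun_fubini_tonelli_F _ _ _ _ _ nu (fun z => (F z.1 z.2)%:E)) => // z.
  exact: F0.
have I0 w : (0 <= \int[nu]_e (F (past Y j w) e)%:E)%E by apply: integral_ge0 => e _; exact: F0.
have II : Q.-integrable setT (fun w => \int[nu]_e (F (past Y j w) e)%:E)%E.
  by apply/integrableP; split => //; under eq_integral do rewrite gee0_abs//.
have := integrable_ae measurableT II; apply: filterS => w /(_ I).
by rewrite ge0_fin_numE.
Qed.

(** The martingale difference property in integrated form: freeze the past, integrate over the
    innovation, and only then over the past. *)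
Lemma fubini_past0 (F : T0 -> R -> R) : measurable_fun setT (fun z : T0 * R => F z.1 z.2) ->
  L1 Q (fun w => F (past Y j w) (Y j w)) ->
  (forall h, (\int[nu]_e (F h e)%:E)%E = 0%E) ->
  \int[Q]_w F (past Y j w) (Y j w) = 0.
Proof.
move=> mF IF F0; have mF' : measurable_fun setT (fun z : T0 * R => (F z.1 z.2)%:E).
  exact/measurable_EFinP.
have Ip : L1 (law Q mpair) (fun z : T0 * R => F z.1 z.2) by exact: integrable_law.
have Im : (mu \x nu)%E.-integrable setT (fun z => (F z.1 z.2)%:E).
  move: Ip => /integrableP[_ Ip]; apply/integrableP; split => //.
  by rewrite (eq_measure_integral (law Q mpair))// => A mA _; exact: law_pair.
have h : (\int[law Q mpair]_z (F z.1 z.2)%:E = 0)%E.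
  rewrite -[LHS](eq_measure_integral (law Q mpair) (m1 := (mu \x nu)%E)).
    apply: etrans (esym (integral12_prod_meas1 Im)) _.
    by apply: integral0_eq => h _; exact: F0.
  by move=> A mA _; exact: law_pair.
have := @Ex_law _ _ _ _ _ Q _ mpair _ mF IF.
by rewrite {1}/Rintegral h => <-.
Qed.

End FubiniPast.

(** * Integrals of functions of a variable with a density *)

Section Density.
Context dO (Omega : measurableType dO) (R : realType) (Q : probability Omega R).
Variables (Y : Omega -> R) (g : R -> R).
Hypotheses (mY : measurable_fun setT Y) (mg : measurable_fun setT g) (g0 : forall x, 0 <= g x).
Hypothesis Yg : has_density Q Y g.
Local Notation mu := (@lebesgue_measure R).

(* [lebesgue_measure] lives on [measurableTypeR R], whose display differs from
   the default one of [R] *)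
Let mY' : measurable_fun setT (Y : Omega -> measurableTypeR R). Proof. exact: mY. Qed.
Let nu : probability (measurableTypeR R) R := law Q mY'.

Let nuE A : measurable A -> nu A = (\int[mu]_(x in A) (g x)%:E)%E.
Proof. by move=> mA; exact: Yg. Qed.

Let dom : nu `<< mu.
Proof.
apply/null_content_dominatesP => A mA muA0; rewrite nuE//.
by apply: null_set_integral => //; apply/measurable_funTS/measurable_EFinP.
Qed.

Let integral_density (f : measurableTypeR R -> R) : L1 nu f ->
  (\int[nu]_x (f x)%:E = \int[mu]_x (f x * g x)%:E)%E.
Proof.
move=> If; have mf := L1_measurable If.
rewrite -(@Radon_Nikodym_change_of_variables _ _ R nu mu dom)//=.
under [RHS]eq_integral do rewrite EFinM.
apply: ae_eq_integral => //.
- apply: emeasurable_funM; first exact/measurable_EFinP.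
  by apply: (measurable_int mu); exact: Radon_Nikodym_integrable.
- by apply: emeasurable_funM; exact/measurable_EFinP.
(* The Radon-Nikodym derivative equals g almost everywhere, both having the same integral over every
   measurable set. *)
- apply: ae_eqe_mul2l => /=.
  rewrite Radon_NikodymE/=; case: cid => /= h [h1 h2 h3].
  apply: integral_ae_eq => //=; first exact/measurable_EFinP.
  by move=> E E01 mE; rewrite -h3//= nuE.
Qed.

Lemma has_density_integrable (f : R -> R) : measurable_fun setT f ->
  L1 Q (fun w => f (Y w)) -> mu.-integrable setT (fun x => (f x * g x)%:E).
Proof.
move=> mf IfY; have If : L1 nu f by exact: integrable_law.
apply/integrableP; split.
  by apply/measurable_EFinP; exact: measurable_funM.
have : (\int[nu]_x (`|f x|)%:E < +oo)%E by move: If => /integrableP[].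
rewrite (integral_density (L1_norm If)).
by under [in X in _ -> X]eq_integral do rewrite /= normrM (ger0_norm (g0 _)).
Qed.

Lemma has_density_integral (f : R -> R) : measurable_fun setT f ->
  L1 Q (fun w => f (Y w)) -> \int[Q]_w f (Y w) = \int[mu]_x (f x * g x).
Proof.
move=> mf IfY; have If : L1 nu f by exact: integrable_law.
by rewrite -(@Ex_law _ _ _ (measurableTypeR R) R Q Y mY' f)// /Rintegral integral_density.
Qed.

End Density.

(** * Vanishing of the integral of a derivative *)

Section IntegralDerivative.
Variable R : realType.
Local Notation mu := (@lebesgue_measure R).

Lemma derivable_oo_LRcontinuous_is_derive (F f : R -> R) (a b : R) : (forall x : R, is_derive x 1 F (f x)) ->
  derivable_oo_LRcontinuous F a b.
Proof.
move=> dF; have cF : continuous F.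
  by move=> y; apply/differentiable_continuous/derivable1_diffP; exact: ex_derive.
split; first by move=> x _; exact: ex_derive.
  by apply: cvg_at_right_filter; exact: cF.
by apply: cvg_at_left_filter; exact: cF.
Qed.

(* Integration by parts against the cutoffs 1 - (x / n)^2 on [-n, n]: no boundary
   terms appear although F is not yet known to vanish at infinity *)
Lemma integral_derive_eq0 (F f : R -> R) : (forall x : R, is_derive x 1 F (f x)) -> continuous f ->
  mu.-integrable setT (EFin \o F) -> mu.-integrable setT (EFin \o f) ->
  \int[mu]_x f x = 0.
Proof.
move=> dF cf IF If.
pose N n : R := n.+1%:R; have N0 n : 0 < N n by rewrite ltr0n.
pose w n x : R := 1 - (x / N n) ^+ 2.
pose w' n x : R := - (2 / N n * (x / N n)).
have dw n (x : R) : is_derive x 1 (w n) (w' n x).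
  have h : is_derive x 1 (fun x => (N n)^-1 * x) (N n)^-1.
    by have := is_deriveZ (N n)^-1 (is_derive_id x (1 : R)); rewrite /GRing.scale/= mulr1.
  have h2 := is_deriveX 2 h.
  have := is_deriveB (is_derive_cst (1:R) x (1:R)) h2.
  rewrite sub0r (_ : - _ = w' n x); last first.
    by rewrite /w' /GRing.scale/=; field; rewrite gt_eqF.
  by rewrite (_ : cst 1 - _ = w n)//; apply/funext => y; rewrite /w /= [y / _]mulrC.
have cw' n : continuous (w' n).
  move=> x; apply: cvgN; apply: cvgM; first exact: cvg_cst.
  by apply: cvgM; [exact: cvg_id|exact: cvg_cst].
have cw n : continuous (w n).
  by move=> y; apply/differentiable_continuous/derivable1_diffP; exact: ex_derive.
have cF : continuous F.
  by move=> y; apply/differentiable_continuous/derivable1_diffP; exact: ex_derive.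
pose A n : set (measurableTypeR R) := `[- N n, N n]%classic.
have mA n : measurable (A n) by exact: measurable_itv.
have J n : `|\int[mu]_(x in A n) (w n x * f x)| <= 2 / N n * \int[mu]_x `|F x|.
  rewrite (@Rintegration_by_parts _ (w n) F (w' n) f).
  - rewrite /w mulNr divff ?gt_eqF// sqrrN !expr1n subrr !mul0r subrr sub0r normrN.
    have I1 : mu.-integrable (A n) (fun x => (w' n x * F x)%:E).
      apply: continuous_compact_integrable; first exact: segment_compact.
      by apply: continuous_subspaceT => x; apply: cvgM; [exact: cw'|exact: cF].
    apply: le_trans (le_normr_Rintegral _ _) _ => //.
    have IFA : mu.-integrable (A n) (EFin \o F) by apply: (integrableS measurableT (mA n) _ IF); exact: subsetT.
    have InF : mu.-integrable setT (EFin \o (fun x => `|F x|)) by exact: integrable_norm.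
    have InFA : mu.-integrable (A n) (EFin \o (fun x => `|F x|)) by exact: integrable_norm.
    apply: (@le_trans _ _ (\int[mu]_(x in A n) (2 / N n * `|F x|))).
      apply: le_Rintegral => //; first exact: integrable_norm.
        exact: (integrableZl (mA n) (2 / N n) InFA).
      move=> x; rewrite /A /= in_itv/= => /andP[x1 x2].
      rewrite normrM ler_wpM2r// /w' normrN normrM (ger0_norm (_ : 0 <= 2 / N n)); last by rewrite divr_ge0// ltW.
      rewrite ler_piMr ?divr_ge0 ?(ltW (N0 n))// normrM normfV (gtr0_norm (N0 n)) ler_pdivrMr// mul1r.
      by rewrite ler_norml x1.
    rewrite RintegralZl// ler_wpM2l ?divr_ge0 ?(ltW (N0 n))//.
    rewrite /Rintegral fine_le//.
    + exact: integrable_fin_num.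
    + exact: integrable_fin_num.
    + by apply: ge0_subset_integral => //; exact: (measurable_int mu).
  - by have := N0 n; lra.
  - by apply: continuous_subspaceT => x; exact: cw'.
  - exact: derivable_oo_LRcontinuous_is_derive.
  - by move=> x _; rewrite derive1E; exact: derive_val.
  - by apply: continuous_subspaceT => x; exact: cf.
  - exact: derivable_oo_LRcontinuous_is_derive.
  - by move=> x _; rewrite derive1E; exact: derive_val.
have Nv : (fun n => (N n)^-1) @ \oo --> (0 : R) by exact: cvg_harmonic.
have J0 : (fun n => \int[mu]_(x in A n) (w n x * f x)) @ \oo --> (0 : R).
  apply/cvgrPdist_le => e e0.
  have h : (fun n => 2 / N n * \int[mu]_x `|F x|) @ \oo --> (0 : R).
    rewrite -[0 in X in _ --> X](mul0r (\int[mu]_x `|F x|)); apply: cvgM; last exact: cvg_cst.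
    rewrite -(mulr0 2); apply: cvgM => //; exact: cvg_cst.
  move/cvgrPdist_le : h => /(_ e e0); apply: filterS => n; rewrite !sub0r !normrN => h.
  apply: le_trans (J n) _; apply: le_trans h; exact: ler_norm.
(* The integrals of [J0] written over the whole line: domination by |f| gives them the limit \int f,
   to be compared with the limit 0. *)
pose f_ n x := ((w n x * f x) * \1_(A n) x)%:E.
have [|||||_ _] := @dominated_convergence _ _ _ mu setT measurableT f_ (EFin \o f) (EFin \o (fun x => `|f x|)).
- move=> n; apply/measurable_EFinP; apply: measurable_funM; last exact: measurable_indic.
  by apply: measurable_funM; apply: continuous_measurable_fun.
- exact: (measurable_int mu).
- apply/aeW => x _; apply/fine_cvgP; split; first exact: nearW.
  have cvw : (fun n => w n x * f x) @ \oo --> f x.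
    rewrite -[X in _ --> X]mul1r; apply: cvgM; last exact: cvg_cst.
    rewrite -[X in _ --> X](subr0 1); apply: cvgB; first exact: cvg_cst.
    have cvx : (fun n => x / N n) @ \oo --> (0 : R).
      by rewrite -(mulr0 x); apply: cvgM => //; exact: cvg_cst.
    by rewrite -(mulr0 0); exact: (cvgM cvx cvx).
  apply: cvg_trans cvw; apply: near_eq_cvg; near=> n.
  have xA : x \in A n.
    rewrite inE /A /= in_itv/= -ler_norml.
    apply: (@le_trans _ _ n%:R); last by rewrite /N ler_nat.
    by near: n; exact: nbhs_infty_ger.
  by rewrite /f_ /= indicE xA mulr1.
- exact: integrable_norm.
- apply/aeW => x n _; rewrite /f_ lee_fin indicE.
  case: (boolP (x \in A n)) => [|_]; last by rewrite mulr0 normr0.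
  rewrite inE /A /= in_itv/= => /andP[x1 x2]; rewrite mulr1 normrM ler_piMl//.
  rewrite /w ger0_norm; last first.
    rewrite subr_ge0 -(real_normK (num_real (x / N n))) exprn_ile1//.
    by rewrite normrM normfV (gtr0_norm (N0 n)) ler_pdivrMr// mul1r ler_norml x1.
  by rewrite gerBl sqr_ge0.
move=> h; have {}h : (fun n => \int[mu]_(x in A n) (w n x * f x)) @ \oo --> \int[mu]_x f x.
  rewrite [X in X @ _ --> _](_ : _ = fun n => fine (\int[mu]_x (f_ n x))%E).
    by apply: fine_cvg; rewrite fineK//; exact: integrable_fin_num.
  apply/funext => n; rewrite Rintegral_mkcond /Rintegral; congr fine; apply: eq_integral => x _.
  by rewrite /f_ patchE indicE; case: ifP => _; rewrite ?mulr1// mulr0.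
by apply: (cvg_unique _ h J0).
Unshelve. all: by end_near.
Qed.

End IntegralDerivative.

(** * Trigonometric approximation *)

Section MatrixNorm.
Variable R : realType.

Lemma norm_coord m n (v : 'M[R]_(m, n)) i j : `|v i j| <= `|v|.
Proof.
rewrite [leRHS]/Num.norm/= mx_normrE.
by apply: (le_bigmax _ (fun ij => `|v ij.1 ij.2|) (i, j)).
Qed.

Lemma norm_mx_le m n (v : 'M[R]_(m, n)) (c : R) : 0 <= c -> (forall i j, `|v i j| <= c) -> `|v| <= c.
Proof.
by move=> c0 vc; rewrite [leLHS]/Num.norm/= mx_normrE; apply: bigmax_le => // -[i j] _; exact: vc.
Qed.

Lemma trmx_continuous m n : continuous (@trmx R m n).
Proof.
move=> M s /= /nbhs_ballP [e e0 es]; apply/nbhs_ballP; exists e => //= N [_ MN].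
by apply: es; split => // i j; rewrite !mxE; exact: MN.
Qed.

Lemma bounded_closed_compact_cV n (A : set 'cV[R]_n) : bounded_set A -> closed A -> compact A.
Proof.
move=> bA cA; have -> : A = (@trmx R 1 n) @` ((@trmx R 1 n) @^-1` A).
  by apply/seteqP; split => [v Av|v [u Au <-]//]; exists v^T; rewrite /= ?trmxK.
apply: continuous_compact; first exact/continuous_subspaceT/trmx_continuous.
apply: bounded_closed_compact; last by apply: closed_comp => // ? _; exact: trmx_continuous.
move: bA => [M [Mr bM]]; exists M; split => // x Mx v Av.
apply: le_trans (bM x Mx _ Av); apply: norm_mx_le => // i j.
by have -> : v i j = v^T j i; [rewrite mxE|exact: norm_coord].
Qed.

Lemma compact_cball n (a : 'cV[R]_n) (M : R) : compact [set x | `|x - a| <= M].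
Proof.
apply: bounded_closed_compact_cV.
  exists (M + `|a|); split; first exact: num_real.
  move=> x Mx v /= va; apply: le_trans (ltW Mx).
  by rewrite -[v](subrK a) (le_trans (ler_normD _ _))// lerD2r.
rewrite (_ : [set x | _] = closed_ball_ Num.norm a M); first exact: closed_closed_ball_.
by apply/seteqP; split => x /=; rewrite distrC.
Qed.

(** Only x is confined to K; y may lie outside, as the grid points of the Bernstein approximation
    and the normalised estimator may. The near-covering form of compactness allows this. *)
Lemma compact_uniform_continuity n (f : 'cV[R]_n -> R) (K : set 'cV[R]_n) (eps : R) :
  continuous f -> compact K -> 0 < eps ->
  exists eta : R, 0 < eta /\ forall x y, K x -> `|x - y| <= eta -> `|f x - f y| <= eps.
Proof.
move=> cf /compact_near_coveringP cK e0.
have := cK R (0^'+)%R (fun eta x => forall y, `|x - y| <= eta -> `|f x - f y| <= eps) _.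
case.
  move=> x Kx; have e20 : 0 < eps / 2 by rewrite divr_gt0.
  have /cvgrPdist_le/(_ _ e20)/nbhs_ballP[r /= r0 rf] := cf x.
  have r20 : 0 < r / 2 by rewrite divr_gt0.
  exists (ball x (r / 2), [set eta : R | eta < r / 2]).
    by split => /=; [exact: nbhsx_ballx|exact: nbhs_right_lt].
  move=> [y eta] /= [xy eta2] z yz.
  rewrite (le_trans (ler_distD (f x) _ _))// (splitr eps) lerD//.
    rewrite distrC; apply: rf; apply: le_ball xy; lra.
  apply: rf; rewrite -ball_normE/=; move: xy; rewrite -ball_normE/= => xy.
  rewrite (le_lt_trans (ler_distD y _ _))// (splitr r) ltrD// (le_lt_trans yz)//.
move=> eta0 /= eta00 H; exists (eta0 / 2); split; first by rewrite divr_gt0.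
move=> x y Kx xy; apply: (H (eta0 / 2)) => //=.
  by rewrite sub0r normrN gtr0_norm ?divr_gt0// ltr_pdivrMr// mulr_natr mulr2n ltrDl.
by rewrite divr_gt0.
Qed.

End MatrixNorm.

Section SinInverse.
Variable R : realType.

(** In the addition formula cos v >= 7/8, sin dl >= 3 dl / 4, and the term sin v (cos dl - 1) costs
    at most dl / 8; 7/8 times 3/4 minus 1/8 exceeds 1/2. *)
Lemma sin_gap_r (v dl : R) : `|v| <= 1 / 2 -> 0 < dl -> dl <= 1 / 2 ->
  sin v + dl / 2 <= sin (v + dl).
Proof.
move=> v2 d0 d2; rewrite sinD.
have v0 := normr_ge0 v.
have h1 : `|sin v| <= 1/2 by apply: le_trans (norm_sin_le _) _.
have h2 : `|cos dl - 1| <= dl ^+ 2 / 2 by exact: norm_cosB1_le2.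
have h3 : `|cos v - 1| <= `|v| ^+ 2 / 2 by rewrite real_normK ?num_real//; exact: norm_cosB1_le2.
have h4 : `|sin dl - dl| <= dl ^+ 3 by rewrite -{3}(gtr0_norm d0); exact: norm_sinB_le3.
have c1 : 7 / 8 <= cos v by move: h3; rewrite ler_norml => /andP[+ _]; nra.
have c2 : (3 / 4) * dl <= sin dl.
  move: h4; rewrite ler_norml => /andP[+ _].
  have : dl ^+ 3 <= dl / 4 by rewrite exprSr; nra.
  lra.
have c3 : - (dl / 8) <= sin v * (cos dl - 1).
  have : `|sin v * (cos dl - 1)| <= dl / 8.
    rewrite normrM; apply: (@le_trans _ _ (1/2 * (dl ^+ 2 / 2))); first exact: ler_pM.
    by nra.
  by rewrite ler_norml => /andP[].
have : 7 / 8 * (3 / 4 * dl) <= cos v * sin dl.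
  by apply: ler_pM => //; nra.
lra.
Qed.

(** A quantitative inverse of sine: by monotonicity on [- pi/2, pi/2], a point u beyond v + dl or v
    - dl would have its sine at distance more than dl / 2 from sin v. *)
Lemma sin_sep (u v dl : R) : `|v| <= 1 / 2 -> - (pi / 2) <= u <= pi / 2 -> 0 < dl -> dl <= 1 / 2 ->
  `|sin u - sin v| < dl / 2 -> `|u - v| <= dl.
Proof.
move=> v2 uI d0 d2 suv.
have pi2 : 1 <= pi / 2 :> R by rewrite ler_pdivlMr// mul1r pi_ge2.
have /ler_normlP[v2l v2r] := v2.
have mono (a b : R) : - (pi/2) <= a <= pi/2 -> - (pi/2) <= b <= pi/2 -> a < b -> sin a < sin b.
  by move=> aI bI; rewrite ltr_sin ?in_itv.
have [//|] := leP `|u - v| dl; rewrite ltNge ler_norml negb_and -!ltNge => /orP[h|h]; exfalso.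
- have := sin_gap_r (v := - v) _ d0 d2; rewrite normrN => /(_ v2).
  have : sin u < sin (v - dl) by apply: mono => //; [apply/andP; split; lra|lra].
  rewrite (_ : - v + dl = - (v - dl)); last by lra.
  rewrite !sinN; move: suv; rewrite ltr_norml => /andP[]; lra.
- have := sin_gap_r v2 d0 d2.
  have : sin (v + dl) < sin u by apply: mono => //; [apply/andP; split; lra|lra].
  move: suv; rewrite ltr_norml => /andP[]; lra.
Qed.

End SinInverse.

Section TrigApproximation.
Variables (R : realType) (d : nat).
Implicit Types x u : 'cV[R]_d.

Definition dotc u x : R := (u^T *m x) 0 0.

Lemma dotcE u x : dotc u x = \sum_i u i 0 * x i 0.
Proof. by rewrite /dotc mxE; apply: eq_bigr => i _; rewrite mxE. Qed.

(** Each triple holds a coefficient, a frequency vector and a phase. Phases let cosines alone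
    express sines, so the class is stable under multiplication by sines. *)
Definition trigpoly (s : seq (R * 'cV[R]_d * R)) x : R :=
  \sum_(p <- s) p.1.1 * cos (dotc p.1.2 x + p.2).

Definition is_trigpoly (F : 'cV[R]_d -> R) := exists s, F = trigpoly s.

Lemma is_trigpoly_cst c : is_trigpoly (fun=> c).
Proof.
exists [:: (c, 0, 0)]; apply/funext => x.
by rewrite /trigpoly big_seq1/= /dotc trmx0 mul0mx mxE addr0 cos0 mulr1.
Qed.

Lemma is_trigpolyD F G : is_trigpoly F -> is_trigpoly G -> is_trigpoly (fun x => F x + G x).
Proof. by move=> [s ->] [t ->]; exists (s ++ t); apply/funext => x; rewrite /trigpoly big_cat. Qed.

Lemma is_trigpolyZ c F : is_trigpoly F -> is_trigpoly (fun x => c * F x).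
Proof.
move=> [s ->]; exists [seq (c * p.1.1, p.1.2, p.2) | p <- s]; apply/funext => x.
by rewrite /trigpoly big_map mulr_sumr; apply: eq_bigr => p _; rewrite mulrA.
Qed.

(** Product-to-sum: sin a cos b is half of sin (b + a) - sin (b - a), and the shifts by pi / 2 turn
    these sines into cosines. *)
Lemma is_trigpoly_sin h i F : is_trigpoly F -> is_trigpoly (fun x => sin (h * x i 0) * F x).
Proof.
move=> [s ->]; set u : 'cV[R]_d := h *: delta_mx i 0.
have uE x : dotc u x = h * x i 0.
  rewrite dotcE (bigD1 i)//= big1 ?addr0; first by rewrite !mxE !eqxx mulr1.
  by move=> j ji; rewrite !mxE (negbTE ji) mulr0 mul0r.
exists ([seq (p.1.1 / 2, p.1.2 + u, p.2 - pi / 2) | p <- s] ++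
        [seq (p.1.1 / 2, p.1.2 - u, p.2 + pi / 2) | p <- s]).
apply/funext => x; rewrite /trigpoly big_cat/= !big_map -big_split/= mulr_sumr.
apply: eq_bigr => p _; rewrite -uE.
have -> : dotc (p.1.2 + u) x = dotc p.1.2 x + dotc u x by rewrite /dotc linearD mulmxDl mxE.
have -> : dotc (p.1.2 - u) x = dotc p.1.2 x - dotc u x by rewrite /dotc linearB mulmxBl !mxE.
set a := dotc u x; set b := dotc _ x.
have -> : b + a + (p.2 - pi / 2) = (b + p.2) + a - pi / 2 by ring.
have -> : b - a + (p.2 + pi / 2) = ((b + p.2) - a) + pi / 2 by ring.
by rewrite cosDpihalf cosB cos_pihalf sin_pihalf mulr0 mulr1 add0r sinD sinB; field.
Qed.

Definition incr_at (i : 'I_d) (a : 'I_d -> nat) : 'I_d -> nat := fun j => (a j + (j == i))%N.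

(** Expectation of [phi] at the end of a walk started at [a], whose step indexed by i raises
    coordinate i with probability y_i. When every index is repeated m times this is the multivariate
    Bernstein operator. The recursion keeps it visibly polynomial in y. *)
Fixpoint walkE (y : 'I_d -> R) (s : seq 'I_d) (phi : ('I_d -> nat) -> R) (a : 'I_d -> nat) : R :=
  if s is i :: s' then
    y i * walkE y s' phi (incr_at i a) + (1 - y i) * walkE y s' phi a
  else phi a.

Lemma walkED y s phi psi a :
  walkE y s (fun b => phi b + psi b) a = walkE y s phi a + walkE y s psi a.
Proof. by elim: s a => //= i s IH a; rewrite !IH; ring. Qed.

Lemma walkEZ y s c phi a : walkE y s (fun b => c * phi b) a = c * walkE y s phi a.
Proof. by elim: s a => //= i s IH a; rewrite !IH; ring. Qed.

Lemma walkE_cst y s c a : walkE y s (fun=> c) a = c.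
Proof. by elim: s a => //= i s IH a; rewrite !IH; ring. Qed.

Lemma walkE_sum y s (phi : 'I_d -> ('I_d -> nat) -> R) a :
  walkE y s (fun b => \sum_i phi i b) a = \sum_i walkE y s (phi i) a.
Proof. by elim: s a => //= i s IH a; rewrite !IH !mulr_sumr -big_split. Qed.

Lemma walkE_le y s phi psi a : (forall i, 0 <= y i <= 1) ->
  (forall b, (forall i, (b i <= a i + count_mem i s)%N) -> phi b <= psi b) ->
  walkE y s phi a <= walkE y s psi a.
Proof.
move=> y01; elim: s a => /= [a h|i s IH a h]; first by apply: h => i; rewrite addn0.
have /andP[y0 y1] := y01 i.
apply: lerD; (apply: ler_wpM2l; [|apply: IH => b hb]) => //; rewrite ?subr_ge0//; apply: h => j;
  apply: leq_trans (hb j) _; rewrite /incr_at [i == j]eq_sym; lia.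
Qed.

(** Squared bias plus binomial variance; this is the input to the Chebyshev argument. *)
Lemma walkE_var y s i c a :
  walkE y s (fun b => ((b i)%:R - c) ^+ 2) a =
  ((a i)%:R + (count_mem i s)%:R * y i - c) ^+ 2 + (count_mem i s)%:R * (y i * (1 - y i)).
Proof.
elim: s a => /= [a|j s IH a]; first by rewrite !mul0r !addr0.
rewrite !IH /incr_at [i == j]eq_sym; case: (eqVneq j i) => [->|_] /=.
  by rewrite addn1 add1n -!natr1; ring.
by rewrite addn0 add0n; ring.
Qed.

Lemma walkE_trigpoly h s phi a :
  is_trigpoly (fun x => walkE (fun i => (1 + sin (h * x i 0)) / 2) s phi a).
Proof.
elim: s a => /= [a|i s IH a]; first exact: is_trigpoly_cst.
have -> : (fun x => (1 + sin (h * x i 0)) / 2 * walkE (fun i => (1 + sin (h * x i 0)) / 2) s phi (incr_at i a)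
    + (1 - (1 + sin (h * x i 0)) / 2) * walkE (fun i => (1 + sin (h * x i 0)) / 2) s phi a) =
  (fun x => (2^-1 * walkE (fun i => (1 + sin (h * x i 0)) / 2) s phi (incr_at i a) +
    2^-1 * (sin (h * x i 0) * walkE (fun i => (1 + sin (h * x i 0)) / 2) s phi (incr_at i a))) +
   (2^-1 * walkE (fun i => (1 + sin (h * x i 0)) / 2) s phi a +
    - 2^-1 * (sin (h * x i 0) * walkE (fun i => (1 + sin (h * x i 0)) / 2) s phi a))).
  by apply/funext => x; field.
by do 2 (apply: is_trigpolyD; apply: is_trigpolyD; apply: is_trigpolyZ => //; apply: is_trigpoly_sin => //).
Qed.

(* Bernstein approximation in the variables y_i = (1 + sin (h x_i)) / 2, which
   turns Bernstein polynomials into trigonometric polynomials; h is small enough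
   for sin (h x_i) to determine x_i on the box *)
Lemma trigpoly_approx (f : 'cV[R]_d -> R) (C M eps : R) : continuous f ->
  (forall x, `|f x| <= C) -> 0 < M -> 0 < eps ->
  exists s, (forall x, `|x| <= M -> `|trigpoly s x - f x| <= eps) /\
            (forall x, `|trigpoly s x| <= C).
Proof.
move=> cf fC M0 e0.
have C0 : 0 <= C by apply: le_trans (fC 0).
have e20 : 0 < eps / 2 by rewrite divr_gt0.
have [eta [eta0 feta]] := compact_uniform_continuity cf (@compact_cball R d 0 M) e20.
(* On the box this forces |h x_i| <= 1/2, the range in which [sin_sep] inverts the sine. *)
pose h : R := (2 * M)^-1; have h0 : 0 < h by rewrite invr_gt0 mulr_gt0.
pose dl : R := Num.min (h * eta) (1 / 2).
have dl0 : 0 < dl by rewrite lt_min divr_gt0// mulr_gt0.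
have dl2 : dl <= 1 / 2 by rewrite ge_min lexx orbT.
have dlh : dl <= h * eta by rewrite ge_min lexx.
(* Chebyshev constant: K times a squared deviation of at least (dl / 4)^2 exceeds 2 C, the largest
   possible gap between two values of f. The quarter arises because the sine is 2 y - 1 and
   [sin_sep] asks for dl / 2. *)
pose K : R := 2 * C / (dl / 4) ^+ 2; have K0 : 0 <= K by apply: divr_ge0; [exact: mulr_ge0|exact: sqr_ge0].
pose m := (Num.truncn (2 * (K * d%:R) / eps)).+1.
have mK : 2 * (K * d%:R) / eps < m%:R by rewrite truncnS_gt.
have m0 : 0 < m%:R :> R by rewrite ltr0n.
pose S := flatten [seq nseq m i | i <- enum 'I_d].
have cS i : count_mem i S = m.
  rewrite /S count_flatten -map_comp sumnE big_map big_enum /=.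
  rewrite (bigD1 i)//= big1 ?addn0; first by rewrite count_nseq /= eqxx mul1n.
  by move=> j ji; rewrite count_nseq/= (negbTE ji) mul0n.
(* The point whose variables y_i are the grid values b_i / m. *)
pose pt (b : 'I_d -> nat) : 'cV[R]_d := \col_i (asin (2 * ((b i)%:R / m%:R) - 1) / h).
pose y x i : R := (1 + sin (h * x i 0)) / 2.
have y01 x i : 0 <= y x i <= 1.
  have := sin_geN1 (h * x i 0); have := sin_le1 (h * x i 0); rewrite /y => *.
  by apply/andP; split; lra.
have [s Fs] := walkE_trigpoly h S (fun b => f (pt b)) (fun=> 0%N).
have {}Fs x : trigpoly s x = walkE (y x) S (fun b => f (pt b)) (fun=> 0%N).
  by rewrite -Fs.
exists s; split => x; last first.
  (* The approximant averages values of f, so it keeps the bound C on the whole space and not only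
     on the box. *)
  have lo := walkE_cst (y x) S (- C) (fun=> 0%N); have hi := walkE_cst (y x) S C (fun=> 0%N).
  rewrite Fs ler_norml -[X in X <= _]lo -[X in _ && (_ <= X)]hi; apply/andP; split;
    by apply: (walkE_le (y01 x)) => b _; have := fC (pt b); rewrite ler_norml => /andP[].
move=> xM.
(* One majorant for all grid points: eps / 2 covers those close to y by uniform continuity, the
   quadratic sum those far away. *)
pose psi (b : 'I_d -> nat) : R := eps / 2 + \sum_i (K / m%:R ^+ 2) * ((b i)%:R - m%:R * y x i) ^+ 2.
have key b : (forall i, (b i <= m)%N) -> `|f (pt b) - f x| <= psi b.
  move=> bm.
  have sum0 i : 0 <= (K / m%:R ^+ 2) * ((b i)%:R - m%:R * y x i) ^+ 2.
    by apply: mulr_ge0; [apply: divr_ge0 => //; exact: sqr_ge0|exact: sqr_ge0].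
  have [/existsP[i bi]|/existsPn bad] := boolP [exists i, dl / 4 <= `|(b i)%:R / m%:R - y x i|].
    have : 2 * C <= psi b.
      rewrite /psi (bigD1 i)//=; set T1 := \sum_(_ | _) _.
      have : 0 <= T1 by apply: sumr_ge0.
      have : 2 * C <= K / m%:R ^+ 2 * ((b i)%:R - m%:R * y x i) ^+ 2.
        have -> : K / m%:R ^+ 2 * ((b i)%:R - m%:R * y x i) ^+ 2 = K * `|(b i)%:R / m%:R - y x i| ^+ 2.
          by rewrite real_normK ?num_real//; field; rewrite gt_eqF.
        rewrite /K -mulrA ler_peMr ?mulr_ge0// mulrC ler_pdivlMr ?mul1r; last by rewrite exprn_gt0// divr_gt0.
        by rewrite ler_pXn2r ?nnegrE//; apply: divr_ge0 => //; exact: ltW.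
      lra.
    apply: le_trans; apply: le_trans (ler_normB _ _) _.
    by have := fC (pt b); have := fC x; lra.
  have : `|f (pt b) - f x| <= eps / 2.
    rewrite distrC; apply: feta; first by rewrite /= subr0.
    apply: norm_mx_le; first exact: ltW.
    move=> i j; rewrite ord1 !mxE distrC -(ler_pM2l h0) -{1}(gtr0_norm h0) -normrM mulrBr.
    rewrite mulrC divfK ?gt_eqF//; apply: le_trans dlh.
    have b01 : 0 <= ((b i)%:R / m%:R : R) <= 1.
      apply/andP; split; first exact: divr_ge0.
      by rewrite ler_pdivrMr// mul1r ler_nat bm.
    have [|I sE] := @asin_def R (2 * ((b i)%:R / m%:R) - 1).
      by move: b01 => /andP[? ?]; apply/andP; split; lra.
    apply: sin_sep => //.
      rewrite normrM gtr0_norm// /h mulrC ler_pdivrMr ?mulr_gt0//.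
      by have := norm_coord x i 0; lra.
    rewrite sE; have := bad i; rewrite -ltNge /y.
    have -> : 2 * ((b i)%:R / m%:R) - 1 - sin (h * x i 0) =
      2 * ((b i)%:R / m%:R - (1 + sin (h * x i 0)) / 2) by field; rewrite gt_eqF.
    by rewrite normrM gtr0_norm//; lra.
  move=> /le_trans; apply; rewrite /psi lerDl; exact: sumr_ge0.
have Epsi : walkE (y x) S psi (fun=> 0%N) <= eps.
  rewrite /psi walkED walkE_cst walkE_sum [leRHS]splitr lerD2l.
  apply: (@le_trans _ _ (\sum_(i < d) (K / m%:R))).
    apply: ler_sum => i _; rewrite walkEZ walkE_var cS add0r subrr expr0n/= add0r.
    have : y x i * (1 - y x i) <= 1 by have /andP[? ?] := y01 x i; nra.
    move=> h1; set t := _ * (1 - _) in h1 *.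
    have -> : K / m%:R ^+ 2 * (m%:R * t) = K / m%:R * t by field; rewrite gt_eqF.
    by rewrite ler_piMr// divr_ge0.
  rewrite sumr_const card_ord -[leLHS]mulr_natr.
  move: mK; rewrite ltr_pdivrMr// => mK. rewrite [leLHS]mulrAC ler_pdivrMr//.
  by move: mK; set u := K * d%:R; lra.
have bS b : (forall i, (b i <= (fun=> 0) i + count_mem i S)%N) -> `|f (pt b) - f x| <= psi b.
  by move=> bS; apply: key => i; have := bS i; rewrite cS.
rewrite Fs ler_distl; apply/andP; split.
- apply: (@le_trans _ _ (walkE (y x) S (fun b => f x + -1 * psi b) (fun=> 0%N))).
    by rewrite walkED walkE_cst walkEZ mulN1r lerD2l lerN2.
  by apply: (walkE_le (y01 x)) => b /bS; rewrite ler_distl mulN1r => /andP[].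
- apply: (@le_trans _ _ (walkE (y x) S (fun b => f x + psi b) (fun=> 0%N))).
    by apply: (walkE_le (y01 x)) => b /bS; rewrite ler_distl => /andP[].
  by rewrite walkED walkE_cst lerD2l.
Qed.

End TrigApproximation.

(** * Continuously differentiable functions of several variables *)

Section DirectionalDerivative.
Variables (R : realType) (d : nat).
Implicit Types (F G : 'cV[R]_d -> R) (a p v t : 'cV[R]_d).

Lemma is_derive_line F p v (c l : R) :
  is_derive (p + c *: v) v F l <-> is_derive c 1 (fun s : R => F (p + s *: v)) l.
Proof.
have E : (fun h => h^-1 *: ((F \o shift (p + c *: v)) (h *: v) - F (p + c *: v))) =
         (fun h => h^-1 *: (((fun s : R => F (p + s *: v)) \o shift c) (h *: 1) - F (p + c *: v))).
  by apply/funext => h /=; rewrite [h%:A]mulr1 scalerDl addrCA.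
split=> -[dF <-].
  by apply: DeriveDef; rewrite /derivable/derive -?E.
by apply: DeriveDef; rewrite /derivable/derive E.
Qed.

Lemma line_continuous p v : continuous (fun s : R => p + s *: v).
Proof.
by move=> s; apply: cvgD; [exact: cvg_cst|apply: cvgZr_tmp; exact: cvg_id].
Qed.

Lemma near_is_derive F G a v (l : R) : (\forall x \near a, F x = G x) ->
  is_derive a v F l -> is_derive a v G l.
Proof.
move=> FG; have FGa : F a = G a by exact: nbhs_singleton FG.
rewrite -{1 2}[a](addr0 a) -(scale0r v) => /is_derive_line -[dF dFl]; apply/is_derive_line.
have e : (fun h => h^-1 *: (((fun s : R => F (a + s *: v)) \o shift 0) (h *: 1) - F (a + 0 *: v))) =
  (fun h => h^-1 *: (F (a + h *: v) - F a)).
  by apply/funext => h /=; rewrite [h%:A]mulr1 addr0 scale0r addr0.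
have e' : (fun h => h^-1 *: (((fun s : R => G (a + s *: v)) \o shift 0) (h *: 1) - G (a + 0 *: v))) =
  (fun h => h^-1 *: (G (a + h *: v) - G a)).
  by apply/funext => h /=; rewrite [h%:A]mulr1 addr0 scale0r addr0.
have N : \forall h \near (0 : R)^', h^-1 *: (F (a + h *: v) - F a) = h^-1 *: (G (a + h *: v) - G a).
  have cv : (fun s : R => a + s *: v) s @[s --> (0:R)] --> a.
    by have := @line_continuous a v 0; rewrite /continuous_at scale0r addr0.
  have N0 : nbhs (0 : R) [set h | F (a + h *: v) = G (a + h *: v)] by exact: (cv _ FG).
  by apply: cvg_within; apply: filterS N0 => h /= ->; rewrite FGa.
have cG : (h^-1 *: (G (a + h *: v) - G a)) @[h --> (0:R)^'] --> l.
  apply: cvg_trans (near_eq_cvg N) _; rewrite -e.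
  by rewrite -dFl; exact: dF.
apply: DeriveDef; first by rewrite /derivable e'; apply/cvg_ex; exists l.
by rewrite /derive e'; exact: cvg_lim.
Qed.

Lemma MVT01 (f df : R -> R) : (forall c : R, 0 <= c <= 1 -> is_derive c 1 f (df c)) ->
  exists c, 0 <= c <= 1 /\ f 1 - f 0 = df c.
Proof.
move=> fd.
have fc : {within `[0, 1], continuous f}.
  apply: continuous_in_subspaceT => x; rewrite inE/= in_itv/= => x01.
  by apply/differentiable_continuous/derivable1_diffP; exact: (@ex_derive _ _ _ _ _ _ _ (fd x x01)).
have dfd (x : R) : x \in `]0, 1[%R -> is_derive x 1 f (df x).
  by rewrite in_itv/= => /andP[x0 x1]; apply: fd; rewrite !ltW.
have [c] := MVT ltr01 dfd fc.
by rewrite in_itv/= subr0 mulr1 => /andP[x0 x1] e; exists c; rewrite !ltW.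
Qed.

Variable Theta : set 'cV[R]_d.
Hypothesis oT : open Theta.

Definition C1_on F := forall t, Theta t -> {for t, continuous F} /\
  forall i, derivable F t (delta_mx i 0) /\ {for t, continuous (pd i F)}.

Lemma C1_pd F t i : C1_on F -> Theta t -> is_derive t (delta_mx i 0) F (pd i F t).
Proof. by move=> cF Tt; have [_ /(_ i)[dF _]] := cF t Tt; apply: DeriveDef. Qed.

Lemma pd_continuous_near F G i t : (forall t, Theta t -> pd i F t = G t) -> Theta t ->
  {for t, continuous G} -> {for t, continuous (pd i F)}.
Proof.
move=> FG Tt cG; have N : \forall x \near t, G x = pd i F x.
  have : nbhs t Theta by apply: open_nbhs_nbhs; split.
  by apply: filterS => x Tx; rewrite FG.
rewrite /prop_for/continuous_at FG//.
exact: cvg_trans (near_eq_cvg N) cG.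
Qed.

Lemma C1_onP F (G : 'I_d -> 'cV[R]_d -> R) : (forall t, Theta t -> {for t, continuous F}) ->
  (forall t i, Theta t -> is_derive t (delta_mx i 0) F (G i t)) ->
  (forall t i, Theta t -> {for t, continuous (G i)}) -> C1_on F.
Proof.
move=> cF dF cG t Tt; split; first exact: cF.
move=> i; split; first by case: (dF t i Tt).
apply: (pd_continuous_near (G := G i)) => //; last exact: cG.
by move=> x Tx; case: (dF x i Tx).
Qed.

Lemma C1_onD F G : C1_on F -> C1_on G -> C1_on (fun t => F t + G t).
Proof.
move=> cF cG; apply: (@C1_onP _ (fun i t => pd i F t + pd i G t)).
- by move=> t Tt; exact: continuousD (cF t Tt).1 (cG t Tt).1.
- by move=> t i Tt; apply: is_deriveD; exact: C1_pd.
- by move=> t i Tt; exact: continuousD ((cF t Tt).2 i).2 ((cG t Tt).2 i).2.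
Qed.

Lemma C1_onN F : C1_on F -> C1_on (fun t => - F t).
Proof.
move=> cF; apply: (@C1_onP _ (fun i t => - pd i F t)).
- by move=> t Tt; exact: continuousN (cF t Tt).1.
- by move=> t i Tt; apply: is_deriveN; exact: C1_pd.
- by move=> t i Tt; exact: continuousN ((cF t Tt).2 i).2.
Qed.

Lemma C1_onM F G : C1_on F -> C1_on G -> C1_on (fun t => F t * G t).
Proof.
move=> cF cG; apply: (@C1_onP _ (fun i t => F t * pd i G t + G t * pd i F t)).
- by move=> t Tt; exact: continuousM (cF t Tt).1 (cG t Tt).1.
- by move=> t i Tt; apply: is_deriveM; exact: C1_pd.
- move=> t i Tt; apply: continuousD.
  + exact: continuousM (cF t Tt).1 ((cG t Tt).2 i).2.
  + exact: continuousM (cG t Tt).1 ((cF t Tt).2 i).2.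
Qed.

Lemma is_derive_comp1 (h : R -> R) (dh : R) F t v (l : R) : is_derive t v F l ->
  is_derive (F t) 1 h dh -> is_derive t v (fun x => h (F x)) (dh * l).
Proof.
rewrite -{1 3}[t](addr0 t) -(scale0r v) => /is_derive_line dF dh'; apply/is_derive_line.
have dh2 : is_derive (F (t + 0 *: v)) 1 h dh by rewrite scale0r addr0.
exact: (@is_derive1_comp _ h (fun s : R => F (t + s *: v)) 0 dh l dh2 dF).
Qed.

Lemma C1_on_comp (h h' : R -> R) F : (forall x : R, is_derive x 1 h (h' x)) -> continuous h' ->
  C1_on F -> C1_on (fun t => h (F t)).
Proof.
move=> dh ch' cF.
have ch : continuous h.
  by move=> y; apply/differentiable_continuous/derivable1_diffP; exact: ex_derive.
apply: (@C1_onP _ (fun i t => h' (F t) * pd i F t)).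
- by move=> t Tt; exact: (continuous_comp (cF t Tt).1 (ch _)).
- by move=> t i Tt; apply: is_derive_comp1; exact: C1_pd.
- move=> t i Tt; apply: continuousM; last exact: ((cF t Tt).2 i).2.
  exact: (continuous_comp (cF t Tt).1 (ch' _)).
Qed.

Lemma is_derive_scale F t v (r l : R) : is_derive t v F l -> is_derive t (r *: v) F (r * l).
Proof.
rewrite -{1 2}[t](addr0 t) -(scale0r v) => /is_derive_line dF.
have -> : t + 0 *: v = t + 0 *: (r *: v) by rewrite !scale0r.
apply/is_derive_line.
have -> : (fun s : R => F (t + s *: (r *: v))) = (fun u : R => F (t + u *: v)) \o (fun s => r * s).
  by apply/funext => s /=; rewrite scalerA mulrC.
rewrite mulrC; apply: is_derive1_comp; first by rewrite mulr0.
by have := is_deriveZ r (is_derive_id (0 : R) (1 : R)); rewrite /GRing.scale/= mulr1.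
Qed.

(** Continuous partial derivatives give total differentiability: pass from t to t + w one coordinate
    at a time and apply the mean value theorem on each leg. *)
Lemma C1_frechet F t (eps : R) : C1_on F -> Theta t -> 0 < eps ->
  exists dl : R, 0 < dl /\ forall w, `|w| <= dl ->
    `|F (t + w) - F t - \sum_k w k 0 * pd k F t| <= eps * \sum_k `|w k 0|.
Proof.
move=> cF Tt e0.
have nT : nbhs t Theta by apply: open_nbhs_nbhs; split.
have nk (k : 'I_d) : \forall x \near t, `|pd k F t - pd k F x| <= eps.
  by have := ((cF t Tt).2 k).2 => /cvgrPdist_le/(_ _ e0).
have : \forall x \near t, Theta x /\ forall k, `|pd k F t - pd k F x| <= eps.
  by apply: filterS (filterI nT (filter_forall (nbhs_filter t) nk)) => x [Tx xk]; split.
move=> /nbhs_ballP[r /= r0 rb].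
exists (r / 2); split; first by rewrite divr_gt0.
move=> w wr.
have inb x : `|x - t| <= `|w| -> Theta x /\ forall k, `|pd k F t - pd k F x| <= eps.
  move=> xw; apply: rb; rewrite -ball_normE/= distrC.
  apply: le_lt_trans xw _; apply: le_lt_trans wr _; by rewrite ltr_pdivrMr// mulr_natr mulr2n ltrDl.
(* The displacement after the first m coordinates have been moved. *)
pose W m : 'cV[R]_d := \col_k (if (k < m)%N then w k 0 else 0).
have W0 : W 0%N = 0 by apply/matrixP => i j; rewrite !mxE.
have Wd : W d = w by apply/matrixP => i j; rewrite !mxE ltn_ord ord1.
have WS (k : 'I_d) : W k.+1 = W k + w k 0 *: delta_mx k 0.
  apply/matrixP => i j; rewrite !mxE ltnS leq_eqVlt val_eqE ord1 eqxx andbT.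
  by case: (eqVneq i k) => [->|ik] /=; rewrite ?ltnn ?mulr1 ?add0r ?mulr0 ?addr0.
have tele : F (t + w) - F t = \sum_(k < d) (F (t + W k.+1) - F (t + W k)).
  rewrite -{1}Wd -{2}[t](addr0 t) -W0 -(big_mkord xpredT (fun k => F (t + W k.+1) - F (t + W k))).
  by rewrite (telescope_sumr (fun k => F (t + W k))).
rewrite tele -sumrB mulr_sumr; apply: le_trans (ler_norm_sum _ _ _) _.
apply: ler_sum => k _.
pose v : 'cV[R]_d := w k 0 *: delta_mx k 0; have WSk : W k.+1 = W k + v := WS k.
have inS c : 0 <= c <= 1 -> `|t + W k + c *: v - t| <= `|w|.
  move=> /andP[c0 c1]; rewrite (_ : _ - t = W k + c *: v); last by rewrite -[t + W k + _]addrA addrAC subrr add0r.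
  apply: norm_mx_le => // i j; rewrite !mxE ord1 eqxx andbT.
  case: (eqVneq i k) => [->|ik]; rewrite ?ltnn ?mulr1 ?mulr0 ?addr0 ?add0r.
    rewrite normrM (ger0_norm c0); apply: le_trans (ler_piMl _ c1) _ => //; exact: norm_coord.
  by case: ifP => _; rewrite ?normr0//; exact: norm_coord.
have [c c01|c [c01]] := @MVT01 (fun s => F (t + W k + s *: v)) (fun s => w k 0 * pd k F (t + W k + s *: v)).
  apply/is_derive_line; apply: is_derive_scale; apply: C1_pd => //.
  exact: (inb _ (inS c c01)).1.
rewrite scale1r scale0r addr0 -addrA -WSk => ->.
rewrite -mulrBr normrM mulrC distrC ler_wpM2r//.
exact: (inb _ (inS c c01)).2.
Qed.

Lemma C1_line F p v (s : R) : C1_on F -> Theta (p + s *: v) ->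
  is_derive s 1 (fun s => F (p + s *: v)) (\sum_k v k 0 * pd k F (p + s *: v)).
Proof.
move=> cF Tt; apply/is_derive_line; set t := p + s *: v in Tt *.
set l := \sum_k _.
rewrite -[t](addr0 t) -(scale0r v); apply/is_derive_line.
have e : (fun h => h^-1 *: (((fun s : R => F (t + s *: v)) \o shift 0) (h *: 1) - F (t + 0 *: v))) =
  (fun h => h^-1 *: (F (t + h *: v) - F t)).
  by apply/funext => h /=; rewrite [h%:A]mulr1 addr0 scale0r addr0.
have cG : (h^-1 *: (F (t + h *: v) - F t)) @[h --> (0:R)^'] --> l.
  apply/cvgrPdist_le => eps e0.
  pose V := \sum_k `|v k 0| + 1.
  have V0 : 0 < V by rewrite ltr_wpDl// sumr_ge0.
  have [dl [dl0 H]] := C1_frechet cF Tt (divr_gt0 e0 V0).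
  pose r := dl / (`|v| + 1); have r0 : 0 < r by rewrite divr_gt0// ltr_wpDl.
  near=> h.
  have h0 : h != 0 by near: h; exact: nbhs_dnbhs_neq.
  have hr : `|h| <= r.
    near: h; apply: cvg_within; apply/nbhs_ballP; exists r => //= x.
    by rewrite -ball_normE/= sub0r normrN => /ltW.
  have hv : `|h *: v| <= dl.
    rewrite normrZ; apply: le_trans (ler_wpM2r _ hr) _ => //.
    by rewrite /r -mulrA ger_pMr// ler_pdivrMl ?mulr1 ?lerDl// ltr_wpDl.
  have := H _ hv.
  have -> : \sum_k (h *: v) k 0 * pd k F t = h * l.
    by rewrite /l mulr_sumr; apply: eq_bigr => k _; rewrite mxE mulrA.
  have -> : \sum_k `|(h *: v) k 0| = `|h| * \sum_k `|v k 0|.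
    by rewrite mulr_sumr; apply: eq_bigr => k _; rewrite mxE normrM.
  have -> : l - h^-1 *: (F (t + h *: v) - F t) = - (h^-1 * (F (t + h *: v) - F t - h * l)).
    by rewrite /GRing.scale/=; field.
  rewrite normrN normrM normfV ler_pdivrMl ?normr_gt0// => H1.
  apply: le_trans H1 _; rewrite mulrCA ler_wpM2l//.
  by rewrite mulrAC ler_pdivrMr// ler_pM2l// /V lerDl.
apply: DeriveDef; first by rewrite /derivable e; apply/cvg_ex; exists l.
by rewrite /derive e; exact: cvg_lim.
Unshelve. all: by end_near.
Qed.

Hypothesis cT : convex_set_cV Theta.

Lemma convex_line t t' (c : R) : Theta t -> Theta t' -> 0 <= c <= 1 -> Theta (t + c *: (t' - t)).
Proof.
move=> Tt Tt' c01; have := cT Tt Tt' c01; congr Theta.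
by rewrite scalerBl scale1r scalerBr addrAC addrA.
Qed.

Lemma C1_mean_value F t t' (B : R) : C1_on F -> (forall x, Theta x -> forall k, `|pd k F x| <= B) ->
  Theta t -> Theta t' -> `|F t' - F t| <= B * \sum_k `|(t' - t) k 0|.
Proof.
move=> cF bF Tt Tt'; set v := t' - t.
have [c c01|c [c01]] := @MVT01 (fun s => F (t + s *: v)) (fun s => \sum_k v k 0 * pd k F (t + s *: v)).
  by apply: C1_line => //; exact: convex_line.
rewrite scale1r scale0r addr0 subrKC => ->.
apply: le_trans (ler_norm_sum _ _ _) _; rewrite mulr_sumr; apply: ler_sum => k _.
rewrite normrM mulrC ler_wpM2r//; apply: bF; exact: convex_line.
Qed.

(** The mean value theorem along the segment leaves a difference of first derivatives, to which the
    mean value bound is applied again; this costs the factor 1/2 of the usual remainder. *)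
Lemma C1_taylor F t t' (B : R) : C1_on F -> (forall j, C1_on (pd j F)) ->
  (forall x, Theta x -> forall j k, `|pd k (pd j F) x| <= B) ->
  Theta t -> Theta t' ->
  `|F t' - F t - \sum_k (t' - t) k 0 * pd k F t| <= B * (\sum_k `|(t' - t) k 0|) ^+ 2.
Proof.
move=> cF cF' bF Tt Tt'; set v := t' - t.
have [c c01|c [c01]] := @MVT01 (fun s => F (t + s *: v)) (fun s => \sum_k v k 0 * pd k F (t + s *: v)).
  by apply: C1_line => //; exact: convex_line.
rewrite scale1r scale0r addr0 subrKC => ->.
rewrite -sumrB expr2 mulrA; apply: le_trans (ler_norm_sum _ _ _) _.
rewrite [leRHS]mulrC mulr_suml; apply: ler_sum => k _.
rewrite -mulrBr normrM ler_wpM2l//.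
have Tc := convex_line Tt Tt' c01.
apply: le_trans (C1_mean_value (cF' k) (fun x Tx j => bF x Tx k j) Tt Tc) _.
have [c0 c1] := andP c01.
have B0 (i : 'I_d) : 0 <= B by apply: le_trans (bF _ Tt k k).
rewrite ler_wpM2l ?(B0 k)//; apply: ler_sum => j _.
rewrite addrC addKr mxE normrM (ger0_norm c0) ler_piMl//.
Qed.

End DirectionalDerivative.

Lemma cvg_sumR (R : realType) (T I : Type) (F : set_system T) (FF : Filter F) (r : seq I)
  (f : I -> T -> R) (l : I -> R) : (forall i, f i x @[x --> F] --> l i) ->
  \sum_(i <- r) f i x @[x --> F] --> \sum_(i <- r) l i.
Proof.
move=> fl; elim: r => [|i r IH].
  rewrite big_nil (_ : (fun x => _) = fun=> 0); first exact: cvg_cst.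
  by apply/funext => x; rewrite big_nil.
rewrite big_cons (_ : (fun x => _) = fun x => f i x + \sum_(j <- r) f j x).
  exact: cvgD.
by apply/funext => x; rewrite big_cons.
Qed.

(** * Positive definite matrices *)

Section Euclidean.
Variables (R : realType) (d : nat).
Implicit Types (u v w : 'cV[R]_d) (A B M Y : 'M[R]_d).

Lemma dotcC u v : dotc u v = dotc v u.
Proof. by rewrite !dotcE; apply: eq_bigr => i _; rewrite mulrC. Qed.

Lemma dotcDr u v w : dotc u (v + w) = dotc u v + dotc u w.
Proof. by rewrite /dotc mulmxDr mxE. Qed.

Lemma dotcZr u (a : R) v : dotc u (a *: v) = a * dotc u v.
Proof. by rewrite /dotc -scalemxAr mxE. Qed.

Lemma dotcDl u v w : dotc (u + v) w = dotc u w + dotc v w.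
Proof. by rewrite dotcC dotcDr !(dotcC w). Qed.

Lemma dotcZl (a : R) u v : dotc (a *: u) v = a * dotc u v.
Proof. by rewrite dotcC dotcZr dotcC. Qed.

Lemma dotcNr u v : dotc u (- v) = - dotc u v.
Proof. by rewrite -scaleN1r dotcZr mulN1r. Qed.

Lemma dotcBr u v w : dotc u (v - w) = dotc u v - dotc u w.
Proof. by rewrite dotcDr dotcNr. Qed.

Lemma dotcBl u v w : dotc (u - v) w = dotc u w - dotc v w.
Proof. by rewrite dotcC dotcBr !(dotcC w). Qed.

Lemma dotc_mx u A v : dotc u (A *m v) = dotc (A^T *m u) v.
Proof. by rewrite /dotc trmx_mul trmxK mulmxA. Qed.

Lemma qformE A v : qform A v = dotc v (A *m v).
Proof. by rewrite /qform /dotc mulmxA. Qed.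

Lemma dotc_ge0 v : 0 <= dotc v v.
Proof. by rewrite dotcE; apply: sumr_ge0 => i _; rewrite -expr2 sqr_ge0. Qed.

Lemma dotc_eq0 v : dotc v v = 0 -> v = 0.
Proof.
rewrite dotcE => /eqP; rewrite psumr_eq0; last by move=> i _; rewrite -expr2 sqr_ge0.
move=> /allP v0; apply/matrixP => i j; rewrite ord1 mxE.
by have /implyP/(_ isT) := v0 i (mem_index_enum i); rewrite -expr2 sqrf_eq0 => /eqP.
Qed.

Lemma enormE v : enorm v ^+ 2 = dotc v v.
Proof. by rewrite /enorm sqr_sqrtr// dotc_ge0. Qed.

Lemma enorm_ge0 v : 0 <= enorm v.
Proof. exact: sqrtr_ge0. Qed.

Lemma cauchy_schwarz u v : `|dotc u v| <= enorm u * enorm v.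
Proof.
rewrite -(@ler_pXn2r _ 2)// ?nnegrE ?mulr_ge0 ?enorm_ge0// exprMn !enormE real_normK ?num_real//.
have [v0|v0] := eqVneq (dotc v v) 0.
  by rewrite (dotc_eq0 v0) /dotc !mulmx0 !mxE expr0n mulr0.
have v0' : 0 < dotc v v by rewrite lt_neqAle eq_sym v0 dotc_ge0.
have := dotc_ge0 (dotc v v *: u - dotc u v *: v).
rewrite dotcBr !dotcZr !(dotcC (_ - _)) !dotcBr !dotcZr (dotcC v u).
set a := dotc u u; set b := dotc u v; set c := dotc v v.
have -> : c * (c * a - b * b) - b * (c * b - b * c) = c * (a * c - b ^+ 2) by ring.
by rewrite pmulr_rge0// subr_ge0.
Qed.

Lemma enormD u v : enorm (u + v) <= enorm u + enorm v.
Proof.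
rewrite -(@ler_pXn2r _ 2)// ?nnegrE ?addr_ge0 ?enorm_ge0// sqrrD !enormE dotcDr !dotcDl (dotcC v u).
have := cauchy_schwarz u v; rewrite ler_norml => /andP[_]; lra.
Qed.

Lemma enormZ (a : R) v : enorm (a *: v) = `|a| * enorm v.
Proof.
apply/eqP; rewrite -(@eqrXn2 _ 2)// ?mulr_ge0 ?enorm_ge0// exprMn !enormE dotcZl dotcZr.
by rewrite mulrA -expr2 real_normK ?num_real.
Qed.

Lemma enormN v : enorm (- v) = enorm v.
Proof. by rewrite -scaleN1r enormZ normrN1 mul1r. Qed.

Lemma coord_le_enorm v i : `|v i 0| <= enorm v.
Proof.
rewrite -(@ler_pXn2r _ 2)// ?nnegrE ?enorm_ge0// enormE dotcE (bigD1 i)//= real_normK ?num_real//.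
by rewrite -expr2 lerDl; apply: sumr_ge0 => j _; rewrite -expr2 sqr_ge0.
Qed.

Lemma norm_le_enorm v : `|v| <= enorm v.
Proof. by apply: norm_mx_le => [|i j]; rewrite ?enorm_ge0// ord1 coord_le_enorm. Qed.

Lemma enorm_le_norm v : enorm v <= d%:R * `|v|.
Proof.
rewrite -(@ler_pXn2r _ 2)// ?nnegrE ?enorm_ge0// ?mulr_ge0// enormE dotcE.
apply: (@le_trans _ _ (\sum_(i < d) `|v| ^+ 2)).
  apply: ler_sum => i _; rewrite -expr2 -(real_normK (num_real (v i 0))).
  by rewrite ler_pXn2r ?nnegrE//; exact: norm_coord.
rewrite sumr_const card_ord exprMn -[leLHS]mulr_natl ler_wpM2r ?sqr_ge0//.
by rewrite -natrX ler_nat; case: (d) => // n; rewrite -mulnn leq_pmull.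
Qed.

Definition opb A (r : R) := forall v, enorm (A *m v) <= r * enorm v.

Lemma opbD A B r s : opb A r -> opb B s -> opb (A + B) (r + s).
Proof. by move=> Ar Bs v; rewrite mulmxDl mulrDl; apply: le_trans (enormD _ _) (lerD (Ar v) (Bs v)). Qed.

Lemma opbZ a A r : opb A r -> opb (a *: A) (`|a| * r).
Proof. by move=> Ar v; rewrite -scalemxAl enormZ -mulrA ler_wpM2l. Qed.

Lemma opbM A B r s : 0 <= r -> opb A r -> opb B s -> opb (A *m B) (r * s).
Proof. by move=> r0 Ar Bs v; rewrite -mulmxA -mulrA; apply: le_trans (Ar _) _; rewrite ler_wpM2l. Qed.

Lemma delta_coord A i j : A i j = (A *m (delta_mx j 0 : 'cV[R]_d)) i 0.
Proof.
rewrite mxE (bigD1 j)//= big1 ?addr0; first by rewrite mxE !eqxx mulr1.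
by move=> k kj; rewrite mxE (negbTE kj) mulr0.
Qed.

Lemma opb_coord A r i j : opb A r -> `|A i j| <= r.
Proof.
move=> Ar; rewrite delta_coord; apply: le_trans (coord_le_enorm _ _) _; apply: le_trans (Ar _) _.
have -> : enorm (delta_mx j 0 : 'cV[R]_d) = 1.
  apply/eqP; rewrite -(@eqrXn2 _ 2)// ?enorm_ge0// expr1n enormE dotcE (bigD1 j)//= big1 ?addr0.
    by rewrite mxE !eqxx mulr1.
  by move=> k kj; rewrite mxE (negbTE kj) mul0r.
by rewrite mulr1.
Qed.

Lemma coord_opb A r : (forall i j, `|A i j| <= r) -> opb A (d%:R ^+ 2 * r).
Proof.
move=> Ar v; have r0 (i : 'I_d) : 0 <= r by apply: le_trans (Ar i i).
apply: le_trans (enorm_le_norm _) _; rewrite expr2 -!mulrA ler_wpM2l//.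
have H : `|A *m v| <= \sum_(j < d) r * enorm v.
  apply: norm_mx_le => [|i k].
    by apply: sumr_ge0 => j _; rewrite mulr_ge0 ?enorm_ge0 ?(r0 j).
  rewrite ord1 mxE; apply: le_trans (ler_norm_sum _ _ _) _; apply: ler_sum => j _.
  by rewrite normrM ler_pM// coord_le_enorm.
by apply: le_trans H _; rewrite sumr_const card_ord mulr_natl.
Qed.

End Euclidean.

(** * Matrix square root by successive approximation *)

Section SquareRoot.
Variables (R : realType) (d : nat).
Implicit Types (u v w : 'cV[R]_d) (A B M Y : 'M[R]_d).

(** Iteration towards a fixed point of Y = (B + Y^2) / 2. At such a Y, (1 - Y)^2 = 1 - B, so 1 - Y
    is a square root of 1 - B. *)
Fixpoint sqrt_iter B k : 'M[R]_d :=
  if k is k'.+1 then 2^-1 *: (B + sqrt_iter B k' *m sqrt_iter B k') else 0.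

Lemma sqrt_iter_opb B (b : R) k : 0 <= b <= 1 -> opb B b -> opb (sqrt_iter B k) b.
Proof.
move=> /andP[b0 b1] Bb; elim: k => [|k IH] v /=.
  by rewrite mul0mx -(scale0r (0 : 'cV[R]_d)) enormZ normr0 mul0r mulr_ge0 ?enorm_ge0.
apply: le_trans (opbZ 2^-1 (opbD Bb (opbM b0 IH IH)) v) _.
rewrite ler_wpM2r ?enorm_ge0// ger0_norm//; nra.
Qed.

(** A difference of squares splits as Y1 (Y1 - Y0) + (Y1 - Y0) Y0; with both iterates bounded by b
    and the factor 1/2, each step contracts by b. *)
Lemma sqrt_iterB B (b : R) k : 0 <= b <= 1 -> opb B b ->
  opb (sqrt_iter B k.+1 - sqrt_iter B k) (b ^+ k * b).
Proof.
move=> b01 Bb; have [b0 b1] := andP b01; elim: k => [|k IH].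
  rewrite subr0 expr0 mul1r; exact: sqrt_iter_opb.
have -> : sqrt_iter B k.+2 - sqrt_iter B k.+1 =
  2^-1 *: (sqrt_iter B k.+1 *m (sqrt_iter B k.+1 - sqrt_iter B k) +
           (sqrt_iter B k.+1 - sqrt_iter B k) *m sqrt_iter B k).
  have E Y1 Y0 : 2^-1 *: (B + Y1 *m Y1) - 2^-1 *: (B + Y0 *m Y0) =
    2^-1 *: (Y1 *m (Y1 - Y0) + (Y1 - Y0) *m Y0).
    rewrite -scalerBr; congr (_ *: _).
    by rewrite mulmxBr mulmxBl opprD addrACA subrr add0r addrA subrK.
  exact: E.
have bk0 : 0 <= b ^+ k * b by rewrite mulr_ge0// exprn_ge0.
move=> v; apply: le_trans (opbZ 2^-1 (opbD (opbM b0 (sqrt_iter_opb _ b01 Bb) IH) (opbM bk0 IH (sqrt_iter_opb _ b01 Bb))) v) _.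
rewrite ler_wpM2r ?enorm_ge0// ger0_norm// exprS; lra.
Qed.

Lemma sqrt_iter_sym B k : B^T = B -> (sqrt_iter B k)^T = sqrt_iter B k.
Proof.
by move=> Bs; elim: k => [|k IH] /=; rewrite ?trmx0// linearZ linearD /= trmx_mul Bs IH.
Qed.

Lemma sqrt_iter_cvg B (b : R) i j : 0 <= b < 1 -> opb B b ->
  cvgn (fun k => sqrt_iter B k i j).
Proof.
move=> /andP[b0 b1] Bb; have b01 : 0 <= b <= 1 by rewrite b0 ltW.
have -> : (fun k => sqrt_iter B k i j) =
  series (fun k => sqrt_iter B k.+1 i j - sqrt_iter B k i j).
  apply/funext => k; rewrite /series/= (telescope_sumr (fun k => sqrt_iter B k i j))//.
  by rewrite /= mxE subr0.
apply: normed_cvg; apply: (@series_le_cvg _ _ (fun k => b * b ^+ k)).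
- by move=> n; exact: normr_ge0.
- by move=> n; rewrite mulr_ge0// exprn_ge0.
- move=> n; have /= := opb_coord i j (sqrt_iterB n b01 Bb).
  have -> : (sqrt_iter B n.+1 - sqrt_iter B n) i j = sqrt_iter B n.+1 i j - sqrt_iter B n i j.
    by rewrite [LHS]mxE [X in _ + X]mxE.
  by rewrite mulrC.
- by apply: is_cvg_geometric_series; rewrite ger0_norm.
Qed.

Lemma sqrtmx_exists A (c : R) : A^T = A -> 0 < c ->
  (forall v, c * dotc v v <= qform A v) -> exists M, is_sqrtmx A M.
Proof.
move=> As c0 Ac.
pose mA := \sum_i \sum_j `|A i j|.
pose L := d%:R ^+ 2 * mA + c.
have mA0 : 0 <= mA by apply: sumr_ge0 => i _; apply: sumr_ge0.
have L0 : 0 < L by rewrite ltr_wpDl// mulr_ge0// exprn_ge0.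
have AL : opb A L.
  have : opb A (d%:R ^+ 2 * mA).
    apply: coord_opb => i j; rewrite /mA (bigD1 i)//= (bigD1 j)//= -addrA lerDl addr_ge0//.
      by apply: sumr_ge0.
    by apply: sumr_ge0 => k _; apply: sumr_ge0.
  by move=> h v; apply: le_trans (h v) _; rewrite ler_wpM2r ?enorm_ge0// /L lerDl ltW.
(* For B = 1 - ep A, |B v|^2 <= (1 - 2 ep c + ep^2 L^2) |v|^2. This [ep] minimises the factor and
   gives b^2 = 1 - (c / L)^2; the summand c in L ensures c <= L. *)
pose ep := c / L ^+ 2; have ep0 : 0 < ep by rewrite divr_gt0// exprn_gt0.
pose B := 1%:M - ep *: A.
pose b := Num.sqrt (1 - (c / L) ^+ 2).
have cL : 0 < c / L <= 1.
  rewrite divr_gt0//= ler_pdivrMr// mul1r /L lerDr mulr_ge0// exprn_ge0//.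
have b2 : b ^+ 2 = 1 - (c / L) ^+ 2.
  rewrite sqr_sqrtr// subr_ge0 exprn_ile1//; by case/andP: cL => /ltW.
have b0 : 0 <= b by exact: sqrtr_ge0.
have b1 : b < 1.
  rewrite -(@ltr_pXn2r _ 2)// ?nnegrE// b2 expr1n gtrBl exprn_gt0//.
  by case/andP: cL.
have Bb : opb B b.
  move=> v; rewrite -(@ler_pXn2r _ 2)// ?nnegrE ?mulr_ge0 ?enorm_ge0// exprMn b2 !enormE.
  have -> : B *m v = v - ep *: (A *m v) by rewrite mulmxBl mul1mx -scalemxAl.
  rewrite dotcBr !dotcBl !dotcZr !dotcZl (dotcC (A *m v) v).
  have := Ac v; rewrite qformE => Acv.
  have ALv : dotc (A *m v) (A *m v) <= L ^+ 2 * dotc v v.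
    by rewrite -!enormE -exprMn ler_pXn2r ?nnegrE ?mulr_ge0 ?enorm_ge0// ltW.
  have h1 : ep * (c * dotc v v) <= ep * dotc v (A *m v) by rewrite ler_pM2l.
  have h2 : ep ^+ 2 * dotc (A *m v) (A *m v) <= ep ^+ 2 * (L ^+ 2 * dotc v v).
    by rewrite ler_pM2l// exprn_gt0.
  have e1 : ep * (c * dotc v v) = (c / L) ^+ 2 * dotc v v by rewrite /ep; field; rewrite gt_eqF.
  have e2 : ep ^+ 2 * (L ^+ 2 * dotc v v) = (c / L) ^+ 2 * dotc v v.
    by rewrite /ep; field; rewrite gt_eqF.
  rewrite e1 in h1; rewrite e2 in h2; move: h1 h2.
  rewrite expr2 -[ep * ep * _]mulrA; lra.
have b01 : 0 <= b <= 1 by rewrite b0 ltW.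
pose Y := \matrix_(i, j) limn (fun k => sqrt_iter B k i j).
have cY i j : (fun k => sqrt_iter B k i j) @ \oo --> Y i j.
  by rewrite mxE; apply: (@sqrt_iter_cvg B b); rewrite ?b0.
have Bs : B^T = B by rewrite /B linearB /= trmx1 linearZ /= As.
have Ys : Y^T = Y.
  apply/matrixP => i j; rewrite mxE.
  have := cY j i; rewrite (_ : (fun k => _) = (fun k => sqrt_iter B k i j)); last first.
    by apply/funext => k; rewrite -[in RHS](sqrt_iter_sym k Bs) mxE.
  by move=> h; apply: (cvg_unique _ h (cY i j)).
have Ye : Y = 2^-1 *: (B + Y *m Y).
  apply/matrixP => i j; have h := cY i j.
  have h' : (fun k => sqrt_iter B k.+1 i j) @ \oo --> Y i j by rewrite -(cvg_shiftS (fun k => sqrt_iter B k i j)) in h.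
  have E : (fun k => sqrt_iter B k.+1 i j) = (fun k => 2^-1 * (B i j + \sum_l sqrt_iter B k i l * sqrt_iter B k l j)).
    by apply/funext => k; rewrite /= !mxE.
  rewrite E in h'.
  have h3 : (fun k => 2^-1 * (B i j + \sum_l sqrt_iter B k i l * sqrt_iter B k l j)) @ \oo -->
      2^-1 * (B i j + \sum_l Y i l * Y l j).
    apply: cvgM; first exact: cvg_cst.
    apply: cvgD; first exact: cvg_cst.
    by apply: cvg_sumR => l; apply: cvgM; exact: cY.
  rewrite [LHS](cvg_unique _ h' h3)//.
  by rewrite [RHS]mxE [X in _ = _ * X]mxE [X in _ = _ * (_ + X)]mxE.
have Yb v : `|dotc v (Y *m v)| <= b * dotc v v.
  have cv : (fun k => dotc v (sqrt_iter B k *m v)) @ \oo --> dotc v (Y *m v).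
    rewrite (_ : (fun k => _) = (fun k => \sum_i v i 0 * \sum_j sqrt_iter B k i j * v j 0)); last first.
      by apply/funext => k; rewrite dotcE; apply: eq_bigr => i _; rewrite mxE.
    rewrite [X in _ --> X](_ : _ = \sum_i v i 0 * \sum_j Y i j * v j 0); last first.
      by rewrite dotcE; apply: eq_bigr => i _; rewrite mxE.
    apply: cvg_sumR => i; apply: cvgM; first exact: cvg_cst.
    by apply: cvg_sumR => j; apply: cvgM; [exact: cY|exact: cvg_cst].
  rewrite -(cvg_lim _ (cvg_norm cv))//; apply: limr_le; first by apply/cvg_ex; eexists; exact: (cvg_norm cv).
  apply: nearW => k; apply: le_trans (cauchy_schwarz _ _) _.
  rewrite -enormE expr2 mulrA [b * _]mulrC -mulrA ler_wpM2l ?enorm_ge0//.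
  exact: sqrt_iter_opb.
pose M := (Num.sqrt ep)^-1 *: (1%:M - Y).
have se : (Num.sqrt ep)^-1 ^+ 2 = ep^-1 by rewrite exprVn sqr_sqrtr// ltW.
exists M; split; [|split].
- by rewrite /M linearZ /= linearB /= trmx1 Ys.
- move=> v; rewrite qformE /M -scalemxAl dotcZr mulr_ge0 ?invr_ge0 ?sqrtr_ge0//.
  rewrite mulmxBl mul1mx dotcBr subr_ge0; have := Yb v; rewrite ler_norml => /andP[_ /le_trans]; apply.
  by rewrite ler_piMl ?dotc_ge0// ltW.
- rewrite /M -scalemxAl -scalemxAr scalerA -expr2 se.
  have -> : (1%:M - Y) *m (1%:M - Y) = ep *: A; last by rewrite scalerA mulVf ?scale1r// gt_eqF.
  have E : Y *m Y = 2 *: Y - B by rewrite {3}Ye scalerA divff// scale1r addrAC subrr add0r.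
  rewrite mulmxBl mul1mx mulmxBr mulmx1 E /B.
  by apply/matrixP => i j; rewrite ![in RHS]mxE !mxE; ring.
Qed.

End SquareRoot.

Section PositiveDefinite.
Variables (R : realType) (d : nat) (A : 'M[R]_d) (c : R).
Hypotheses (c0 : 0 < c) (Ac : forall v, c * dotc v v <= qform A v).
Implicit Types (u v w : 'cV[R]_d).

Lemma pd_unitmx : A \in unitmx.
Proof.
rewrite -row_free_unit -kermx_eq0; apply/eqP/row_matrixP => i; rewrite row0.
set u := row i _; have uA : u *m A = 0.
  by rewrite /u -row_mul mulmx_ker row0.
have : c * dotc u^T u^T <= 0.
  by apply: le_trans (Ac _) _; rewrite /qform trmxK uA mul0mx mxE.
rewrite pmulr_rle0// => h; apply: trmx_inj; rewrite trmx0; apply: dotc_eq0.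
by apply/eqP; rewrite eq_le h dotc_ge0.
Qed.

Lemma pd_inv_opb : opb (invmx A) c^-1.
Proof.
move=> v; set x := invmx A *m v.
have vx : A *m x = v by rewrite /x mulKVmx// pd_unitmx.
have := Ac x; rewrite qformE vx -enormE => h.
have {}h : c * enorm x ^+ 2 <= enorm x * enorm v.
  by apply: le_trans h _; apply: le_trans (cauchy_schwarz _ _); exact: ler_norm.
have [->|x0] := eqVneq (enorm x) 0; first by rewrite mulr_ge0 ?enorm_ge0// invr_ge0 ltW.
have x0' : 0 < enorm x by rewrite lt_neqAle eq_sym x0 enorm_ge0.
by rewrite ler_pdivlMl// -(ler_pM2l x0') mulrCA -expr2.
Qed.

Lemma pd_inv_pd : exists c', 0 < c' /\ forall v, c' * dotc v v <= qform (invmx A) v.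
Proof.
pose mA := \sum_i \sum_j `|A i j|.
pose L := d%:R ^+ 2 * mA + 1.
have mA0 : 0 <= mA by apply: sumr_ge0 => i _; apply: sumr_ge0.
have L0 : 0 < L by rewrite ltr_wpDl// mulr_ge0// exprn_ge0.
have AL : opb A L.
  have : opb A (d%:R ^+ 2 * mA).
    apply: coord_opb => i j; rewrite /mA (bigD1 i)//= (bigD1 j)//= -addrA lerDl addr_ge0//.
      by apply: sumr_ge0.
    by apply: sumr_ge0 => k _; apply: sumr_ge0.
  by move=> h v; apply: le_trans (h v) _; rewrite ler_wpM2r ?enorm_ge0// /L lerDl ltW.
exists (c / L ^+ 2); split; first by rewrite divr_gt0// exprn_gt0.
move=> v; set x := invmx A *m v.
have vx : A *m x = v by rewrite /x mulKVmx// pd_unitmx.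
have -> : qform (invmx A) v = qform A x by rewrite qformE -/x qformE vx dotcC.
apply: le_trans (Ac x); rewrite mulrAC ler_pdivrMr ?exprn_gt0// -mulrA ler_pM2l//.
have L0' := ltW L0; rewrite -!enormE mulrC -exprMn ler_pXn2r ?nnegrE ?mulr_ge0 ?enorm_ge0//.
by have := AL x; rewrite vx.
Qed.

Lemma invmx_sym : A^T = A -> (invmx A)^T = invmx A.
Proof. by move=> As; rewrite trmx_inv As. Qed.

End PositiveDefinite.

Lemma sqrtmxP (R : realType) d (A : 'M[R]_d) (c : R) : A^T = A -> 0 < c ->
  (forall v, c * dotc v v <= qform A v) -> is_sqrtmx A (sqrtmx A).
Proof. by move=> As c0 Ac; have [M HM] := sqrtmx_exists As c0 Ac; exact: (xgetPex 0 (ex_intro _ M HM)). Qed.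

Lemma nondeg_qform (R : realType) d (A : 'M[R]_d) (c : R) :
  (forall v, qform 1%:M v = 1 -> c <= qform A v) -> forall v, c * dotc v v <= qform A v.
Proof.
move=> Ac v; have [v0|v0] := eqVneq (dotc v v) 0.
  by rewrite v0 mulr0 (dotc_eq0 v0) /qform mulmx0 mxE.
have v0' : 0 < dotc v v by rewrite lt_neqAle eq_sym v0 dotc_ge0.
have e0 : 0 < enorm v by rewrite sqrtr_gt0.
have := Ac ((enorm v)^-1 *: v); rewrite !qformE mul1mx -scalemxAr !dotcZr !dotcZl -enormE.
rewrite (_ : _ * (_ * _ ^+ 2) = 1); last by field; rewrite gt_eqF.
move=> /(_ erefl); rewrite mulrA -invfM -expr2 ler_pdivlMl ?exprn_gt0// mulrC.
exact.
Qed.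

(** * The log-likelihood *)

Section LogDensity.
Variables (R : realType) (g : R -> R).
Hypotheses (gC : C3_R g) (g0 : forall x, 0 < g x).

(** [score], [score1] and [score2] are the first three derivatives of ln g. *)
Definition score x := derive1 g x / g x.
Definition score1 x := derive1 (derive1 g) x / g x - score x ^+ 2.
Definition score2 x := derive1 (derive1 (derive1 g)) x / g x
  - derive1 (derive1 g) x / g x * score x - 2 * score x * score1 x.

Let dg (x : R) : is_derive x 1 g (derive1 g x).
Proof. have [h _ _] := gC.1 x; exact: (DeriveDef h (esym (derive1E _ _))). Qed.
Let dg1 (x : R) : is_derive x 1 (derive1 g) (derive1 (derive1 g) x).
Proof. have [_ h _] := gC.1 x; exact: (DeriveDef h (esym (derive1E _ _))). Qed.
Let dg2 (x : R) : is_derive x 1 (derive1 (derive1 g)) (derive1 (derive1 (derive1 g)) x).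
Proof. have [_ _ h] := gC.1 x; exact: (DeriveDef h (esym (derive1E _ _))). Qed.

Lemma is_derive_ln_density (x : R) : is_derive x 1 (fun y => ln (g y)) (score x).
Proof.
have := is_derive1_comp (is_derive1_ln (g0 x)) (dg x).
by rewrite /score mulrC.
Qed.

Let dratio (f f' : R -> R) (x : R) : is_derive x 1 f (f' x) ->
  is_derive x 1 (fun y => f y / g y) (f' x / g x - f x / g x * score x).
Proof.
move=> df; have gx0 : g x != 0 by rewrite gt_eqF.
have dv : is_derive x 1 (fun y => (g y)^-1) (- (g x) ^- 2 *: derive1 g x).
  have [h1 h2] := dg x; exact: (DeriveDef (derivableV gx0 h1) (etrans (deriveV gx0 h1) (congr1 _ h2))).
have := is_deriveM df dv.
rewrite (_ : _ *: _ + _ *: _ = f' x / g x - f x / g x * score x)//.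
by rewrite /score /GRing.scale/= -exprVn; field.
Qed.

Lemma is_derive_score (x : R) : is_derive x 1 score (score1 x).
Proof. by have := dratio (dg1 x); rewrite -expr2. Qed.

Lemma is_derive_score1 (x : R) : is_derive x 1 score1 (score2 x).
Proof.
have h2 := is_deriveX 2 (is_derive_score x).
have := is_deriveB (dratio (dg2 x)) h2.
by rewrite (_ : _ - _ = score2 x)// /score2 /GRing.scale.
Qed.

Lemma score_continuous : continuous score.
Proof. by move=> x; apply/differentiable_continuous/derivable1_diffP; case: (is_derive_score x). Qed.

Lemma score1_continuous : continuous score1.
Proof. by move=> x; apply/differentiable_continuous/derivable1_diffP; case: (is_derive_score1 x). Qed.

Lemma score2_continuous : continuous score2.
Proof.
have [_ [c0 c1 c2 c3]] := gC.
have cV : continuous (fun x => (g x)^-1) by move=> x; apply: cvgV; [rewrite gt_eqF|exact: c0].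
move=> x; apply: cvgB; first apply: cvgB.
- by apply: cvgM; [exact: c3|exact: cV].
- by apply: cvgM; [apply: cvgM; [exact: c2|exact: cV]|exact: score_continuous].
- by apply: cvgM; [apply: cvgM; [exact: cvg_cst|exact: score_continuous]|exact: score1_continuous].
Qed.

Lemma density_continuous : continuous g. Proof. by case: gC => _ []. Qed.

Lemma scoreM x : score x * g x = derive1 g x.
Proof. by rewrite /score divfK// gt_eqF. Qed.

(** Rewrites the mean of score1 + score^2 under the density g as the integral of g''. *)
Lemma score1M x : (score1 x + score x ^+ 2) * g x = derive1 (derive1 g) x.
Proof. by rewrite /score1 subrK divfK// gt_eqF. Qed.

End LogDensity.

Section C1Ext.
Variables (R : realType) (d : nat) (Theta : set 'cV[R]_d).
Hypothesis oT : open Theta.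

Lemma open_near t (P : 'cV[R]_d -> Prop) : (forall x, Theta x -> P x) -> Theta t -> \forall x \near t, P x.
Proof. by move=> TP Tt; apply: filterS (open_nbhs_nbhs (conj oT Tt)) => x; exact: TP. Qed.

Lemma eq_on_is_derive (F G : 'cV[R]_d -> R) t v l : (forall x, Theta x -> F x = G x) -> Theta t ->
  is_derive t v G l -> is_derive t v F l.
Proof. by move=> FG Tt; apply: near_is_derive; apply: open_near => // x Tx; rewrite FG. Qed.

Lemma C1_on_ext (F G : 'cV[R]_d -> R) : (forall x, Theta x -> F x = G x) ->
  C1_on Theta G -> C1_on Theta F.
Proof.
move=> FG cG; apply: (C1_onP oT (G := fun i => pd i G)).
- move=> t Tt; have := (cG t Tt).1; rewrite /prop_for/continuous_at FG// => c.
  have N : \forall x \near t, G x = F x by apply: (open_near (P := fun x => G x = F x)) => // x Tx; rewrite FG.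
  exact: cvg_trans (near_eq_cvg N) c.
- by move=> t i Tt; apply: (eq_on_is_derive FG) => //; exact: (C1_pd i cG Tt).
- by move=> t i Tt; exact: ((cG t Tt).2 i).2.
Qed.

(** The derivative is the pointwise limit of difference quotients with increments 1 / (n + 1); the
    shift by [n0] keeps the displaced points in the open set [Theta]. *)
Lemma measurable_pd dT (T : measurableType dT) (F : 'cV[R]_d -> T -> R) t i :
  (forall t', Theta t' -> measurable_fun setT (F t')) -> Theta t ->
  (forall x, derivable (F^~ x) t (delta_mx i 0)) ->
  measurable_fun setT (fun x => pd i (F^~ x) t).
Proof.
move=> mF Tt dF.
have Tn : \forall n \near \oo, Theta (t + n.+1%:R^-1 *: delta_mx i 0).
  have : (fun n => t + n.+1%:R^-1 *: delta_mx i 0) @ \oo --> t.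
    rewrite -[X in _ --> X](addr0 t) -(scale0r (delta_mx i 0)).
    apply: cvgD; first exact: cvg_cst.
    by apply: cvgZr_tmp; exact: cvg_harmonic.
  move=> /(_ Theta); apply; exact: open_nbhs_nbhs.
have [n0 _ Hn] := Tn.
apply: (measurable_fun_cvg (h := fun n x => (n + n0).+1%:R * (F (t + (n + n0).+1%:R^-1 *: delta_mx i 0) x - F t x))).
- move=> n; apply: measurable_funM => //; apply: measurable_funB; apply: mF => //.
  by apply: Hn; rewrite /= leq_addl.
- move=> x _; have dFx := dF x.
  have hc : (fun n => (n + n0).+1%:R^-1 : R) @ \oo --> (0 : R).
    by rewrite (cvg_shiftn n0 (fun n => n.+1%:R^-1 : R)); exact: cvg_harmonic.
  have h0 : (fun n => (n + n0).+1%:R^-1 : R) @ \oo --> (0 : R)^'.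
    move=> A A0; have N : \forall n \near \oo, (n + n0).+1%:R^-1 != 0 :> R -> A ((n + n0).+1%:R^-1) by exact: (hc _ A0).
    by apply: filterS N => n; apply; rewrite invr_eq0 pnatr_eq0.
  have := cvg_comp _ _ h0 dFx.
  rewrite (_ : _ \o _ = fun n => (n + n0).+1%:R * (F (t + (n + n0).+1%:R^-1 *: delta_mx i 0) x - F t x))//.
  by apply/funext => n /=; rewrite invrK [_ + t]addrC.
Qed.

End C1Ext.

Section LogLikelihood.
Variables (R : realType) (d : nat) (Theta : set 'cV[R]_d) (S : 'cV[R]_d -> R -> R) (g : R -> R).
Hypotheses (oT : open Theta) (cT : convex_set_cV Theta) (S3 : forall x, C3_on Theta (S^~ x))
  (g0 : forall x, 0 < g x) (g3 : C3_R g).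
Implicit Types (t : 'cV[R]_d) (i j k : 'I_d).

Let C1_S i x : C1_on Theta (S^~ x).
Proof.
move=> t Tt; have [cS H] := S3 x Tt; split => // k.
by have [[]] := H k i i => + _ _ [].
Qed.

Let C1_dS i x : C1_on Theta (pd i (S^~ x)).
Proof.
move=> t Tt; have [cS H] := S3 x Tt; split; first by have [_ []] := H i i i.
by move=> k; have [[]] := H i k i => _ + _ [_].
Qed.

Let C1_ddS i j x : C1_on Theta (pd j (pd i (S^~ x))).
Proof.
move=> t Tt; have [cS H] := S3 x Tt; split; first by have [_ []] := H i j i.
by move=> k; have [[]] := H i j k => _ _ + [_ _].
Qed.

Let resid (x x' : R) t := x' - S t x.

Let is_derive_sub (x' y : R) : is_derive y 1 (fun z => x' - z) (-1).
Proof.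
have := is_deriveB (is_derive_cst x' y (1 : R)) (is_derive_id y (1 : R)).
by rewrite sub0r.
Qed.

Let C1_resid i x x' : C1_on Theta (resid x x').
Proof.
apply: (@C1_on_comp R d Theta oT (fun z => x' - z) (fun=> -1)); last exact: C1_S.
  by move=> y; exact: is_derive_sub.
by move=> y; exact: cvg_cst.
Qed.

Let pd_resid x x' t i : Theta t -> is_derive t (delta_mx i 0) (resid x x') (- pd i (S^~ x) t).
Proof.
move=> Tt; rewrite -mulN1r.
exact: (is_derive_comp1 (C1_pd i (C1_S i x) Tt) (is_derive_sub x' (S t x))).
Qed.

Lemma pd_ell t x x' i : Theta t ->
  pd i (ell S g x x') t = - (score g (x' - S t x) * pd i (S^~ x) t).
Proof.
move=> Tt; rewrite -mulrN.
by case: (is_derive_comp1 (pd_resid x x' i Tt) (is_derive_ln_density g3 g0 (x' - S t x))).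
Qed.

Let is_derive_score_resid t x x' j : Theta t ->
  is_derive t (delta_mx j 0) (fun t => score g (resid x x' t)) (- (score1 g (x' - S t x) * pd j (S^~ x) t)).
Proof.
move=> Tt; rewrite -mulrN.
exact: (is_derive_comp1 (pd_resid x x' j Tt) (is_derive_score g3 g0 (x' - S t x))).
Qed.

Lemma pd_pd_ell t x x' i j : Theta t ->
  pd j (pd i (ell S g x x')) t =
  score1 g (x' - S t x) * (pd i (S^~ x) t * pd j (S^~ x) t) - score g (x' - S t x) * pd j (pd i (S^~ x)) t.
Proof.
move=> Tt.
have h := is_deriveN (is_deriveM (is_derive_score_resid x x' j Tt) (C1_pd j (C1_dS i x) Tt)).
have [_] := eq_on_is_derive oT (fun x0 Tx0 => pd_ell x x' i Tx0) Tt h.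
rewrite /pd => ->; rewrite /GRing.scale/= /resid; ring.
Qed.

Lemma C1_pd_ell i x x' : C1_on Theta (pd i (ell S g x x')).
Proof.
apply: (C1_on_ext oT (fun t Tt => pd_ell x x' i Tt)).
apply: C1_onN => //; apply: C1_onM => //.
apply: (@C1_on_comp R d Theta oT (score g) (score1 g)); last exact: C1_resid i x x'.
  by move=> y; exact: is_derive_score.
exact: score1_continuous.
Qed.

Lemma C1_pd_pd_ell i j x x' : C1_on Theta (pd j (pd i (ell S g x x'))).
Proof.
apply: (C1_on_ext oT (fun t Tt => pd_pd_ell x x' i j Tt)).
apply: C1_onD => //; last apply: C1_onN => //; apply: C1_onM => //.
- apply: (@C1_on_comp R d Theta oT (score1 g) (score2 g)); last exact: C1_resid i x x'.
    by move=> y; exact: is_derive_score1.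
  exact: score2_continuous.
- exact: C1_onM.
- apply: (@C1_on_comp R d Theta oT (score g) (score1 g)); last exact: C1_resid i x x'.
    by move=> y; exact: is_derive_score.
  exact: score1_continuous.
Qed.

Lemma ldot_taylor t t' x x' i (B : R) : Theta t -> Theta t' ->
  (forall t, Theta t -> forall i j k, `|ldddot S g t x x' i j k| <= B) ->
  `|ldot S g t' x x' i 0 - ldot S g t x x' i 0 - (lddot S g t x x' *m (t' - t)) i 0| <=
  B * (\sum_k `|(t' - t) k 0|) ^+ 2.
Proof.
move=> Tt Tt' Bb; rewrite !mxE.
under [X in _ - X]eq_bigr do rewrite mxE mulrC.
apply: (C1_taylor oT cT (C1_pd_ell i x x') (fun j => C1_pd_pd_ell i j x x')) => //.
by move=> y Ty j k; exact: Bb.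
Qed.

Hypothesis Sm : forall t, measurable_fun setT (S t).

Lemma measurable_pdS t i : Theta t -> measurable_fun setT (fun x => pd i (S^~ x) t).
Proof.
move=> Tt; apply: (@measurable_pd R d Theta oT _ _ S) => //.
by move=> x; have [_ /(_ i)[]] := C1_S i x Tt.
Qed.

Lemma measurable_pdpdS t i j : Theta t -> measurable_fun setT (fun x => pd j (pd i (S^~ x)) t).
Proof.
move=> Tt; apply: (@measurable_pd R d Theta oT _ _ (fun t x => pd i (S^~ x) t)) => //.
  by move=> t' Tt'; exact: measurable_pdS.
by move=> x; have [_ /(_ j)[]] := C1_dS i x Tt.
Qed.

Lemma measurable_score : measurable_fun setT (score g).
Proof. by apply: continuous_measurable_fun; exact: score_continuous. Qed.

Lemma measurable_score1 : measurable_fun setT (score1 g).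
Proof. by apply: continuous_measurable_fun; exact: score1_continuous. Qed.

End LogLikelihood.

(** * Moments of the innovation score *)

Section ScoreMoments.
Variables (R : realType) (d : nat) (Theta : set 'cV[R]_d) (S : 'cV[R]_d -> R -> R) (g : R -> R).
Hypotheses (oT : open Theta) (S3 : forall x, C3_on Theta (S^~ x))
  (g0 : forall x, 0 < g x) (g3 : C3_R g) (Sm : forall t, measurable_fun setT (S t)).
Context dO (Omega : measurableType dO) (Q : probability Omega R) (X : nat -> Omega -> R) (t : 'cV[R]_d).
Hypotheses (mX : forall j, measurable_fun setT (X j)) (Tt : Theta t).
Hypotheses (iY : mutual_indep Q (innov S X t)) (Yg : has_density Q (innov S X t 1) g).
Local Notation Y := (innov S X t).

Lemma measurable_innov j : measurable_fun setT (Y j).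
Proof.
case: j => [|j]; first exact: mX.
by apply: measurable_funB; [exact: mX|apply: measurableT_comp => //; exact: Sm].
Qed.

Variable i : 'I_d.
Hypotheses (I0 : 0 < \int[Q]_w (ldot S g t (X 0%N w) (X 1%N w) i 0 * ldot S g t (X 0%N w) (X 1%N w) i 0))
  (Ioo : (\int[Q]_w (ldot S g t (X 0%N w) (X 1%N w) i 0 ^+ 2)%:E < +oo)%E)
  (Joo : (\int[Q]_w (lddot S g t (X 0%N w) (X 1%N w) i i ^+ 2)%:E < +oo)%E).

Let mY := measurable_innov.
Let nu : probability R R := law Q (mY 1%N).
Let nuE A : measurable A -> nu A = Q (Y 1%N @^-1` A). Proof. by []. Qed.
Let a x := pd i (S^~ x) t.
Let b x := pd i (pd i (S^~ x)) t.
Let ma : measurable_fun setT a. Proof. exact: (measurable_pdS oT S3). Qed.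
Let mb : measurable_fun setT b. Proof. exact: (measurable_pdpdS oT S3). Qed.
Let ms : measurable_fun setT (score g). Proof. exact: measurable_score. Qed.
Let ms1 : measurable_fun setT (score1 g). Proof. exact: measurable_score1. Qed.

Let past0 w : past Y 1 w 0%N = X 0%N w. Proof. by []. Qed.

Let ldotE w : ldot S g t (X 0%N w) (X 1%N w) i 0 = - (score g (Y 1%N w) * a (past Y 1 w 0%N)).
Proof. by rewrite mxE (pd_ell S3 g0 g3). Qed.

Let lddotE w : lddot S g t (X 0%N w) (X 1%N w) i i =
  score1 g (Y 1%N w) * a (past Y 1 w 0%N) ^+ 2 - score g (Y 1%N w) * b (past Y 1 w 0%N).
Proof. by rewrite mxE (pd_pd_ell oT S3 g0 g3). Qed.

Let F1 (h : history R) e := (score g e * a (h 0%N)) ^+ 2.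
Let F2 (h : history R) e := (score1 g e * a (h 0%N) ^+ 2 - score g e * b (h 0%N)) ^+ 2.

Let mh : measurable_fun setT (fun z : history R * R => z.1 0%N).
Proof. exact: (measurableT_comp (measurable_coord 0)). Qed.

Let mF1 : measurable_fun setT (fun z : history R * R => F1 z.1 z.2).
Proof. by apply: measurable_funX; apply: measurable_funM; [exact: measurableT_comp|exact: (measurableT_comp ma)]. Qed.

Let mF2 : measurable_fun setT (fun z : history R * R => F2 z.1 z.2).
Proof.
apply: measurable_funX; apply: measurable_funB; apply: measurable_funM.
- exact: measurableT_comp.
- by apply: measurable_funX; exact: (measurableT_comp ma).
- exact: measurableT_comp.
- exact: (measurableT_comp mb).
Qed.

Let K := (\int[nu]_e (score g e ^+ 2)%:E)%E.
Let A2 := (\int[Q]_w (a (X 0%N w) ^+ 2)%:E)%E.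

Let K0 : (0 <= K)%E. Proof. by apply: integral_ge0 => e _; rewrite lee_fin sqr_ge0. Qed.
Let A20 : (0 <= A2)%E. Proof. by apply: integral_ge0 => e _; rewrite lee_fin sqr_ge0. Qed.

(** Independence splits the diagonal information into an innovation factor K and a state factor A2.
    As the product is positive and finite, neither factor is 0, and so K is finite. *)
Let KA : (\int[Q]_w (ldot S g t (X 0%N w) (X 1%N w) i 0 ^+ 2)%:E = K * A2)%E.
Proof.
under eq_integral do rewrite ldotE sqrrN.
rewrite (tonelli_past mY iY nuE mF1); last by move=> h e; exact: sqr_ge0.
rewrite /A2 -ge0_integralZl//; last first.
- by move=> x _; rewrite lee_fin sqr_ge0.
- by apply/measurable_EFinP/measurable_funX; exact: measurableT_comp.
apply: eq_integral => w _; rewrite muleC /K -ge0_integralZl_EFin//; last 3 first.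
- by move=> x _; rewrite lee_fin sqr_ge0.
- by apply/measurable_EFinP/measurable_funX.
- exact: sqr_ge0.
by apply: eq_integral => e _; rewrite /F1 past0 exprMn EFinM muleC.
Qed.

Let KA0 : (0 < K * A2)%E.
Proof.
rewrite -KA lt_neqAle integral_ge0 ?andbT; last by move=> *; rewrite lee_fin sqr_ge0.
apply/eqP => h; move: I0; rewrite /Rintegral; under eq_integral do rewrite -expr2.
by rewrite -h ltxx.
Qed.

Let KN0 : K != 0%E. Proof. by apply/eqP => h; move: KA0; rewrite h mul0e ltxx. Qed.
Let A2N0 : A2 != 0%E. Proof. by apply/eqP => h; move: KA0; rewrite h mule0 ltxx. Qed.

Let Koo : (K < +oo)%E.
Proof.
rewrite ltey; apply/eqP => h; move: Ioo; rewrite KA h.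
by rewrite gt0_mulye ?ltxx// lt_neqAle eq_sym A2N0.
Qed.

Let score2_L1 : L1 nu (fun e => score g e ^+ 2).
Proof.
apply/integrableP; split; first by apply/measurable_EFinP/measurable_funX.
by under eq_integral do rewrite /= ger0_norm ?sqr_ge0//.
Qed.

Let score_L1 : L1 nu (score g). Proof. exact: L1_sqr. Qed.

(** Otherwise a (X_0) would vanish almost surely, since the conditional second moment of the Hessian
    is almost surely finite, and A2 would be 0. *)
Let exw : exists w, a (X 0%N w) != 0 /\ (\int[nu]_e (F2 (past Y 1 w) e)%:E < +oo)%E.
Proof.
apply: contrapT => /forallNP H.
have ae := tonelli_past_ae mY iY nuE mF2 (fun h e => sqr_ge0 _).
have {}ae : {ae Q, forall w, (\int[nu]_e (F2 (past Y 1 w) e)%:E < +oo)%E}.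
  by apply: ae; move: Joo; under eq_integral do rewrite lddotE.
move/eqP: A2N0; apply; rewrite /A2.
rewrite (ae_eq_integral (cst 0%E)) ?integral0//.
- by apply/measurable_EFinP/measurable_funX; exact: measurableT_comp.
- move: ae; apply: filterS => w fw _; have /not_andP[/negP|] := H w; last by [].
  by rewrite negbK => /eqP ->; rewrite expr0n.
Qed.

(** At the state given by [exw], the Hessian is a combination of score1 and score with a nonzero
    coefficient a^2, so one can solve for score1. *)
Let score1_L1 : L1 nu (score1 g).
Proof.
have [w [aw fw]] := exw.
set x := X 0%N w in aw; set aa := a x; set bb := b x.
have mf : measurable_fun setT (fun e => score1 g e * aa ^+ 2 - score g e * bb).
  by apply: measurable_funB; apply: measurable_funM; [exact: ms1|exact: measurable_cst|exact: ms|exact: measurable_cst].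
have h2 : L1 nu (fun e => (score1 g e * aa ^+ 2 - score g e * bb) ^+ 2).
  apply/integrableP; split; first by apply/measurable_EFinP/measurable_funX.
  by under eq_integral do rewrite /= ger0_norm ?sqr_ge0//.
have h1 := L1_sqr mf h2.
have -> : score1 g = (fun e => aa ^- 2 * ((score1 g e * aa ^+ 2 - score g e * bb) + bb * score g e)).
  by apply/funext => e; field.
by apply: L1Z; apply: L1D => //; exact: L1Z.
Qed.

Let mg : measurable_fun setT g. Proof. by apply: continuous_measurable_fun; exact: density_continuous. Qed.

(** The two Bartlett identities. The moments found so far make g, g' and g'' integrable, hence the
    integrals of g' and g'' vanish; they are the means of score and of score1 + score^2. *)
Lemma score_moments :
  [/\ L1 nu (fun e => score g e ^+ 2), L1 nu (score1 g), \int[nu]_e score g e = 0,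
      \int[nu]_e score1 g e = - \int[nu]_e (score g e ^+ 2) & 0 < \int[nu]_e (score g e ^+ 2)].
Proof.
have [_ [cg cg1 cg2 _]] := g3.
have dg (x : R) : is_derive x 1 g (derive1 g x).
  by have [h _ _] := g3.1 x; exact: (DeriveDef h (esym (derive1E _ _))).
have dg1 (x : R) : is_derive x 1 (derive1 g) (derive1 (derive1 g) x).
  by have [_ h _] := g3.1 x; exact: (DeriveDef h (esym (derive1E _ _))).
have Q1 : L1 Q (fun w => score g (Y 1%N w)) by apply: (law_integrable (mf := mY 1%N)).
have Q2 : L1 Q (fun w => score1 g (Y 1%N w)) by apply: (law_integrable (mf := mY 1%N)).
have Q3 : L1 Q (fun w => score g (Y 1%N w) ^+ 2).
  by apply: (law_integrable (mf := mY 1%N) (F := fun e => score g e ^+ 2)) => //; exact: measurable_funX.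
have ms12 : measurable_fun setT (fun e => score1 g e + score g e ^+ 2).
  by apply: measurable_funD => //; exact: measurable_funX.
have Q4 : L1 Q (fun w => score1 g (Y 1%N w) + score g (Y 1%N w) ^+ 2) by exact: L1D.
have g00 x : 0 <= g x by exact: ltW.
have Ig : (@lebesgue_measure R).-integrable setT (EFin \o g).
  have := has_density_integrable (mY 1%N) mg g00 Yg (f := fun=> 1) (@measurable_cst _ _ _ _ _ _) (L1_cst Q 1).
  by under eq_fun do rewrite mul1r.
have Ig1 : (@lebesgue_measure R).-integrable setT (EFin \o derive1 g).
  have := has_density_integrable (mY 1%N) mg g00 Yg ms Q1.
  by under eq_fun do rewrite scoreM//.
have Ig2 : (@lebesgue_measure R).-integrable setT (EFin \o derive1 (derive1 g)).
  have := has_density_integrable (mY 1%N) mg g00 Yg ms12 Q4.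
  by under eq_fun do rewrite score1M//.
split => //.
- rewrite (Ex_law (mY 1%N) ms Q1) (has_density_integral (mY 1%N) mg Yg ms Q1).
  rewrite -[RHS](integral_derive_eq0 dg cg1 Ig Ig1).
  by congr Rintegral; apply/funext => x; rewrite scoreM.
- apply/eqP; rewrite -subr_eq0 opprK; apply/eqP.
  rewrite -ExD// (Ex_law (mY 1%N) ms12 Q4) (has_density_integral (mY 1%N) mg Yg ms12 Q4).
  rewrite -[RHS](integral_derive_eq0 dg1 cg2 Ig1 Ig2).
  by congr Rintegral; apply/funext => x; rewrite score1M.
- by rewrite /Rintegral fine_gt0// Koo lt_neqAle eq_sym KN0 K0.
Qed.

End ScoreMoments.

(** * The score martingale under a fixed parameter *)

Section FixedParameter.
Variables (R : realType) (d : nat) (Theta : set 'cV[R]_d) (S : 'cV[R]_d -> R -> R) (g : R -> R).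
Hypotheses (oT : open Theta) (S3 : forall x, C3_on Theta (S^~ x))
  (g0 : forall x, 0 < g x) (g3 : C3_R g) (Sm : forall t, measurable_fun setT (S t)).
Context dO (Omega : measurableType dO) (Q : probability Omega R) (X : nat -> Omega -> R) (t : 'cV[R]_d).
Hypotheses (mX : forall j, measurable_fun setT (X j)) (Tt : Theta t).
Local Notation Y := (innov S X t).
Hypotheses (iY : mutual_indep Q Y).
Variable nu : probability R R.
Hypothesis nuE : forall j A, (0 < j)%N -> measurable A -> nu A = Q (Y j @^-1` A).
Local Notation Ig := (\int[nu]_e (score g e ^+ 2)).
Hypotheses (score2_L1 : L1 nu (fun e => score g e ^+ 2)) (score1_L1 : L1 nu (score1 g))
  (score_mean : \int[nu]_e score g e = 0) (score1_mean : \int[nu]_e score1 g e = - Ig)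
  (Ig0 : 0 < Ig).
Variables (R1 R2 : R -> R -> R) (C : R).
Hypotheses (mR1 : measurable_fun setT (fun p : R * R => R1 p.1 p.2))
  (mR2 : measurable_fun setT (fun p : R * R => R2 p.1 p.2))
  (ldotR1 : forall x x' i, `|ldot S g t x x' i 0| <= R1 x x')
  (lddotR2 : forall x x' i j, `|lddot S g t x x' i j| <= R2 x x')
  (R1C : forall j, (\int[Q]_w ((R1 (X j w) (X j.+1 w)) ^+ 2)%:E <= C%:E)%E)
  (R2C : forall j, (\int[Q]_w ((R2 (X j w) (X j.+1 w)) ^+ 2)%:E <= C%:E)%E).
Variables (u : 'cV[R]_d) (U s2 : R).
Hypotheses (uU : \sum_i `|u i 0| <= U) (s20 : 0 <= s2).

Definition xi k w : R := dotc u (ldot S g t (X k w) (X k.+1 w)).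
Definition hess k w : R := qform (lddot S g t (X k w) (X k.+1 w)) u.

Let mY := measurable_innov Sm t mX.
Let a x : R := \sum_i u i 0 * pd i (S^~ x) t.
Let b x : R := \sum_i \sum_j u i 0 * u j 0 * pd j (pd i (S^~ x)) t.
Let ma : measurable_fun setT a.
Proof. by apply: measurable_sum => i; apply: measurable_funM => //; exact: (measurable_pdS oT S3). Qed.
Let mb : measurable_fun setT b.
Proof.
apply: measurable_sum => i; apply: measurable_sum => j; apply: measurable_funM; first exact: measurable_cst.
exact: (measurable_pdpdS oT S3).
Qed.
Let ms : measurable_fun setT (score g). Proof. exact: measurable_score. Qed.
Let ms1 : measurable_fun setT (score1 g). Proof. exact: measurable_score1. Qed.

(** A function of the innovation times a function of the preceding state: all conditional means are
    computed from this form. *)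
Let xiE k w : xi k w = - (score g (Y k.+1 w) * a (X k w)).
Proof.
rewrite /xi dotcE /a mulr_sumr -sumrN; apply: eq_bigr => i _.
by rewrite mxE (pd_ell S3 g0 g3)//= mulrN mulrCA.
Qed.

Let hessE k w : hess k w = score1 g (Y k.+1 w) * a (X k w) ^+ 2 - score g (Y k.+1 w) * b (X k w).
Proof.
rewrite /hess qformE dotcE.
transitivity (\sum_i \sum_j (score1 g (Y k.+1 w) * ((u i 0 * pd i (S^~ (X k w)) t) * (u j 0 * pd j (S^~ (X k w)) t))
    - score g (Y k.+1 w) * (u i 0 * u j 0 * pd j (pd i (S^~ (X k w))) t))).
  apply: eq_bigr => i _; rewrite mxE mulr_sumr; apply: eq_bigr => j _.
  by rewrite mxE (pd_pd_ell oT S3 g0 g3)//=; ring.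
rewrite /a /b expr2 mulr_suml !mulr_sumr -sumrB; apply: eq_bigr => i _.
by rewrite !mulr_sumr -sumrB; apply: eq_bigr => j _.
Qed.

Lemma measurable_xi k : measurable_fun setT (xi k).
Proof.
rewrite (_ : xi k = fun w => - (score g (Y k.+1 w) * a (X k w))); last by apply/funext => w; rewrite xiE.
apply: measurableT_comp => //; apply: measurable_funM; first exact: (measurableT_comp ms (mY k.+1)).
exact: (measurableT_comp ma (mX k)).
Qed.

Lemma measurable_hess k : measurable_fun setT (hess k).
Proof.
rewrite (_ : hess k = fun w => score1 g (Y k.+1 w) * a (X k w) ^+ 2 - score g (Y k.+1 w) * b (X k w)); last first.
  by apply/funext => w; rewrite hessE.
apply: measurable_funB; apply: measurable_funM.
- exact: (measurableT_comp ms1 (mY k.+1)).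
- by apply: measurable_funX; exact: (measurableT_comp ma (mX k)).
- exact: (measurableT_comp ms (mY k.+1)).
- exact: (measurableT_comp mb (mX k)).
Qed.

Let U0 : 0 <= U. Proof. by apply: le_trans uU; exact: sumr_ge0. Qed.

Lemma xi_le k w : `|xi k w| <= U * `|R1 (X k w) (X k.+1 w)|.
Proof.
rewrite /xi dotcE; apply: le_trans (ler_norm_sum _ _ _) _.
apply: (@le_trans _ _ (\sum_i `|u i 0| * `|R1 (X k w) (X k.+1 w)|)).
  by apply: ler_sum => i _; rewrite normrM ler_wpM2l// (le_trans (ldotR1 _ _ i))// ler_norm.
by rewrite -mulr_suml ler_wpM2r.
Qed.

Lemma hess_le k w : `|hess k w| <= U ^+ 2 * `|R2 (X k w) (X k.+1 w)|.
Proof.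
set r := `|R2 _ _|.
rewrite /hess qformE dotcE; apply: le_trans (ler_norm_sum _ _ _) _.
apply: (@le_trans _ _ (\sum_i `|u i 0| * (U * r))); last first.
  by rewrite -mulr_suml expr2 -mulrA ler_wpM2r//; exact: (mulr_ge0 U0 (normr_ge0 _)).
apply: ler_sum => i _; rewrite normrM ler_wpM2l// mxE.
apply: le_trans (ler_norm_sum _ _ _) _.
apply: (@le_trans _ _ (\sum_j `|u j 0| * r)); last by rewrite -mulr_suml ler_wpM2r//; exact: normr_ge0.
apply: ler_sum => j _; rewrite normrM mulrC ler_wpM2l//.
by apply: le_trans (lddotR2 _ _ i j) _; exact: ler_norm.
Qed.

Let mR (Rf : R -> R -> R) k : measurable_fun setT (fun p : R * R => Rf p.1 p.2) ->
  measurable_fun setT (fun w => Rf (X k w) (X k.+1 w)).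
Proof.
move=> mRf; apply: (@measurableT_comp _ _ _ _ _ _ (fun p : R * R => Rf p.1 p.2) _ (fun w => (X k w, X k.+1 w))) => //.
exact: measurable_fun_pair.
Qed.

Lemma xi_sqr k : L1 Q (fun w => xi k w ^+ 2) /\ \int[Q]_w (xi k w ^+ 2) <= U ^+ 2 * C.
Proof.
have [IR RC] := L1_nonneg (measurable_funX 2 (mR k mR1)) (fun w => sqr_ge0 _) (R1C k).
have le2 w : `|xi k w ^+ 2| <= U ^+ 2 * R1 (X k w) (X k.+1 w) ^+ 2.
  rewrite normrX -exprMn -(real_normK (num_real (U * _))) normrM (ger0_norm U0).
  by rewrite ler_pXn2r ?nnegrE ?mulr_ge0// xi_le.
have I2 : L1 Q (fun w => xi k w ^+ 2).
  apply: (L1_dom _ _ le2); last exact: L1Z.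
  by apply: measurable_funX; exact: measurable_xi.
split => //; apply: (@le_trans _ _ (\int[Q]_w (U ^+ 2 * R1 (X k w) (X k.+1 w) ^+ 2))).
  by apply: Ex_le => // [|w]; [exact: L1Z|apply: le_trans (le2 w); exact: ler_norm].
by rewrite ExZ// ler_wpM2l// sqr_ge0.
Qed.

Lemma hess_sqr k : L1 Q (fun w => hess k w ^+ 2) /\ \int[Q]_w (hess k w ^+ 2) <= U ^+ 4 * C.
Proof.
have [IR RC] := L1_nonneg (measurable_funX 2 (mR k mR2)) (fun w => sqr_ge0 _) (R2C k).
have U20 : 0 <= U ^+ 2 by exact: sqr_ge0.
have le2 w : `|hess k w ^+ 2| <= U ^+ 4 * R2 (X k w) (X k.+1 w) ^+ 2.
  rewrite normrX (exprM U 2 2) -exprMn -(real_normK (num_real (U ^+ 2 * _))) normrM (ger0_norm U20).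
  by rewrite ler_pXn2r ?nnegrE ?mulr_ge0// hess_le.
have I2 : L1 Q (fun w => hess k w ^+ 2).
  apply: (L1_dom _ _ le2); last exact: L1Z.
  by apply: measurable_funX; exact: measurable_hess.
split => //; apply: (@le_trans _ _ (\int[Q]_w (U ^+ 4 * R2 (X k w) (X k.+1 w) ^+ 2))).
  by apply: Ex_le => // [|w]; [exact: L1Z|apply: le_trans (le2 w); exact: ler_norm].
by rewrite ExZ// ler_wpM2l// exprn_ge0.
Qed.

Lemma hessD_sqr k : L1 Q (fun w => (hess k w + s2) ^+ 2) /\
  \int[Q]_w ((hess k w + s2) ^+ 2) <= 2 * (U ^+ 4 * C) + 2 * s2 ^+ 2.
Proof.
have [I2 E2] := hess_sqr k.
have Is : L1 Q (fun w => (fun=> s2) w ^+ 2) by exact: L1_cst.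
have I : L1 Q (fun w => (hess k w + s2) ^+ 2).
  by apply: (L1_sqrD (f := hess k) (g := fun=> s2)) => //; exact: measurable_hess.
split => //; apply: (@le_trans _ _ (\int[Q]_w (2 * hess k w ^+ 2 + 2 * s2 ^+ 2))).
  apply: Ex_le => // [|w]; first by apply: L1D; [exact: L1Z|exact: L1_cst].
  by have := sqr_ge0 (hess k w - s2); nra.
rewrite ExD; [|exact: L1Z|exact: L1_cst].
by rewrite ExZ// Ex_cst lerD2r ler_pM2l.
Qed.

(** Solves the recursion of the model, making X_k a measurable function of the innovations up to k.
    Anything known before step j becomes a function on [history]. *)
Let XH : history R -> nat -> R := fix XH h k := if k is k'.+1 then S t (XH h k') + h k else h 0%N.

Let mXH k : measurable_fun setT (fun h => XH h k).
Proof.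
elim: k => [|k IH]; first exact: measurable_coord.
by apply: measurable_funD; [apply: measurableT_comp => //; exact: Sm|exact: measurable_coord].
Qed.

Let XHE j k w : (k < j)%N -> XH (past Y j w) k = X k w.
Proof.
elim: k => [|k IH] kj; first by rewrite /= /past kj.
by rewrite /= IH ?(ltnW kj)// /past kj /= subrKC.
Qed.

Let xiH (h : history R) k : R := - (score g (h k.+1) * a (XH h k)).

Let mxiH k : measurable_fun setT (fun h : history R => xiH h k).
Proof.
apply: measurableT_comp => //; apply: measurable_funM.
  by apply: measurableT_comp => //; exact: measurable_coord.
exact: (measurableT_comp ma (mXH k)).
Qed.

Let xiHE j k w : (k.+1 < j)%N -> xiH (past Y j w) k = xi k w.
Proof. by move=> kj; rewrite /xiH xiE XHE ?(ltnW kj)// /past kj. Qed.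

Let mfst (f : history R -> R) : measurable_fun setT f -> measurable_fun setT (fun z : history R * R => f z.1).
Proof. by move=> mf; exact: (measurableT_comp mf). Qed.
Let msnd (f : R -> R) : measurable_fun setT f -> measurable_fun setT (fun z : history R * R => f z.2).
Proof. by move=> mf; exact: (measurableT_comp mf). Qed.

Let score_L1 : L1 nu (score g). Proof. exact: L1_sqr. Qed.

Let inner0 (c : R) : (\int[nu]_e (c * score g e)%:E = 0)%E.
Proof. by rewrite -Ex_EFin; [rewrite ExZ// score_mean mulr0|exact: L1Z]. Qed.

Lemma mart_xi (phi : history R -> R) j : measurable_fun setT phi ->
  L1 Q (fun w => phi (past Y j.+1 w) * xi j w) ->
  \int[Q]_w (phi (past Y j.+1 w) * xi j w) = 0.
Proof.
move=> mphi; pose F h e := phi h * a (XH h j) * - score g e.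
have E w : phi (past Y j.+1 w) * xi j w = F (past Y j.+1 w) (Y j.+1 w).
  by rewrite /F xiE XHE//; ring.
rewrite (funext E).
move=> IF; apply: (fubini_past0 mY iY (fun A => @nuE j.+1 A isT) _ IF).
  apply: measurable_funM; last by apply: measurableT_comp => //; exact: msnd.
  by apply: measurable_funM; [exact: mfst|exact: (mfst (measurableT_comp ma (mXH j)))].
move=> h; rewrite -[RHS](inner0 (- (phi h * a (XH h j)))); apply: eq_integral => e _.
by rewrite /F mulrN mulNr.
Qed.

Lemma mart_xi2 (phi : history R -> R) j : measurable_fun setT phi ->
  L1 Q (fun w => phi (past Y j.+1 w) * (xi j w ^+ 2 + hess j w)) ->
  \int[Q]_w (phi (past Y j.+1 w) * (xi j w ^+ 2 + hess j w)) = 0.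
Proof.
move=> mphi; pose F h e := phi h * (a (XH h j) ^+ 2 * (score g e ^+ 2 + score1 g e) - b (XH h j) * score g e).
have E w : phi (past Y j.+1 w) * (xi j w ^+ 2 + hess j w) = F (past Y j.+1 w) (Y j.+1 w).
  by rewrite /F xiE hessE XHE//; ring.
rewrite (funext E).
move=> IF; apply: (fubini_past0 mY iY (fun A => @nuE j.+1 A isT) _ IF).
  apply: measurable_funM; first exact: mfst.
  apply: measurable_funB; apply: measurable_funM.
  - exact: (mfst (measurable_funX 2 (measurableT_comp ma (mXH j)))).
  - by apply: (msnd (f := fun e => score g e ^+ 2 + score1 g e)); apply: measurable_funD => //; exact: measurable_funX.
  - exact: (mfst (measurableT_comp mb (mXH j))).
  - exact: msnd.
move=> h; have I1 : L1 nu (fun e => score g e ^+ 2 + score1 g e) by exact: L1D.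
rewrite -Ex_EFin; last by apply: L1Z; apply: L1B; exact: L1Z.
rewrite ExZ; last by apply: L1B; exact: L1Z.
rewrite ExB; [|exact: L1Z|exact: L1Z].
by rewrite !ExZ// ExD// score_mean score1_mean subrr !mulr0 subrr mulr0.
Qed.

Let M n j w : R := (Num.sqrt (n%:R : R))^-1 * \sum_(i < j) xi i w.
Let MH n (h : history R) j : R := (Num.sqrt (n%:R : R))^-1 * \sum_(i < j) xiH h i.

Let mMH n j : measurable_fun setT (fun h : history R => MH n h j).
Proof. by apply: measurable_funM => //; apply: measurable_sum => i; exact: mxiH. Qed.

Let MHE n j w : MH n (past Y j.+1 w) j = M n j w.
Proof. by rewrite /MH /M; congr (_ * _); apply: eq_bigr => i _; rewrite xiHE ?ltnS. Qed.

Let mtrig n j c (h : R -> R) : continuous h -> measurable_fun setT (fun hh : history R => h (MH n hh j + c)).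
Proof.
move=> ch; apply: (@measurableT_comp _ _ _ _ _ _ h); first exact: continuous_measurable_fun.
by apply: measurable_funD => //; exact: mMH.
Qed.

Let mpast (f : history R -> R) j : measurable_fun setT f -> measurable_fun setT (fun w => f (past Y j w)).
Proof. by move=> mf; exact: (measurableT_comp mf (measurable_past mY j)). Qed.

Let xi1 j : L1 Q (xi j). Proof. by apply: L1_sqr; [exact: measurable_xi|exact: (xi_sqr j).1]. Qed.
Let hess1 j : L1 Q (hess j). Proof. by apply: L1_sqr; [exact: measurable_hess|exact: (hess_sqr j).1]. Qed.

Lemma mart_sin n j c : \int[Q]_w (sin (M n j w + c) * xi j w) = 0.
Proof.
have m1 := mtrig n j c (@continuous_sin R).
under eq_Rintegral do rewrite -MHE.
apply: (mart_xi m1); apply: (@L1_mul_bounded _ _ _ _ 1) => //; first exact: (mpast _ m1).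
by move=> w; exact: sin_max.
Qed.

Lemma mart_cos n j c : \int[Q]_w (cos (M n j w + c) * (xi j w ^+ 2 + (hess j w + s2) - s2)) = 0.
Proof.
have m1 := mtrig n j c (@continuous_cos R).
under eq_Rintegral do rewrite -MHE addrA addrK.
apply: (mart_xi2 m1); apply: (@L1_mul_bounded _ _ _ _ 1) => //; first exact: (mpast _ m1).
  by move=> w; exact: cos_max.
by apply: L1D => //; exact: (xi_sqr j).1.
Qed.

Lemma mart_orth i j : (i < j)%N -> \int[Q]_w (xi i w * xi j w) = 0.
Proof.
move=> ij.
have E : (fun w => xi i w * xi j w) = (fun w => xiH (past Y j.+1 w) i * xi j w).
  by apply/funext => w; rewrite xiHE ?ltnS.
rewrite E; apply: (mart_xi (mxiH i)); rewrite -E.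
by apply: L1M_sqr; [exact: measurable_xi|exact: measurable_xi|exact: (xi_sqr i).1|exact: (xi_sqr j).1].
Qed.

(** Integrates the tangent line inequality f^2 >= 2 m f - m^2 at the mean m. The right-hand side may
    be infinite, as square integrability is not yet known where this is used. *)
Lemma Jensen_sqr (f : R -> R) : L1 nu f -> (((\int[nu]_e f e) ^+ 2)%:E <= \int[nu]_e (f e ^+ 2)%:E)%E.
Proof.
move=> If; have mf := L1_measurable If.
have [foo|] := boolP (\int[nu]_e (f e ^+ 2)%:E < +oo)%E; last by rewrite -leNgt leye_eq => /eqP ->; rewrite leey.
have I2 : L1 nu (fun e => f e ^+ 2).
  apply/integrableP; split; first by apply/measurable_EFinP/measurable_funX.
  by under eq_integral do rewrite /= ger0_norm ?sqr_ge0//.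
rewrite -Ex_EFin// lee_fin; set m := \int[nu]_e f e.
apply: (@le_trans _ _ (\int[nu]_e (2 * m * f e - m ^+ 2))).
  rewrite ExB; [|exact: L1Z|exact: L1_cst].
  by rewrite ExZ// Ex_cst -/m; lra.
apply: Ex_le => // [|e]; first by apply: L1B; [exact: L1Z|exact: L1_cst].
by have := sqr_ge0 (f e - m); nra.
Qed.

(* By Jensen, (Ig a^2)^2 is at most the conditional second moment of the Hessian,
   so a has a fourth moment bounded uniformly in the parameter: this is what makes
   the Lindeberg condition uniform. *)
Definition A4 : R := U ^+ 4 * C / Ig ^+ 2.

Let a4 k : L1 Q (fun w => a (X k w) ^+ 4) /\ \int[Q]_w (a (X k w) ^+ 4) <= A4.
Proof.
have [I2 E2] := hess_sqr k.
have Ig20 : 0 < Ig ^+ 2 by rewrite exprn_gt0.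
have ma4 : measurable_fun setT (fun w => a (X k w) ^+ 4).
  by apply: measurable_funX; exact: (measurableT_comp ma (mX k)).
pose F h e := (score1 g e * a (XH h k) ^+ 2 - score g e * b (XH h k)) ^+ 2.
have mF : measurable_fun setT (fun z : history R * R => F z.1 z.2).
  apply: measurable_funX; apply: measurable_funB; apply: measurable_funM.
  - exact: msnd.
  - exact: (mfst (measurable_funX 2 (measurableT_comp ma (mXH k)))).
  - exact: msnd.
  - exact: (mfst (measurableT_comp mb (mXH k))).
have T : (\int[Q]_w (Ig ^+ 2 * a (X k w) ^+ 4)%:E <= (U ^+ 4 * C)%:E)%E.
  apply: (@le_trans _ _ (\int[Q]_w (hess k w ^+ 2)%:E)%E); last by rewrite -Ex_EFin// lee_fin.
  have E w : hess k w ^+ 2 = F (past Y k.+1 w) (Y k.+1 w) by rewrite /F hessE XHE.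
  under [leRHS]eq_integral do rewrite E.
  rewrite (tonelli_past mY iY (fun A => @nuE k.+1 A isT) mF); last by move=> h e; exact: sqr_ge0.
  apply: ge0_le_integral => //.
  - by move=> w _; rewrite lee_fin mulr_ge0 ?(ltW Ig20)// (exprM _ 2 2) sqr_ge0.
  - by apply/measurable_EFinP; apply: measurable_funM.
  - apply: (@measurableT_comp _ _ _ _ _ _ (fun h : history R => \int[nu]_e (F h e)%:E)%E); last exact: measurable_past.
    have mF' : measurable_fun setT (fun z : history R * R => (F z.1 z.2)%:E) by exact/measurable_EFinP.
    apply: (@measurable_fun_fubini_tonelli_F _ _ _ _ _ nu (fun z => (F z.1 z.2)%:E)) => // z.
    by rewrite lee_fin sqr_ge0.
  - move=> w _; rewrite /F XHE//; set x := a _; set y := b _.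
    have If : L1 nu (fun e => score1 g e * x ^+ 2 - score g e * y).
      rewrite (_ : (fun e => _) = fun e => x ^+ 2 * score1 g e - y * score g e).
        by apply: L1B; exact: L1Z.
      by apply/funext => e; ring.
    apply: le_trans (Jensen_sqr If); rewrite lee_fin.
    (* The score having mean 0, the Hessian has conditional mean - Ig a^2, free of second
       derivatives of S. *)
    have -> : \int[nu]_e (score1 g e * x ^+ 2 - score g e * y) = \int[nu]_e (x ^+ 2 * score1 g e - y * score g e).
      by apply: eq_Rintegral => e _; ring.
    rewrite ExB; [|exact: L1Z|exact: L1Z].
    rewrite !ExZ// score_mean score1_mean mulr0 subr0 mulrN sqrrN exprMn -exprM mulrC.
    exact: lexx.
have mI : measurable_fun setT (fun w => Ig ^+ 2 * a (X k w) ^+ 4) by exact: measurable_funM.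
have [I4 E4] := L1_nonneg mI (fun w => mulr_ge0 (ltW Ig20) (exprn_even_ge0 (a (X k w)) (isT : ~~ odd 4))) T.
have I : L1 Q (fun w => a (X k w) ^+ 4).
  rewrite (_ : (fun w => _) = fun w => Ig ^- 2 * (Ig ^+ 2 * a (X k w) ^+ 4)); first exact: L1Z.
  by apply/funext => w; rewrite mulKf// gt_eqF.
split => //; rewrite /A4 ler_pdivlMr// mulrC -ExZ//.
Qed.

Definition score_tail (kap : R) : R := \int[nu]_e (score g e ^+ 2 * \1_([set e | kap < `|score g e|]) e).

Let mind kap : measurable_fun setT (\1_([set e | kap < `|score g e|]) : R -> R).
Proof. by apply: measurable_indic; apply: measurable_gt; exact: measurableT_comp. Qed.

Let tail_L1 kap : L1 nu (fun e => score g e ^+ 2 * \1_([set e | kap < `|score g e|]) e).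
Proof.
rewrite (_ : (fun e => _) = fun e => \1_([set e | kap < `|score g e|]) e * score g e ^+ 2); last first.
  by apply/funext => e; rewrite mulrC.
apply: (@L1_mul_bounded _ _ _ _ 1); [exact: mind| |exact: score2_L1].
by move=> e; rewrite indicE; case: (_ \in _); rewrite /= ?normr1 ?normr0.
Qed.

Lemma score_tail_ge0 kap : 0 <= score_tail kap.
Proof. by apply: Ex_ge0 => e; rewrite mulr_ge0 ?sqr_ge0// indicE. Qed.

Let tail_sqr k kap :
  L1 Q (fun w => score g (Y k.+1 w) ^+ 2 * \1_([set e | kap < `|score g e|]) (Y k.+1 w) * a (X k w) ^+ 2) /\
  \int[Q]_w (score g (Y k.+1 w) ^+ 2 * \1_([set e | kap < `|score g e|]) (Y k.+1 w) * a (X k w) ^+ 2)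
    <= score_tail kap * (1 + A4).
Proof.
have [I4 E4] := a4 k.
pose ind e : R := \1_([set e | kap < `|score g e|]) e.
have ind0 e : 0 <= ind e by rewrite /ind indicE.
have mi : measurable_fun setT (fun e => score g e ^+ 2 * ind e).
  by apply: measurable_funM; [exact: measurable_funX|exact: mind].
pose F h e := score g e ^+ 2 * ind e * a (XH h k) ^+ 2.
have mF : measurable_fun setT (fun z : history R * R => F z.1 z.2).
  apply: measurable_funM; first exact: (msnd mi).
  exact: (mfst (measurable_funX 2 (measurableT_comp ma (mXH k)))).
have E w : score g (Y k.+1 w) ^+ 2 * ind (Y k.+1 w) * a (X k w) ^+ 2 = F (past Y k.+1 w) (Y k.+1 w).
  by rewrite /F XHE.
have F0 h e : 0 <= F h e by apply: mulr_ge0; [apply: mulr_ge0 => //; exact: sqr_ge0|exact: sqr_ge0].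
apply: L1_nonneg.
- apply: measurable_funM; first exact: (measurableT_comp mi (mY k.+1)).
  by apply: measurable_funX; exact: (measurableT_comp ma (mX k)).
- by move=> w; rewrite E; exact: F0.
rewrite -/ind; under eq_integral do rewrite E.
rewrite (tonelli_past mY iY (fun A => @nuE k.+1 A isT) mF F0).
rewrite (_ : (fun w => _) = fun w => (score_tail kap * a (X k w) ^+ 2)%:E); last first.
  apply/funext => w; rewrite /F XHE//.
  rewrite (_ : (fun e => _) = fun e => (a (X k w) ^+ 2 * (score g e ^+ 2 * ind e))%:E); last first.
    by apply/funext => e; rewrite mulrC.
  rewrite -Ex_EFin; last exact/L1Z/tail_L1.
  by rewrite ExZ ?tail_L1// mulrC.
have I2 : L1 Q (fun w => a (X k w) ^+ 2).
  apply: (L1_dom (g := fun w => 1 + a (X k w) ^+ 4)).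
  - by apply: measurable_funX; exact: (measurableT_comp ma (mX k)).
  - by apply: L1D => //; exact: L1_cst.
  - by move=> w; rewrite ger0_norm ?sqr_ge0//; have := sqr_ge0 (a (X k w) ^+ 2 - 1); nra.
rewrite -Ex_EFin; last exact: L1Z.
rewrite lee_fin ExZ// ler_wpM2l ?score_tail_ge0//.
apply: (@le_trans _ _ (\int[Q]_w (1 + a (X k w) ^+ 4))).
  apply: Ex_le => // [|w]; first by apply: L1D => //; exact: L1_cst.
  by have := sqr_ge0 (a (X k w) ^+ 2 - 1); nra.
by rewrite ExD ?Ex_cst ?lerD2l//; exact: L1_cst.
Qed.

(** The truncation acts on the innovation score and not on xi. Above [kap] the quadratic bound on
    [lrem] leaves the tail of [nu]; below it the cubic bound applies with |a|^3 <= 1 + a^4. Neither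
    piece depends on theta except through [A4], a uniform bound. *)
Lemma lindeberg n kap : (0 < n)%N -> 0 <= kap ->
  \sum_(j < n) \int[Q]_w lrem ((Num.sqrt (n%:R : R))^-1 * xi j w) <=
  (score_tail kap + kap ^+ 3 / Num.sqrt n%:R) * (1 + A4).
Proof.
move=> n0 kap0; set sn := Num.sqrt n%:R.
have nR0 : 0 < n%:R :> R by rewrite ltr0n.
have sn0 : 0 < sn by rewrite sqrtr_gt0.
have sn2 : sn ^+ 2 = n%:R by rewrite sqr_sqrtr// ltW.
have snV : sn^-1 ^+ 2 = n%:R^-1 by rewrite exprVn sn2.
pose ind e : R := \1_([set e | kap < `|score g e|]) e.
suff step (j : 'I_n) : \int[Q]_w lrem (sn^-1 * xi j w) <=
    n%:R^-1 * ((score_tail kap + kap ^+ 3 / sn) * (1 + A4)).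
  apply: le_trans (ler_sum _ (fun j _ => step j)) _.
  by rewrite sumr_const card_ord -[leLHS]mulr_natl mulrA mulfV ?mul1r// gt_eqF.
have [I4 E4] := a4 j; have [It Et] := tail_sqr j kap.
have Il : L1 Q (fun w => lrem (sn^-1 * xi j w)).
  apply: (L1_dom (g := fun w => n%:R^-1 * xi j w ^+ 2)).
  - have h : measurable_fun setT (fun w => sn^-1 * xi j w).
      by apply: measurable_funM => //; exact: measurable_xi.
    by apply: measurable_minr; apply: measurable_funX => //; exact: measurableT_comp.
  - exact/L1Z/(xi_sqr j).1.
  - by move=> w; rewrite ger0_norm ?lrem_ge0// (le_trans (lrem_le2 _))// exprMn snV.
have Ib : L1 Q (fun w => n%:R^-1 * (score g (Y j.+1 w) ^+ 2 * ind (Y j.+1 w) * a (X j w) ^+ 2)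
   + n%:R^-1 * (kap ^+ 3 / sn) * (1 + a (X j w) ^+ 4)).
  by apply: L1D; apply: L1Z => //; apply: L1D => //; exact: L1_cst.
apply: (@le_trans _ _ (\int[Q]_w (n%:R^-1 * (score g (Y j.+1 w) ^+ 2 * ind (Y j.+1 w) * a (X j w) ^+ 2)
   + n%:R^-1 * (kap ^+ 3 / sn) * (1 + a (X j w) ^+ 4)))); last first.
  have I14 : L1 Q (fun w => 1 + a (X j w) ^+ 4) by apply: L1D => //; exact: L1_cst.
  rewrite ExD; [|exact: L1Z|exact: L1Z].
  rewrite !ExZ// ExD//; last exact: L1_cst.
  rewrite Ex_cst -mulrA -mulrDr ler_wpM2l ?invr_ge0 ?(ltW nR0)// mulrDl lerD//.
  by rewrite ler_wpM2l ?lerD2l// divr_ge0 ?exprn_ge0// ltW.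
apply: Ex_le => // w; rewrite /ind indicE xiE; set y := score g _; set x := a _.
have x40 : 0 <= x ^+ 4 by rewrite (exprM _ 2 2) sqr_ge0.
case: (boolP (_ \in _)) => [_|/negP H].
  apply: le_trans (lrem_le2 _) _; rewrite exprMn snV sqrrN exprMn mulr1 lerDl.
  apply: mulr_ge0; last by rewrite addr_ge0.
  by rewrite mulr_ge0 ?invr_ge0 ?(ltW nR0)// mulr_ge0 ?invr_ge0 ?(ltW sn0)// exprn_ge0.
have yk : `|y| <= kap by rewrite leNgt; apply/negP => yk; apply: H; rewrite inE.
rewrite mulr0 mul0r mulr0 add0r; apply: le_trans (lrem_le3 _) _.
rewrite !normrM normrN normrM normfV (gtr0_norm sn0) !exprMn.
have -> : sn^-1 ^+ 3 = n%:R^-1 / sn by rewrite exprSr snV.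
have x3 : `|x| ^+ 3 <= 1 + x ^+ 4.
  have -> : x ^+ 4 = `|x| ^+ 4 by rewrite !(exprM _ 2 2) real_normK ?num_real.
  move: (normr_ge0 x) => h; set z := `|x| in h *.
  have [z1|z1] := leP z 1.
    have : z ^+ 3 <= 1 by rewrite exprn_ile1.
    have : 0 <= z ^+ 4 by rewrite exprn_ge0.
    lra.
  have : z ^+ 3 <= z ^+ 4 by rewrite ler_eXn2l.
  lra.
have y3 : `|y| ^+ 3 <= kap ^+ 3 by rewrite ler_pXn2r ?nnegrE.
have c0 : 0 <= n%:R^-1 / sn by rewrite mulr_ge0 ?invr_ge0 ?ltW.
rewrite (_ : n%:R^-1 * (kap ^+ 3 / sn) * (1 + x ^+ 4) = n%:R^-1 / sn * (kap ^+ 3 * (1 + x ^+ 4))).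
  by rewrite ler_wpM2l//; apply: ler_pM => //; exact: exprn_ge0.
by ring.
Qed.

Lemma sqr_sum_le (f : nat -> R) m : (\sum_(k < m) f k) ^+ 2 <= m%:R * \sum_(k < m) f k ^+ 2.
Proof.
elim: m => [|m IH]; first by rewrite !big_ord0 expr0n mul0r.
rewrite !big_ord_recr/=; set s := \sum_(i < m) f i in IH *; set q := \sum_(i < m) _ in IH *.
case: m @s @q IH => [|m] s q IH.
  by rewrite /s /q !big_ord0 !add0r mul1r.
have m0 : 0 < m.+1%:R :> R by rewrite ltr0n.
rewrite -(ler_pM2l m0) -(natr1 m.+1); set r := m.+1%:R in IH m0 *; set a0 := f m.+1.
have := sqr_ge0 (s - r * a0); have : (r + 1) * s ^+ 2 <= (r + 1) * (r * q) by rewrite ler_wpM2l// addr_ge0 ?ltW.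
by nra.
Qed.

Definition hess_bound : R := 2 * (U ^+ 4 * C) + 2 * s2 ^+ 2.

(** [Ex_abs_le] at scale n L. Off an event of probability [dl] the sum is of order sqrt m. On it the
    crude second moment n^2 [hess_bound], from Cauchy-Schwarz alone, suffices because L is free. *)
Lemma sum_hess_le n (C' dl L : R) : (0 < n)%N -> 0 < C' -> 0 < L -> 0 <= dl ->
  (forall m, (Q [set w | (U ^+ 2 * (Num.sqrt m%:R * C') < `|\sum_(k < m) (hess k w + s2)|)%R] <= dl%:E)%E) ->
  forall m, (m <= n)%N -> \int[Q]_w `|\sum_(k < m) (hess k w + s2)| <=
    (U ^+ 2 * C' / Num.sqrt n%:R + L * dl + hess_bound / L) * n%:R.
Proof.
move=> n0 C'0 L0 dl0 H m mn.
have nR0 : 0 < n%:R :> R by rewrite ltr0n.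
have mn' : m%:R <= n%:R :> R by rewrite ler_nat.
pose D k w := hess k w + s2.
have mD k : measurable_fun setT (D k) by apply: measurable_funD => //; exact: measurable_hess.
have D2 k : L1 Q (fun w => D k w ^+ 2) := (hessD_sqr k).1.
have mS : measurable_fun setT (fun w => \sum_(k < m) D k w) by apply: measurable_sum => k; exact: mD.
have Ib : L1 Q (fun w => m%:R * \sum_(k < m) D k w ^+ 2) by apply/L1Z/L1_sum => k _; exact: D2.
have IS : L1 Q (fun w => (\sum_(k < m) D k w) ^+ 2).
  apply: (L1_dom _ Ib); first exact: measurable_funX.
  by move=> w; rewrite ger0_norm ?sqr_ge0//; exact: (sqr_sum_le (D^~ w)).
have HD0 : 0 <= hess_bound.
  have h := (hessD_sqr 0).2; rewrite /hess_bound; apply: le_trans h; apply: Ex_ge0 => w; exact: sqr_ge0.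
have ES : \int[Q]_w ((\sum_(k < m) D k w) ^+ 2) <= n%:R ^+ 2 * hess_bound.
  apply: (@le_trans _ _ (\int[Q]_w (m%:R * \sum_(k < m) D k w ^+ 2))).
    by apply: Ex_le => // w; exact: (sqr_sum_le (D^~ w)).
  rewrite ExZ; last by apply: L1_sum => k _; exact: D2.
  rewrite Ex_sum; last by move=> k _; exact: D2.
  apply: (@le_trans _ _ (m%:R * (m%:R * hess_bound))).
    rewrite ler_wpM2l//; apply: (@le_trans _ _ (\sum_(k < m) hess_bound)).
      by apply: ler_sum => k _; exact: (hessD_sqr k).2.
    by rewrite sumr_const card_ord -/hess_bound -[leLHS]mulr_natl.
  by rewrite mulrA -expr2 ler_wpM2r// ler_pXn2r ?nnegrE.
have e0 : 0 <= U ^+ 2 * (Num.sqrt m%:R * C').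
  by rewrite mulr_ge0 ?sqr_ge0// mulr_ge0 ?sqrtr_ge0// ltW.
have L'0 : 0 < n%:R * L by rewrite mulr_gt0.
apply: le_trans (Ex_abs_le mS L'0 e0 IS ES (H m)) _.
move: (hess_bound) => hd.
rewrite !mulrDl; apply: lerD; [apply: lerD|].
- have sn0 : 0 < Num.sqrt n%:R :> R by rewrite sqrtr_gt0.
  have -> : U ^+ 2 * C' / Num.sqrt n%:R * n%:R = U ^+ 2 * (Num.sqrt n%:R * C').
    by rewrite -[X in _ * X](@sqr_sqrtr _ n%:R) ?(ltW nR0)//; field; rewrite gt_eqF.
  by rewrite ler_wpM2l ?sqr_ge0// ler_wpM2r ?(ltW C'0)// ler_wsqrtr.
- by rewrite (_ : n%:R * L * dl = L * dl * n%:R)//; ring.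
- have -> : n%:R ^+ 2 * hd / (n%:R * L) = hd / L * n%:R by field; rewrite !gt_eqF.
  exact: lexx.
Qed.

Lemma char_bound n kap eps B beta c : (0 < n)%N -> 0 <= kap -> (0 < B)%N -> 0 < beta ->
  (forall m, (m <= n)%N -> \int[Q]_w `|\sum_(k < m) (hess k w + s2)| <= eps * n%:R) ->
  `|\int[Q]_w cos ((Num.sqrt (n%:R : R))^-1 * \sum_(i < n) xi i w + c) - expR (- (s2 / 2)) * cos c| <=
  2 * ((score_tail kap + kap ^+ 3 / Num.sqrt n%:R) * (1 + A4)) + s2 ^+ 2 / n%:R + B%:R * eps
    + (beta * (U ^+ 2 * C * (B%:R^-1 + n%:R^-1) + (s2 * (B%:R^-1 + n%:R^-1)) ^+ 2) + hess_bound / beta).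
Proof.
move=> n0 kap0 B0 beta0 DV.
apply: (martingale_cos_bound (D := fun k w => hess k w + s2)) => //.
- by move=> j; exact: measurable_xi.
- by move=> j; apply: measurable_funD => //; exact: measurable_hess.
- by move=> j; exact: (xi_sqr j).1.
- by move=> j; exact: (xi_sqr j).2.
- by move=> j; exact: (hessD_sqr j).1.
- by move=> j; exact: (hessD_sqr j).2.
- by move=> j c' _; exact: mart_sin.
- by move=> j c' _; exact: mart_cos.
- by move=> i j; exact: mart_orth.
- exact: lindeberg.
Qed.

End FixedParameter.

Lemma score_tail_small (R : realType) (g : R -> R) (nu : probability R R) (eps : R) :
  measurable_fun setT (score g) -> L1 nu (fun e => score g e ^+ 2) -> 0 < eps ->
  exists kap, 0 <= kap /\ score_tail g nu kap <= eps.
Proof.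
move=> ms I2 e0.
pose h n e : R := score g e ^+ 2 * \1_([set e | n%:R < `|score g e|]) e.
have mh n : measurable_fun setT (h n).
  apply: measurable_funM; first exact: measurable_funX.
  apply: measurable_indic; apply: (measurable_gt (f := fun e => `|score g e|)).
  exact: (measurableT_comp (@normr_measurable _ _) ms).
have hI n x : 0 <= h n x <= score g x ^+ 2.
  rewrite /h indicE; case: (_ \in _) => /=; last by rewrite mulr0 lexx sqr_ge0.
  by rewrite mulr1 lexx sqr_ge0.
have hn x n : 0 <= h n x by case/andP: (hI n x).
have cv x : setT x -> (h n x)%:E @[n --> \oo] --> 0%E.
  move=> _; apply: cvg_near_cst.
  have [m _ Hm] := @nbhs_infty_ger R `|score g x|; exists m => // n mn.
  rewrite /h indicE (_ : _ \in _ = false) ?mulr0//; apply/negbTE/negP; rewrite inE/= => xn.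
  by have := Hm n mn; rewrite /= leNgt xn.
have dm : forall x n, setT x -> (`|(h n x)%:E| <= (score g x ^+ 2)%:E)%E.
  by move=> x n _; have /andP[h0 h1] := hI n x; rewrite /= lee_fin ger0_norm.
have [_ _ H] := @dominated_convergence _ _ _ nu setT measurableT (fun n x => (h n x)%:E) (cst 0%E)
  (fun x => (score g x ^+ 2)%:E) (fun n => (measurable_EFinP _ _).2 (mh n)) (measurable_cst _)
  (aeW _ cv) I2 (aeW _ dm).
have IL n : L1 nu (h n).
  by apply: (L1_dom _ I2) => // x; have /andP[h0 h1] := hI n x; rewrite ger0_norm.
move: H; rewrite integral0 => H.
have [_ H2] := (fine_cvgP _ _).1 H.
have [n _ Hn] := cvgr_lt (0 : R) H2 eps e0; exists n%:R; split => //.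
by apply/ltW; have := Hn n (leqnn n).
Qed.

Lemma measurable_mx_norm (R : realType) dT (T : measurableType dT) m n (Y : T -> 'M[R]_(m, n)) :
  (forall i j, measurable_fun setT (fun w => Y w i j)) -> measurable_fun setT (fun w => `|Y w|).
Proof.
move=> mY; rewrite (_ : (fun w => _) = fun w => \big[Num.max/0]_(ij <- index_enum _) `|Y w ij.1 ij.2|).
  elim: (index_enum _) => [|ij s IH].
    by rewrite (_ : (fun w => _) = fun=> 0)//; apply/funext => w; rewrite big_nil.
  rewrite (_ : (fun w => _) = fun w => Num.max `|Y w ij.1 ij.2| (\big[Num.max/0]_(ij <- s) `|Y w ij.1 ij.2|)).
    by apply: measurable_maxr => //; exact: (measurableT_comp (@normr_measurable _ _) (mY _ _)).
  by apply/funext => w; rewrite big_cons.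
by apply/funext => w; rewrite [LHS]/Num.norm/= mx_normrE.
Qed.

Lemma inv_sqrt_small (R : realType) (q e : R) : 0 <= q -> 0 < e ->
  exists n0, (0 < n0)%N /\ forall n, (n0 <= n)%N -> q / Num.sqrt n%:R <= e /\ q / n%:R <= e.
Proof.
move=> q0 e0; exists (Num.truncn ((q / e) ^+ 2 + q / e)).+1; split => // n nn.
have n0 : 0 < n%:R :> R by rewrite ltr0n (leq_trans _ nn).
have qe0 : 0 <= q / e by rewrite divr_ge0// ltW.
have h : (q / e) ^+ 2 + q / e <= n%:R.
  apply: ltW; apply: lt_le_trans (truncnS_gt _) _.
  by rewrite ler_nat.
have h2 : q / e <= n%:R by apply: le_trans h; rewrite lerDr sqr_ge0.
have h1 : (q / e) ^+ 2 <= n%:R by apply: le_trans h; rewrite lerDl.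
split; first last.
  by rewrite ler_pdivrMr// -ler_pdivrMl// mulrC.
rewrite ler_pdivrMr ?sqrtr_gt0// -ler_pdivrMl// mulrC.
by rewrite -(@ler_pXn2r _ 2)// ?nnegrE ?sqrtr_ge0// sqr_sqrtr// ltW.
Qed.

Lemma qform_le_norm (R : realType) d (A : 'M[R]_d) (u : 'cV[R]_d) :
  `|qform A u| <= (\sum_i `|u i 0|) ^+ 2 * `|A|.
Proof.
rewrite qformE dotcE; apply: le_trans (ler_norm_sum _ _ _) _.
apply: (@le_trans _ _ (\sum_i `|u i 0| * ((\sum_i `|u i 0|) * `|A|))); last by rewrite -mulr_suml expr2 mulrA.
apply: ler_sum => i _; rewrite normrM ler_wpM2l// mxE.
apply: le_trans (ler_norm_sum _ _ _) _; rewrite mulr_suml; apply: ler_sum => j _.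
by rewrite normrM mulrC ler_wpM2l// norm_coord.
Qed.

Lemma qformDl (R : realType) d (A B : 'M[R]_d) u : qform (A + B) u = qform A u + qform B u.
Proof. by rewrite !qformE mulmxDl dotcDr. Qed.

Lemma qformZl (R : realType) d a (A : 'M[R]_d) u : qform (a *: A) u = a * qform A u.
Proof. by rewrite !qformE -scalemxAl dotcZr. Qed.

Lemma qform_sum (R : realType) d (I : Type) (r : seq I) (F : I -> 'M[R]_d) u :
  qform (\sum_(i <- r) F i) u = \sum_(i <- r) qform (F i) u.
Proof.
elim: r => [|i r IH]; last by rewrite !big_cons qformDl IH.
by rewrite !big_nil -(scale0r (0 : 'M[R]_d)) qformZl mul0r.
Qed.

Lemma dotc_sum (R : realType) d (I : Type) (r : seq I) (F : I -> 'cV[R]_d) u :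
  dotc u (\sum_(i <- r) F i) = \sum_(i <- r) dotc u (F i).
Proof.
elim: r => [|i r IH]; last by rewrite !big_cons dotcDr IH.
by rewrite !big_nil -(scale0r (0 : 'cV[R]_d)) dotcZr mul0r.
Qed.

Lemma enorm_le_sum (R : realType) d (u : 'cV[R]_d) : enorm u <= \sum_i `|u i 0|.
Proof.
rewrite -(@ler_pXn2r _ 2)// ?nnegrE ?enorm_ge0 ?sumr_ge0// enormE dotcE.
rewrite [leRHS]expr2 mulr_suml; apply: ler_sum => i _.
rewrite -expr2 -real_normK ?num_real// expr2 ler_wpM2l// (bigD1 i)//= lerDl.
exact: sumr_ge0.
Qed.

Lemma big_pred_shift (V : zmodType) (F : nat -> nat -> V) n :
  \sum_(1 <= j < n.+1) F j.-1 j = \sum_(i < n) F i i.+1.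
Proof. by rewrite big_add1/= big_mkord. Qed.

(** * Uniform central limit theorem for the score *)

Section UniformCLT.
Variables (R : realType) (d : nat) (Theta : set 'cV[R]_d) (S : 'cV[R]_d -> R -> R) (g : R -> R).
Hypotheses (oT : open Theta) (S3 : forall x, C3_on Theta (S^~ x))
  (g0 : forall x, 0 < g x) (g3 : C3_R g) (Sm : forall t, measurable_fun setT (S t)).
Context dO (Omega : measurableType dO) (P : 'cV[R]_d -> probability Omega R) (X : nat -> Omega -> R).
Hypotheses (mX : forall j, measurable_fun setT (X j))
  (iY : forall t, Theta t -> mutual_indep (P t) (innov S X t)).
Variable nu : probability R R.
Hypothesis nuE : forall t j A, Theta t -> (0 < j)%N -> measurable A -> nu A = P t (innov S X t j @^-1` A).
Local Notation Ig := (\int[nu]_e (score g e ^+ 2)).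
Hypotheses (score2_L1 : L1 nu (fun e => score g e ^+ 2)) (score1_L1 : L1 nu (score1 g))
  (score_mean : \int[nu]_e score g e = 0) (score1_mean : \int[nu]_e score1 g e = - Ig)
  (Ig0 : 0 < Ig).
Variables (R1 R2 : R -> R -> R) (C : R).
Hypotheses (mR1 : measurable_fun setT (fun p : R * R => R1 p.1 p.2))
  (mR2 : measurable_fun setT (fun p : R * R => R2 p.1 p.2))
  (ldotR1 : forall t x x' i, Theta t -> `|ldot S g t x x' i 0| <= R1 x x')
  (lddotR2 : forall t x x' i j, Theta t -> `|lddot S g t x x' i j| <= R2 x x')
  (R1C : forall t j, Theta t -> (\int[P t]_w ((R1 (X j w) (X j.+1 w)) ^+ 2)%:E <= C%:E)%E)
  (R2C : forall t j, Theta t -> (\int[P t]_w ((R2 (X j w) (X j.+1 w)) ^+ 2)%:E <= C%:E)%E).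
Variables (I : 'cV[R]_d -> 'M[R]_d) (M : R).
Hypotheses (I0 : forall t v, Theta t -> 0 <= qform (I t) v)
  (IM : forall t v, Theta t -> qform (I t) v <= M * dotc v v)
  (hess_tight : tight_unif_compacts Theta P
      (fun n t w => (Num.sqrt (n%:R : R))^-1 *: \sum_(1 <= j < n.+1)
          (lddot S g t (X j.-1 w) (X j w) + I t))).

Lemma measurable_ldot t k i : Theta t -> measurable_fun setT (fun w => ldot S g t (X k w) (X k.+1 w) i 0).
Proof.
move=> Tt; rewrite (_ : (fun w => _) = fun w => - (score g (innov S X t k.+1 w) * pd i (S^~ (X k w)) t)); last first.
  by apply/funext => w; rewrite mxE (pd_ell S3 g0 g3).
apply: measurableT_comp => //; apply: measurable_funM.
  exact: (measurableT_comp (measurable_score g0 g3) (measurable_innov Sm t mX k.+1)).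
have mp : measurable_fun setT (fun x => pd i (S^~ x) t) by exact: (measurable_pdS oT S3).
exact: (measurableT_comp mp (mX k)).
Qed.

Lemma measurable_lddot t k i j : Theta t -> measurable_fun setT (fun w => lddot S g t (X k w) (X k.+1 w) i j).
Proof.
move=> Tt; rewrite (_ : (fun w => _) = fun w => score1 g (innov S X t k.+1 w) *
    (pd i (S^~ (X k w)) t * pd j (S^~ (X k w)) t) - score g (innov S X t k.+1 w) * pd j (pd i (S^~ (X k w))) t); last first.
  by apply/funext => w; rewrite mxE (pd_pd_ell oT S3 g0 g3).
have mY := measurable_innov Sm t mX k.+1.
have mp i' : measurable_fun setT (fun w => pd i' (S^~ (X k w)) t).
  have mp : measurable_fun setT (fun x => pd i' (S^~ x) t) by exact: (measurable_pdS oT S3).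
  exact: (measurableT_comp mp (mX k)).
have mp2 : measurable_fun setT (fun x => pd j (pd i (S^~ x)) t) by exact: (measurable_pdpdS oT S3).
apply: measurable_funB; apply: measurable_funM.
- exact: (measurableT_comp (measurable_score1 g0 g3) mY).
- by apply: measurable_funM; exact: mp.
- exact: (measurableT_comp (measurable_score g0 g3) mY).
- exact: (measurableT_comp mp2 (mX k)).
Qed.

Definition normscore n t w : 'cV[R]_d :=
  (Num.sqrt (n%:R : R))^-1 *: \sum_(1 <= j < n.+1) ldot S g t (X j.-1 w) (X j w).

Lemma dotc_normscore (u : 'cV[R]_d) n t w : dotc u (normscore n t w) = (Num.sqrt n%:R)^-1 * \sum_(i < n) xi S g X t u i w.
Proof.
by rewrite /normscore dotcZr dotc_sum (big_pred_shift (fun j k => dotc u (ldot S g t (X j w) (X k w)))).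
Qed.

Let Y n t w : 'M[R]_d := (Num.sqrt (n%:R : R))^-1 *: \sum_(1 <= j < n.+1) (lddot S g t (X j.-1 w) (X j w) + I t).

Lemma measurable_normhess n t i j : Theta t -> measurable_fun setT (fun w => Y n t w i j).
Proof.
move=> Tt; rewrite (_ : (fun w => _) = fun w => (Num.sqrt n%:R)^-1 *
    \sum_(k < n) (lddot S g t (X k w) (X k.+1 w) i j + I t i j)).
  apply: measurable_funM; first exact: measurable_cst.
  apply: measurable_sum => k; apply: measurable_funD; last exact: measurable_cst.
  exact: measurable_lddot.
apply/funext => w; rewrite /Y mxE summxE.
rewrite (big_pred_shift (fun j' k' => (lddot S g t (X j' w) (X k' w) + I t) i j)).
by congr (_ * _); apply: eq_bigr => k _; rewrite mxE.
Qed.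

(** The factor U^2 compares the quadratic form with the matrix norm for all u of l1 norm at most U,
    so one tightness constant serves every direction. *)
Lemma hess_tightP (u : 'cV[R]_d) (U C' dl : R) m t : Theta t -> \sum_i `|u i 0| <= U -> 0 <= C' -> 0 <= dl ->
  (P t [set w | (C' < `|Y m t w|)%R] <= dl%:E)%E ->
  (P t [set w | (U ^+ 2 * (Num.sqrt m%:R * C') <
     `|\sum_(k < m) (hess S g X t u k w + qform (I t) u)|)%R] <= dl%:E)%E.
Proof.
move=> Tt uU C'0 dl0; apply: le_trans; apply: le_measure; rewrite ?inE.
- apply: (measurable_gt (f := fun w => `|\sum_(k < m) (hess S g X t u k w + qform (I t) u)|)).
  apply: (measurableT_comp (@normr_measurable _ _)); apply: measurable_sum => k.
  by apply: measurable_funD => //; exact: (measurable_hess oT S3 g0 g3 Sm mX Tt).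
- by apply: measurable_gt; apply: measurable_mx_norm => i j; exact: measurable_normhess.
move=> w /=; set q := _ ^+ 2.
have E : \sum_(k < m) (hess S g X t u k w + qform (I t) u) = Num.sqrt m%:R * qform (Y m t w) u.
  rewrite /Y qformZl; case: m => [|m]; first by rewrite big_ord0 sqrtr0 mul0r.
  rewrite mulVKf ?gt_eqF ?sqrtr_gt0// qform_sum.
  rewrite (big_pred_shift (fun j k => qform (lddot S g t (X j w) (X k w) + I t) u)).
  by apply: eq_bigr => k _; rewrite qformDl.
rewrite E normrM (ger0_norm (sqrtr_ge0 _)) => h; rewrite ltNge; apply/negP => Yc; move: h.
rewrite ltNge mulrCA ler_wpM2l ?sqrtr_ge0//.
apply: le_trans (qform_le_norm _ _) _; apply: ler_pM => //; first exact: sqr_ge0.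
by rewrite ler_pXn2r ?nnegrE// (sumr_ge0, le_trans _ uU)// sumr_ge0.
Qed.

(** Constants are fixed in the order [beta], [B], [kap], [L], [dl], [C'], and n last, so that each
    of six error terms is at most eps / 6. They depend on U and the uniform bounds but not on t or
    u, hence a single threshold for n. *)
Lemma char_unif K (U eps : R) : compact K -> K `<=` Theta -> 0 <= U -> 0 < eps ->
  exists n0, forall n, (n0 <= n)%N -> forall t, K t -> forall (u : 'cV[R]_d) c, \sum_i `|u i 0| <= U ->
  `|\int[P t]_w cos (dotc u (normscore n t w) + c) - expR (- (qform (I t) u / 2)) * cos c| <= eps.
Proof.
move=> cK KT U0 eps0; pose Cn := `|C|; pose Sb := `|M| * U ^+ 2.
have Cn0 : 0 <= Cn by exact: normr_ge0.
have Sb0 : 0 <= Sb by rewrite mulr_ge0// sqr_ge0.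
have s2S t (u : 'cV[R]_d) : Theta t -> \sum_i `|u i 0| <= U -> 0 <= qform (I t) u <= Sb.
  move=> Tt uU; rewrite I0//=; apply: le_trans (IM _ Tt) _.
  apply: (@le_trans _ _ (`|M| * dotc u u)); first by rewrite ler_wpM2r ?dotc_ge0// ler_norm.
  rewrite ler_wpM2l// -enormE ler_pXn2r ?nnegrE ?enorm_ge0//.
  exact: le_trans (enorm_le_sum u) uU.
pose hb := 2 * (U ^+ 4 * Cn) + 2 * Sb ^+ 2.
have UC0 : 0 <= U ^+ 4 * Cn by rewrite mulr_ge0// exprn_ge0.
have hb0 : 0 <= hb by rewrite addr_ge0// mulr_ge0// sqr_ge0.
pose e := eps / 6; have e0 : 0 < e by rewrite divr_gt0.
pose A := 1 + A4 g nu Cn U.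
have A0 : 0 < A.
  by rewrite ltr_pwDl//; apply: divr_ge0 => //; exact: sqr_ge0.
pose beta := hb / e + 1; have beta0 : 0 < beta by rewrite ltr_wpDl// divr_ge0// ltW.
have hbeta : hb / beta <= e.
  by rewrite ler_pdivrMr// /beta mulrDr mulrCA divff ?gt_eqF// mulr1 mulr1 lerDl ltW.
pose B := (Num.truncn (beta * (2 * (U ^+ 2 * Cn) + 4 * Sb ^+ 2) / e)).+1.
have B0 : 0 < B%:R :> R by rewrite ltr0n.
have hB : beta * (2 * (U ^+ 2 * Cn) + 4 * Sb ^+ 2) <= e * B%:R.
  by rewrite -ler_pdivrMl// mulrC; apply/ltW/truncnS_gt.
have [kap [kap0 hkap]] : exists kap, 0 <= kap /\ score_tail g nu kap <= e / (2 * A).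
  apply: score_tail_small => //; first exact: measurable_score.
  by rewrite divr_gt0// mulr_gt0.
pose L := 3 * B%:R * hb / e + 1.
have L0 : 0 < L by rewrite ltr_wpDl// divr_ge0 ?(ltW e0)// mulr_ge0.
have hL : B%:R * (hb / L) <= e / 3.
  rewrite mulrA ler_pdivrMr// (_ : e / 3 * L = B%:R * hb + e / 3); first by rewrite lerDl divr_ge0// ltW.
  by rewrite /L; field; rewrite gt_eqF.
pose dl := e / (3 * B%:R * L).
have dl0 : 0 < dl by rewrite divr_gt0// !mulr_gt0.
have hdl : B%:R * (L * dl) = e / 3 by rewrite /dl; field; rewrite !gt_eqF.
have [C' [C'0 HC']] := hess_tight cK KT dl0.
have [n1 [n10 H1]] := inv_sqrt_small (q := 2 * (kap ^+ 3 * A))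
   (mulr_ge0 (ler0n _ 2) (mulr_ge0 (exprn_ge0 3 kap0) (ltW A0))) e0.
have [n2 [n20 H2]] := inv_sqrt_small (sqr_ge0 Sb) e0.
have e30 : 0 < e / 3 by rewrite divr_gt0.
have [n3 [n30 H3]] := inv_sqrt_small (q := B%:R * (U ^+ 2 * C'))
  (mulr_ge0 (ltW B0) (mulr_ge0 (sqr_ge0 U) (ltW C'0))) e30.
exists (n1 + n2 + n3 + B)%N => n nn t Kt u c uU.
have Tt := KT t Kt.
have nB : (B <= n)%N by apply: leq_trans nn; rewrite leq_addl.
have n_gt0 : (0 < n)%N by exact: leq_trans nB.
have nR0 : 0 < n%:R :> R by rewrite ltr0n.
have {}H1 : 2 * (kap ^+ 3 / Num.sqrt n%:R * A) <= e.
  have [h _] := H1 n (leq_trans (leq_trans (leq_addr _ _) (leq_trans (leq_addr _ _) (leq_addr _ _))) nn).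
  by rewrite (_ : 2 * _ = 2 * (kap ^+ 3 * A) / Num.sqrt n%:R)//; ring.
have {H2} [_ H2] := H2 n (leq_trans (leq_trans (leq_addl _ _) (leq_trans (leq_addr _ _) (leq_addr _ _))) nn).
have {H3} [H3 _] := H3 n (leq_trans (leq_trans (leq_addl _ _) (leq_addr _ _)) nn).
have /andP[s20 s2b] := s2S t u Tt uU; set s2 := qform (I t) u in s20 s2b *.
have R1C' j : (\int[P t]_w ((R1 (X j w) (X j.+1 w)) ^+ 2)%:E <= Cn%:E)%E.
  by apply: le_trans (R1C j Tt) _; rewrite lee_fin ler_norm.
have R2C' j : (\int[P t]_w ((R2 (X j w) (X j.+1 w)) ^+ 2)%:E <= Cn%:E)%E.
  by apply: le_trans (R2C j Tt) _; rewrite lee_fin ler_norm.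
have l1 x x' i := ldotR1 x x' i Tt.
have l2 x x' i j := lddotR2 x x' i j Tt.
have nuE' j A' := @nuE t j A' Tt.
have DV := sum_hess_le oT S3 g0 g3 Sm mX Tt mR2 l2 R2C' uU n_gt0 C'0 L0 (ltW dl0)
  (fun m => hess_tightP Tt uU (ltW C'0) (ltW dl0) (HC' m t Kt)).
under eq_Rintegral do rewrite dotc_normscore.
have := char_bound oT S3 g0 g3 Sm mX Tt (iY Tt) nuE' score2_L1 score1_L1 score_mean score1_mean Ig0
  mR1 mR2 l1 l2 R1C' R2C' uU s20 c n_gt0 kap0 (ltn0Sn _ : (0 < B)%N) beta0 DV.
move=> h; apply: le_trans h _.
have hbs : hess_bound Cn U s2 <= hb.
  by rewrite /hess_bound lerD2l ler_pM2l// ler_pXn2r ?nnegrE.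
have t1 : 2 * (score_tail g nu kap * A) <= e.
  have : score_tail g nu kap * (2 * A) <= e by rewrite -ler_pdivlMr ?mulr_gt0.
  by lra.
have t2 : s2 ^+ 2 / n%:R <= e.
  by apply: le_trans H2; rewrite ler_pM2r ?invr_gt0// ler_pXn2r ?nnegrE.
have t3 : B%:R * (U ^+ 2 * C' / Num.sqrt n%:R + L * dl + hess_bound Cn U s2 / L) <= e.
  rewrite !mulrDr hdl; have : B%:R * (hess_bound Cn U s2 / L) <= e / 3.
    by apply: le_trans hL; rewrite ler_pM2l// ler_pM2r// invr_gt0.
  have : B%:R * (U ^+ 2 * C' / Num.sqrt n%:R) <= e / 3 by rewrite mulrA.
  by lra.
have t4 : hess_bound Cn U s2 / beta <= e.
  by apply: le_trans hbeta; rewrite ler_pM2r// invr_gt0.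
have t5 : beta * (U ^+ 2 * Cn * (B%:R^-1 + n%:R^-1) + (s2 * (B%:R^-1 + n%:R^-1)) ^+ 2) <= e.
  set r := B%:R^-1 + n%:R^-1; have r0 : 0 <= r by rewrite addr_ge0 ?invr_ge0 ?ltW.
  have rB : r <= 2 / B%:R.
    rewrite /r (_ : 2 / B%:R = B%:R^-1 + B%:R^-1); last by lra.
    by rewrite lerD2l lef_pV2 ?posrE// ler_nat.
  have rB2 : r ^+ 2 <= 4 / B%:R.
    apply: (@le_trans _ _ ((2 / B%:R) ^+ 2)); first by rewrite ler_pXn2r ?nnegrE// divr_ge0 ?ltW.
    have -> : (2 / B%:R) ^+ 2 = 4 / B%:R / B%:R :> R by field; rewrite gt_eqF.
    by rewrite ler_pdivrMr// ler_peMr ?ler1n// divr_ge0// ltW.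
  rewrite -(ler_pM2r B0); apply: le_trans hB; rewrite -[leLHS]mulrA ler_pM2l// mulrDl exprMn; apply: lerD.
    rewrite -[leLHS]mulrA [leRHS]mulrC; apply: ler_wpM2l; first by rewrite mulr_ge0// sqr_ge0.
    by rewrite -ler_pdivlMr.
  rewrite -[leLHS]mulrA [leRHS]mulrC; apply: ler_pM; rewrite ?sqr_ge0//.
  - by rewrite mulr_ge0 ?sqr_ge0// ltW.
  - by rewrite ler_pXn2r ?nnegrE.
  - by rewrite -ler_pdivlMr.
have t0 : 2 * ((score_tail g nu kap + kap ^+ 3 / Num.sqrt n%:R) * A) <= e + e.
  rewrite [X in 2 * X]mulrDl [leLHS]mulrDr.
  exact: lerD.
rewrite (_ : eps = e + e + e + e + (e + e)); last by rewrite /e; lra.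
exact: (lerD (lerD (lerD t0 t2) t3) (lerD t5 t4)).
Qed.

End UniformCLT.

(* No measurability: the integral of a nonnegative function is a supremum over
   simple functions below it. The one-step estimator is not assumed measurable. *)
Lemma integral_mono d (T : measurableType d) (R : realType) (mu : {measure set T -> \bar R})
  (f g : T -> \bar R) : (forall x, (f x <= g x)%E) -> (\int[mu]_x f x <= \int[mu]_x g x)%E.
Proof.
move=> fg; rewrite /integral !patch_setT; apply: leeB; apply: ereal_sup_le => _ [h /= hf <-]; exists h => // x.
  apply: le_trans (hf x) _; rewrite !funeposE ge_max !le_max fg/=.
  by apply/orP; right.
apply: le_trans (hf x) _; rewrite !funenegE ge_max !le_max leeN2 fg/=.
by apply/orP; right.
Qed.

(** f may fail to be measurable: its extended integral is squeezed between two finite values, so it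
    is finite and [fine] preserves the order. *)
Lemma Rintegral_sandwich d (T : measurableType d) (R : realType) (P : probability T R)
  (a f b : T -> R) : L1 P a -> L1 P b -> (forall x, a x <= f x <= b x) ->
  \int[P]_x a x <= \int[P]_x f x <= \int[P]_x b x.
Proof.
move=> Ia Ib afb.
have af : (\int[P]_x (a x)%:E <= \int[P]_x (f x)%:E)%E.
  by apply: integral_mono => x; rewrite lee_fin; case/andP: (afb x).
have fb : (\int[P]_x (f x)%:E <= \int[P]_x (b x)%:E)%E.
  by apply: integral_mono => x; rewrite lee_fin; case/andP: (afb x).
move: af fb; rewrite -(Ex_EFin Ia) -(Ex_EFin Ib) /Rintegral.
by case: (\int[P]_x (f x)%:E)%E => [r| |]//=; rewrite ?lee_fin => -> ->.
Qed.

Lemma Rintegral_close d (T : measurableType d) (R : realType) (P : probability T R)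
    (F G : T -> R) (B : set T) (C e eta : R) :
  L1 P G -> measurable B -> (forall w, `|F w| <= C) -> (forall w, `|G w| <= C) -> 0 <= C -> 0 <= e ->
  (P B <= eta%:E)%E -> (forall w, ~ B w -> `|F w - G w| <= e) ->
  `|\int[P]_w F w - \int[P]_w G w| <= e + 2 * C * eta.
Proof.
move=> IG mB FC GC C0 e0 PB FG; have II := L1_indic P mB.
pose b w := e + 2 * C * \1_B w : R.
have Ib : L1 P b by apply: L1D; [exact: L1_cst|exact: L1Z].
have Eb : \int[P]_w b w <= e + 2 * C * eta.
  rewrite ExD; [|exact: L1_cst|exact: L1Z].
  rewrite Ex_cst ExZ// Ex_indic// lerD2l ler_wpM2l ?mulr_ge0//.
  by rewrite -lee_fin fineK ?probability_fin.
have FGb w : G w - b w <= F w <= G w + b w.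
  rewrite -ler_distl /b indicE; case: (boolP (w \in B)) => [_|/negP wB].
    rewrite mulr1; apply: le_trans (ler_normB _ _) _.
    by have := FC w; have := GC w; lra.
  by rewrite mulr0 addr0; apply: FG => Bw; apply: wB; rewrite inE.
have := Rintegral_sandwich (L1B IG Ib) (L1D IG Ib) FGb.
by rewrite ExB// ExD// => /andP[h1 h2]; rewrite ler_norml; apply/andP; split; lra.
Qed.

Lemma measurable_dotc d (T : measurableType d) (R : realType) n (Z : T -> 'cV[R]_n) u :
  (forall i, measurable_fun setT (fun w => Z w i 0)) -> measurable_fun setT (fun w => dotc u (Z w)).
Proof.
move=> mZ; under eq_fun do rewrite dotcE.
by apply: measurable_sum => i; apply: measurable_funM; [exact: measurable_cst|exact: mZ].
Qed.

Lemma measurable_trigpoly d (T : measurableType d) (R : realType) n (Z : T -> 'cV[R]_n) s :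
  (forall i, measurable_fun setT (fun w => Z w i 0)) -> measurable_fun setT (fun w => trigpoly s (Z w)).
Proof.
move=> mZ; apply: measurable_sum => p; apply: measurable_funM; first exact: measurable_cst.
apply: (measurableT_comp (@continuous_measurable_fun _ _ (@continuous_cos R))).
by apply: measurable_funD; [exact: measurable_dotc|exact: measurable_cst].
Qed.

(** Only coordinates of Z are known to be measurable. Trigonometric polynomials within 1 / (m + 1)
    of f on the ball of radius m + 1 converge to f pointwise. *)
Lemma measurable_continuous_cV d (T : measurableType d) (R : realType) n (Z : T -> 'cV[R]_n) (f : 'cV[R]_n -> R) (C : R) :
  (forall i, measurable_fun setT (fun w => Z w i 0)) -> continuous f -> (forall x, `|f x| <= C) ->
  measurable_fun setT (fun w => f (Z w)).
Proof.
move=> mZ cf fC.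
have H (m : nat) : exists s, forall x, `|x| <= m.+1%:R -> `|trigpoly s x - f x| <= m.+1%:R^-1.
  have m0 : 0 < m.+1%:R^-1 :> R by rewrite invr_gt0.
  by have [s [sm _]] := trigpoly_approx cf fC (ltr0Sn R m) m0; exists s.
have [s sH] := choice H.
apply: (measurable_fun_cvg (h := fun m w => trigpoly (s m) (Z w))).
  by move=> m; exact: measurable_trigpoly.
move=> w _; apply/cvgrPdist_le => e e0.
exists (Num.truncn `|Z w| + Num.truncn e^-1)%N => // m /= mN; rewrite distrC.
apply: le_trans (sH m _ _) _.
  apply/ltW/(lt_le_trans (truncnS_gt _)).
  by rewrite ler_nat ltnS (leq_trans (leq_addr _ _) mN).
rewrite invf_ple ?posrE//; apply/ltW/(lt_le_trans (truncnS_gt _)).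
by rewrite ler_nat ltnS (leq_trans (leq_addl _ _) mN).
Qed.

(** * Comparison of laws through finitely many characteristic functions *)

Section LawClose.
Context (R : realType) (n : nat).

Lemma trigpoly_Ex d (T : measurableType d) (P : probability T R) (Z : T -> 'cV[R]_n) s :
  (forall i, measurable_fun setT (fun w => Z w i 0)) ->
  \int[P]_w trigpoly s (Z w) = \sum_(p <- s) p.1.1 * \int[P]_w cos (dotc p.1.2 (Z w) + p.2).
Proof.
move=> mZ; have Ic p : L1 P (fun w => cos (dotc p.1.2 (Z w) + p.2)).
  apply: (@L1_bounded _ _ _ _ _ 1); last by move=> x; exact: cos_max.
  apply: (measurableT_comp (@continuous_measurable_fun _ _ (@continuous_cos R))).
  by apply: measurable_funD; [exact: measurable_dotc|exact: measurable_cst].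
rewrite /trigpoly Ex_sum; last by move=> p _; apply: L1Z; exact: Ic.
by apply: eq_bigr => p _; rewrite ExZ//; exact: Ic.
Qed.

Lemma law_close_trig d (T : measurableType d) (P : probability T R) (Z : T -> 'cV[R]_n)
    (f : 'cV[R]_n -> R) (C M e eta : R) s :
  (forall i, measurable_fun setT (fun w => Z w i 0)) -> continuous f -> (forall x, `|f x| <= C) ->
  (forall x, `|x| <= M -> `|trigpoly s x - f x| <= e) -> (forall x, `|trigpoly s x| <= C) -> 0 <= e ->
  (P [set w | (M < `|Z w|)%R] <= eta%:E)%E ->
  `|\int[P]_w f (Z w) - \int[P]_w trigpoly s (Z w)| <= e + 2 * C * eta.
Proof.
move=> mZ cf fC se sC e0 PM.
have mM : measurable [set w | M < `|Z w|].
  by apply: measurable_gt; apply: measurable_mx_norm => i j; rewrite ord1.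
have If : L1 P (fun w => f (Z w)) by apply: (@L1_bounded _ _ _ _ _ C) => // ; exact: (measurable_continuous_cV mZ cf fC).
have Is : L1 P (fun w => trigpoly s (Z w)) by apply: (@L1_bounded _ _ _ _ _ C) => //; exact: measurable_trigpoly.
have C0 : 0 <= C by apply: le_trans (fC 0); exact: normr_ge0.
apply: (Rintegral_close Is mM) => // w /= wM; rewrite distrC; apply: se.
by rewrite leNgt; apply/negP.
Qed.

(* eta1 is chosen before M, so that M may come from tightness at level eta1. *)
Lemma law_close (f : 'cV[R]_n -> R) (C eps : R) : continuous f -> (forall x, `|f x| <= C) -> 0 < eps ->
  exists eta1, 0 < eta1 /\ forall M, 0 < M -> exists (s : seq (R * 'cV[R]_n * R)) (eta2 : R), 0 < eta2 /\
  forall d (T : measurableType d) (P : probability T R) (Z : T -> 'cV[R]_n)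
    d' (T' : measurableType d') (P' : probability T' R) (Z' : T' -> 'cV[R]_n),
  (forall i, measurable_fun setT (fun w => Z w i 0)) ->
  (forall i, measurable_fun setT (fun w => Z' w i 0)) ->
  (P [set w | (M < `|Z w|)%R] <= eta1%:E)%E -> (P' [set w | (M < `|Z' w|)%R] <= eta1%:E)%E ->
  (forall p, p \in s -> `|\int[P]_w cos (dotc p.1.2 (Z w) + p.2) - \int[P']_w cos (dotc p.1.2 (Z' w) + p.2)| <= eta2) ->
  `|\int[P]_w f (Z w) - \int[P']_w f (Z' w)| <= eps.
Proof.
move=> cf fC eps0; have C0 : 0 <= C by apply: le_trans (fC 0); exact: normr_ge0.
(* Replacing f by the polynomial costs 2 e for each law, namely e inside the ball and 2 C eta1 <= e
   outside; the two polynomial expectations differ by at most e. *)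
pose e := eps / 5; have e0 : 0 < e by rewrite divr_gt0.
exists (e / (2 * C + 1)); split; first by rewrite divr_gt0// ltr_wpDl// mulr_ge0.
move=> M M0; have [s [sM sC]] := trigpoly_approx cf fC M0 e0.
have sa0 : 0 <= \sum_(p <- s) `|p.1.1| by exact: sumr_ge0.
exists s, (e / (\sum_(p <- s) `|p.1.1| + 1)); split; first by rewrite divr_gt0// ltr_wpDl.
move=> d T P Z d' T' P' Z' mZ mZ' PM PM' H.
have h1 := law_close_trig mZ cf fC sM sC (ltW e0) PM.
have h2 := law_close_trig mZ' cf fC sM sC (ltW e0) PM'.
have h3 : `|\int[P]_w trigpoly s (Z w) - \int[P']_w trigpoly s (Z' w)| <= e.
  rewrite !trigpoly_Ex// -sumrB; apply: le_trans (ler_norm_sum _ _ _) _.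
  apply: (@le_trans _ _ (\sum_(p <- s) `|p.1.1| * (e / (\sum_(p <- s) `|p.1.1| + 1)))).
    move: H; set eta2 := e / _ => H; rewrite !big_seq; apply: ler_sum => p ps; rewrite -mulrBr normrM ler_wpM2l//; exact: H.
  rewrite -mulr_suml mulrCA ler_piMr ?(ltW e0)// ler_pdivrMr ?mul1r ?lerDl//.
  by rewrite ltr_wpDl.
have h4 : 2 * C * (e / (2 * C + 1)) <= e.
  by rewrite mulrCA ler_piMr ?(ltW e0)// ler_pdivrMr ?mul1r ?lerDl// ltr_wpDl// mulr_ge0.
rewrite (_ : eps = 5 * e); last by rewrite /e; lra.
move: h1 h2 h3; rewrite !ler_norml => /andP[? ?] /andP[? ?] /andP[? ?].
by apply/andP; split; lra.
Qed.

End LawClose.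

Lemma tail_small d (T : measurableType d) (R : realType) (P : probability T R) (f : T -> R) (eps : R) :
  measurable_fun setT f -> 0 < eps -> exists m, 0 < m /\ (P [set w | (m < `|f w|)%R] <= eps%:E)%E.
Proof.
move=> mf e0; pose A n := [set w | n%:R < `|f w|].
have mA n : measurable (A n).
  by apply: (measurable_gt (f := fun w => `|f w|)); exact: (measurableT_comp (@normr_measurable _ _) mf).
have dA : nonincreasing_seq A.
  move=> m n mn; apply/subsetPset => w; rewrite /A /=; apply: le_lt_trans; rewrite ler_nat//.
have A0 : \bigcap_n A n = set0.
  apply/seteqP; split => // w H; have := H (Num.truncn `|f w|).+1 I; rewrite /A/=.
  by rewrite ltNge (ltW (truncnS_gt _)).
have PA0 : (P (A 0%N) < +oo)%E by apply: le_lt_trans (probability_le1 P (mA 0%N)) _; rewrite ltry.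
have mI : measurable (\bigcap_n A n) by exact: bigcapT_measurable.
have H := nonincreasing_cvg_mu PA0 mA mI dA.
move: H; rewrite A0 measure0 => H; have [_ H2] := (fine_cvgP _ _).1 H.
have [k _ Hk] := cvgr_lt (0 : R) H2 eps e0; exists k.+1%:R; split => //.
have /= := Hk k.+1 (leqnSn k) => h.
have hfin := probability_fin P (mA k.+1).
by rewrite -(fineK hfin) lee_fin ltW.
Qed.

Lemma sup_close (R : realType) (T : Type) (B : set T) (F G : T -> R) (C e : R) : B !=set0 ->
  (forall t, B t -> `|F t| <= C) -> (forall t, B t -> `|G t| <= C) -> (forall t, B t -> `|F t - G t| <= e) ->
  `|sup [set F t | t in B] - sup [set G t | t in B]| <= e.
Proof.
move=> [t0 Bt0].
suff main F' G' : (forall t, B t -> `|F' t| <= C) -> (forall t, B t -> `|G' t| <= C) ->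
    (forall t, B t -> `|F' t - G' t| <= e) -> sup [set F' t | t in B] <= sup [set G' t | t in B] + e.
  move=> FC GC FG; have h1 := main F G FC GC FG.
  have h2 := main G F GC FC (fun t Bt => ltac:(by rewrite distrC FG)).
  by rewrite ler_norml; apply/andP; split; lra.
move=> FC GC FG; apply: ge_sup; first by exists (F' t0), t0.
move=> _ [t Bt <-]; apply: (@le_trans _ _ (G' t + e)).
  by have := FG t Bt; rewrite ler_norml => /andP[_]; lra.
rewrite lerD2r; apply: ub_le_sup; last by exists t.
by exists C => _ [t' Bt' <-]; apply: le_trans (GC t' Bt'); exact: ler_norm.
Qed.

Section SqrtInverse.
Variables (R : realType) (d : nat) (A : 'M[R]_d) (c : R).
Hypotheses (As : A^T = A) (c0 : 0 < c) (Ac : forall v, c * dotc v v <= qform A v).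

Lemma sqrtmx_invP : is_sqrtmx (invmx A) (sqrtmx (invmx A)).
Proof.
have [c' [c'0 Hc']] := pd_inv_pd c0 Ac.
exact: (sqrtmxP (invmx_sym As) c'0 Hc').
Qed.

Lemma dotc_sqrtmx_inv v : dotc (sqrtmx (invmx A) *m v) (sqrtmx (invmx A) *m v) = qform (invmx A) v.
Proof. by have [Bs [_ BB]] := sqrtmx_invP; rewrite -{1}Bs -dotc_mx mulmxA BB qformE. Qed.

Lemma sqrtmx_inv_opb : opb (sqrtmx (invmx A)) (Num.sqrt c^-1).
Proof.
move=> v; rewrite -(@ler_pXn2r _ 2)// ?nnegrE ?mulr_ge0 ?sqrtr_ge0 ?enorm_ge0//.
rewrite exprMn (@sqr_sqrtr _ c^-1) ?invr_ge0 ?(ltW c0)// enormE dotc_sqrtmx_inv qformE.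
apply: le_trans (ler_norm _) _; apply: le_trans (cauchy_schwarz _ _) _.
by rewrite expr2 mulrCA ler_wpM2l ?enorm_ge0//; exact: (pd_inv_opb c0 Ac).
Qed.

End SqrtInverse.

Lemma dotc_continuous (R : realType) d (u : 'cV[R]_d) : continuous (dotc u).
Proof.
move=> x; rewrite /prop_for/continuous_at (_ : dotc u = fun x => \sum_i u i 0 * x i 0); last first.
  by apply/funext => y; rewrite dotcE.
apply: (@cvg_sumR _ _ _ (nbhs x) (nbhs_filter x)) => i; apply: (@cvgM _ _ (nbhs x) (nbhs_filter x)); first exact: cvg_cst.
exact: coord_continuous.
Qed.

Lemma cos_dotc_continuous (R : realType) d (u : 'cV[R]_d) c : continuous (fun x => cos (dotc u x + c)).
Proof.
move=> x; apply: (@continuous_comp _ _ _ (fun x => dotc u x + c) cos); last exact: continuous_cos.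
apply: (@cvgD _ _ _ (nbhs x) (nbhs_filter x)); [exact: (@dotc_continuous R d u x)|exact: cvg_cst].
Qed.

(** * The Gaussian limit law *)

Section GaussChar.
Variables (R : realType) (d : nat) (A : 'M[R]_d) (c : R).
Hypotheses (As : A^T = A) (c0 : 0 < c) (Ac : forall v, c * dotc v v <= qform A v).
Context dO (Omega : measurableType dO) (P : probability Omega R) (Z : nat -> Omega -> 'cV[R]_d).
Context dO' (Omega' : measurableType dO') (Q : probability Omega' R) (zeta : Omega' -> 'cV[R]_d).
Hypotheses (clt : cvg_in_law P Z Q (fun w => sqrtmx A *m zeta w))
  (char : forall U eps, 0 <= U -> 0 < eps -> exists n0, forall n, (n0 <= n)%N -> forall (u : 'cV[R]_d) b,
     \sum_i `|u i 0| <= U ->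
     `|\int[P]_w cos (dotc u (Z n w) + b) - expR (- (qform A u / 2)) * cos b| <= eps).

(* The pointwise central limit theorem serves only to compute the characteristic
   function of zeta without any Gaussian integral. *)
Lemma gauss_char w b : \int[Q]_x cos (dotc w (zeta x) + b) = expR (- (dotc w w / 2)) * cos b.
Proof.
have [Bs [_ BB]] := sqrtmxP As c0 Ac; set B := sqrtmx A in Bs BB *.
have Bu : B \in unitmx.
  have := pd_unitmx c0 Ac; rewrite -BB unitmx_mul => /andP[]//.
pose u := invmx B *m w; have Buw : B *m u = w by rewrite mulKVmx.
have E x : dotc w (zeta x) = dotc u (B *m zeta x) by rewrite dotc_mx Bs Buw.
have bd : exists M, forall x : 'cV[R]_d, `|cos (dotc u x + b)| <= M by exists 1 => x; exact: cos_max.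
have h1 := clt (@cos_dotc_continuous R d u b) bd.
under eq_Rintegral do rewrite E.
apply: (cvg_unique _ h1); first exact: norm_hausdorff.
apply/cvgrPdist_le => eps eps0.
have [n0 H] := char (sumr_ge0 _ (fun i _ => normr_ge0 (u i 0)) : 0 <= \sum_i `|u i 0|) eps0.
exists n0 => // n /= nn; rewrite distrC (_ : dotc w w = qform A u); first exact: H.
by rewrite qformE -BB -mulmxA dotc_mx Bs Buw.
Qed.

End GaussChar.

Section ScaledGauss.
Variables (R : realType) (d : nat).
Context dO' (Omega' : measurableType dO') (Q : probability Omega' R) (zeta : Omega' -> 'cV[R]_d).
Hypotheses (mz : forall i, measurable_fun setT (fun w => zeta w i 0))
  (gc : forall w b, \int[Q]_x cos (dotc w (zeta x) + b) = expR (- (dotc w w / 2)) * cos b).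

Lemma gauss_char_inv (A : 'M[R]_d) (c : R) v b : A^T = A -> 0 < c -> (forall v, c * dotc v v <= qform A v) ->
  \int[Q]_x cos (dotc v (sqrtmx (invmx A) *m zeta x) + b) = expR (- (qform (invmx A) v / 2)) * cos b.
Proof.
move=> As c0 Ac; have [Bs _] := sqrtmx_invP As c0 Ac.
under eq_Rintegral do rewrite dotc_mx Bs.
by rewrite gc (dotc_sqrtmx_inv As c0 Ac).
Qed.

Lemma measurable_mulmx (B : 'M[R]_d) dT (T : measurableType dT) (Z : T -> 'cV[R]_d) i :
  (forall i, measurable_fun setT (fun w => Z w i 0)) -> measurable_fun setT (fun w => (B *m Z w) i 0).
Proof.
move=> mZ; rewrite (_ : (fun w => _) = fun w => \sum_j B i j * Z w j 0); last by apply/funext => w; rewrite mxE.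
by apply: measurable_sum => j; apply: measurable_funM; [exact: measurable_cst|exact: mZ].
Qed.

Lemma norm_opb (B : 'M[R]_d) (r : R) (v : 'cV[R]_d) : 0 <= r -> opb B r -> `|B *m v| <= r * d%:R * `|v|.
Proof.
move=> r0 Br; apply: le_trans (norm_le_enorm _) _; apply: le_trans (Br v) _.
by rewrite -mulrA ler_wpM2l// enorm_le_norm.
Qed.

Lemma tight_opb dT (T : measurableType dT) (P : probability T R) (Z : T -> 'cV[R]_d) (B : 'M[R]_d) (r m : R) eta :
  (forall i, measurable_fun setT (fun w => Z w i 0)) -> 0 <= r -> opb B r ->
  (P [set w | (m < `|Z w|)%R] <= eta)%E -> (P [set w | (r * d%:R * m < `|B *m Z w|)%R] <= eta)%E.
Proof.
move=> mZ r0 Br; apply: le_trans; apply: le_measure; rewrite ?inE.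
- by apply: measurable_gt; apply: measurable_mx_norm => i j; rewrite ord1; exact: measurable_mulmx.
- by apply: measurable_gt; apply: measurable_mx_norm => i j; rewrite ord1.
move=> w /=; apply: contraTT; rewrite -!leNgt => h.
apply: le_trans (norm_opb _ r0 Br) _; rewrite ler_wpM2l// mulr_ge0//.
Qed.

Lemma gauss_tight eta : 0 < eta -> exists m, 0 < m /\ (Q [set w | (m < `|zeta w|)%R] <= eta%:E)%E.
Proof.
move=> eta0; have [|m [m0 H]] := @tail_small _ _ _ Q (fun w => `|zeta w|) eta _ eta0.
  by apply: measurable_mx_norm => i j; rewrite ord1.
exists m; split => //; apply: le_trans H; rewrite le_eqVlt; apply/orP; left; apply/eqP.
by congr (Q _); apply/funext => w /=; rewrite normr_id.
Qed.

End ScaledGauss.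

(** With B the square root of A, |A v|^2 is the form of A at B v, at most M |B v|^2; and |B v|^2 is
    the form of A at v. *)
Lemma psd_opb (R : realType) d (A : 'M[R]_d) (c M : R) : A^T = A -> 0 < c -> 0 <= M ->
  (forall v, c * dotc v v <= qform A v) -> (forall v, qform A v <= M * dotc v v) -> opb A M.
Proof.
move=> As c0 M0 Ac AM v; have [Bs [_ BB]] := sqrtmxP As c0 Ac; set B := sqrtmx A in Bs BB.
have BE x : dotc (B *m x) (B *m x) = qform A x by rewrite -{1}Bs -dotc_mx mulmxA BB qformE.
rewrite -(@ler_pXn2r _ 2)// ?nnegrE ?mulr_ge0 ?enorm_ge0// exprMn !enormE.
rewrite -{1 2}BB -!mulmxA BE; apply: le_trans (AM _) _.
by rewrite BE expr2 -mulrA ler_wpM2l.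
Qed.

Lemma opb_norm (R : realType) d (A : 'M[R]_d) : opb A (d%:R ^+ 2 * `|A|).
Proof. by apply: coord_opb => i j; exact: norm_coord. Qed.

Lemma enorm_coord_le (R : realType) d (v : 'cV[R]_d) (r : R) : 0 <= r -> (forall i, `|v i 0| <= r) -> enorm v <= d%:R * r.
Proof.
move=> r0 vr; apply: le_trans (enorm_le_norm _) _; rewrite ler_wpM2l//.
by apply: norm_mx_le => // i j; rewrite ord1.
Qed.

(** * The one-step estimator *)

Section OneStepAlgebra.
Variables (R : realType) (d : nat) (Ib It : 'M[R]_d) (c l M m : R) (h : 'cV[R]_d) (N k : nat).
Variables (f fb : nat -> 'cV[R]_d) (H : nat -> 'M[R]_d) (R3 : nat -> R).
Hypotheses (c0 : 0 < c) (l0 : 0 <= l) (M0 : 0 <= M) (m0 : 0 <= m) (N0 : (0 < N)%N) (Nk : (N <= k)%N)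
  (R30 : forall j, 0 <= R3 j)
  (Ibc : forall v, c * dotc v v <= qform Ib v) (Itc : forall v, c * dotc v v <= qform It v)
  (ItM : opb It M) (hm : `|h| <= m / Num.sqrt N%:R) (Ibt : opb (Ib - It) (l * (m / Num.sqrt N%:R)))
  (taylor : forall j i, `|(fb j - f j - H j *m h) i 0| <= R3 j * (\sum_i `|h i 0|) ^+ 2).
Let Z n : 'cV[R]_d := (Num.sqrt (n%:R : R))^-1 *: \sum_(1 <= j < n.+1) f j.
Let Y n : 'M[R]_d := (Num.sqrt (n%:R : R))^-1 *: \sum_(1 <= j < n.+1) (H j + It).
Hypotheses (ZN : `|Z N| <= m) (Zk : `|Z k| <= m) (YN : `|Y N| <= m) (Yk : `|Y k| <= m)
  (Wk : k%:R^-1 * \sum_(1 <= j < k.+1) R3 j <= m).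

Let sN : R := Num.sqrt N%:R.
Let sk : R := Num.sqrt k%:R.
Let k0 : (0 < k)%N. Proof. exact: leq_trans Nk. Qed.
Let sN0 : 0 < sN. Proof. by rewrite sqrtr_gt0 ltr0n. Qed.
Let sk0 : 0 < sk. Proof. by rewrite sqrtr_gt0 ltr0n. Qed.
Let sN2 : sN ^+ 2 = N%:R. Proof. by rewrite sqr_sqrtr. Qed.
Let sk2 : sk ^+ 2 = k%:R. Proof. by rewrite sqr_sqrtr. Qed.
Let sNk : sN <= sk. Proof. by rewrite ler_wsqrtr// ler_nat. Qed.

Let sum_split (V : zmodType) (F : nat -> V) :
  \sum_(N.+1 <= j < k.+1) F j = \sum_(1 <= j < k.+1) F j - \sum_(1 <= j < N.+1) F j.
Proof.
have NkS : (N.+1 <= k.+1)%N by [].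
by rewrite [X in _ = X - _](big_cat_nat (ltn0Sn N) NkS)/= addrAC subrr add0r.
Qed.

Let rho j := fb j - f j - H j *m h.
Let Delta : 'cV[R]_d := sk^-1 *: \sum_(N.+1 <= j < k.+1) fb j.

(** The sum over N < j <= k is a difference of two full sums, for which bounds in probability are
    available. The drift of order sqrt k It h is what the Newton correction removes. *)
Let DeltaE : Delta = Z k - (sN / sk) *: Z N + (Y k - (sN / sk) *: Y N) *m h
  - (sk - sN ^+ 2 / sk) *: (It *m h) + sk^-1 *: \sum_(N.+1 <= j < k.+1) rho j.
Proof.
have ZE n : (0 < n)%N -> \sum_(1 <= j < n.+1) f j = Num.sqrt n%:R *: Z n.
  by move=> n0; rewrite /Z scalerA mulfV ?scale1r// gt_eqF// sqrtr_gt0 ltr0n.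
have YE n : (0 < n)%N -> \sum_(1 <= j < n.+1) (H j + It) = Num.sqrt n%:R *: Y n.
  by move=> n0; rewrite /Y scalerA mulfV ?scale1r// gt_eqF// sqrtr_gt0 ltr0n.
have -> : Delta = sk^-1 *: (\sum_(N.+1 <= j < k.+1) f j + (\sum_(N.+1 <= j < k.+1) (H j + It)) *m h
    - (k%:R - N%:R) *: (It *m h) + \sum_(N.+1 <= j < k.+1) rho j).
  congr (_ *: _); rewrite mulmx_suml.
  have -> : (k%:R - N%:R : R) *: (It *m h) = \sum_(N.+1 <= j < k.+1) It *m h.
    by rewrite sumr_const_nat subSS -[RHS]scaler_nat natrB.
  rewrite -big_split -sumrB -big_split/=; apply: eq_bigr => j _.
  rewrite /rho mulmxDl; set p := H j *m h; set q := It *m h.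
  by apply/matrixP => a b; rewrite !mxE; ring.
rewrite !sum_split !ZE// !YE// -/sk -/sN -sk2 -sN2.
rewrite !mulmxBl -!scalemxAl; apply/matrixP => a b; rewrite !mxE.
by field; rewrite -/sN -/sk !gt_eqF.
Qed.

(* With h = theta_bar - theta, this is
   sqrt k (theta* - theta) - I(theta)^-1 Z_k. *)
Let err := Num.sqrt k%:R *: (h + (Num.sqrt k%:R)^-1 *: (invmx Ib *m Delta)) - invmx It *m Z k.

(** [V1] and [V6] come from taking the information at the preliminary estimator, [V2] and [V3] from
    the first N observations left out of the sum, [V4] from the fluctuation of the Hessian, [V5]
    from the Taylor remainder. *)
Let V1 := sk *: ((Ib - It) *m h).
Let V2 := (sN ^+ 2 / sk) *: (It *m h).
Let V3 := - ((sN / sk) *: Z N).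
Let V4 := (Y k - (sN / sk) *: Y N) *m h.
Let V5 := sk^-1 *: \sum_(N.+1 <= j < k.+1) rho j.
Let V6 := - ((Ib - It) *m (invmx It *m Z k)).

Let errE : err = invmx Ib *m (V1 + V2 + V3 + V4 + V5 + V6).
Proof.
have Ibu := pd_unitmx c0 Ibc; have Itu := pd_unitmx c0 Itc.
rewrite -[LHS](mulKmx Ibu); congr (_ *m _).
rewrite /err -/sk mulmxBr -scalemxAr mulmxDr -scalemxAr mulKVmx// scalerDr scalerA mulfV ?gt_eqF// scale1r DeltaE.
rewrite /V1 /V2 /V3 /V4 /V5 /V6 !mulmxBl mulKVmx//.
set p := Ib *m (invmx It *m _); set q := Ib *m h; set r := It *m h.
set y1 := Y k *m h; set y2 := _ *m h; set s := \sum_(_ <= _ < _) _.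
by apply/matrixP => a b; rewrite !mxE; ring.
Qed.

(** One rate per kind of error: sN / sk for [V2] and [V3], 1 / sN for [V4] and [V6], sk / sN^2 for
    [V1] and [V5], which are quadratic in h. *)
Let a : R := sN / sk + sN^-1 + sk / sN ^+ 2.
Definition onestep_const : R := (l * m * d%:R * m + M * d%:R * m + d%:R * m + 2 * (d%:R ^+ 2 * m * d%:R * m)
  + d%:R ^+ 3 * m ^+ 3 + l * m * (c^-1 * (d%:R * m))).

Lemma onestep_bound : enorm err <= c^-1 * onestep_const * a.
Proof.
rewrite errE; apply: le_trans (pd_inv_opb c0 Ibc _) _; rewrite -mulrA ler_wpM2l ?invr_ge0 ?(ltW c0)//.
have hb0 : 0 <= m / sN by rewrite divr_ge0// ltW.
have eh : enorm h <= d%:R * (m / sN) by apply: le_trans (enorm_le_norm _) _; rewrite ler_wpM2l.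
have eZ n : `|Z n| <= m -> enorm (Z n) <= d%:R * m.
  by move=> Zn; apply: le_trans (enorm_le_norm _) _; rewrite ler_wpM2l.
have r1 : 0 <= sN / sk <= 1.
  by apply/andP; split; [rewrite divr_ge0// ltW|rewrite ler_pdivrMr ?mul1r].
have [r10 r11] := andP r1.
have h1 : enorm V1 <= l * m * d%:R * m * (sk / sN ^+ 2).
  rewrite /V1 enormZ (gtr0_norm sk0).
  apply: (@le_trans _ _ (sk * (l * (m / sN) * (d%:R * (m / sN))))).
    rewrite ler_pM2l//; apply: le_trans (Ibt h) _; rewrite ler_wpM2l// mulr_ge0//.
  by rewrite le_eqVlt; apply/orP; left; apply/eqP; field; rewrite gt_eqF.
have h2 : enorm V2 <= M * d%:R * m * (sN / sk).
  rewrite /V2 enormZ ger0_norm ?divr_ge0 ?sqr_ge0 ?(ltW sk0)//.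
  apply: (@le_trans _ _ (sN ^+ 2 / sk * (M * (d%:R * (m / sN))))).
    rewrite ler_wpM2l ?divr_ge0 ?sqr_ge0 ?(ltW sk0)//; apply: le_trans (ItM h) _; rewrite ler_wpM2l//.
  by rewrite le_eqVlt; apply/orP; left; apply/eqP; field; rewrite !gt_eqF.
have h3 : enorm V3 <= d%:R * m * (sN / sk).
  by rewrite /V3 enormN enormZ (ger0_norm r10) mulrC ler_wpM2r// eZ.
have h4 : enorm V4 <= 2 * (d%:R ^+ 2 * m * d%:R * m) * sN^-1.
  have oY n : `|Y n| <= m -> opb (Y n) (d%:R ^+ 2 * m).
    move=> Yn v; apply: le_trans (opb_norm _ v) _; rewrite ler_wpM2r ?enorm_ge0// ler_wpM2l ?sqr_ge0//.
  have dm0 : 0 <= d%:R ^+ 2 * m by rewrite mulr_ge0 ?sqr_ge0.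
  rewrite /V4 -scaleN1r scalerA mulN1r; apply: le_trans (opbD (oY k Yk) (opbZ _ (oY N YN)) h) _.
  rewrite normrN (ger0_norm r10).
  apply: (@le_trans _ _ (2 * (d%:R ^+ 2 * m) * (d%:R * (m / sN)))); last by rewrite !mulrA.
  apply: ler_pM; rewrite ?enorm_ge0//; first by rewrite addr_ge0// mulr_ge0.
  by rewrite mulr_natl mulr2n lerD2l ler_piMl.
have h5 : enorm V5 <= d%:R ^+ 3 * m ^+ 3 * (sk / sN ^+ 2).
  rewrite /V5 enormZ (ger0_norm (_ : 0 <= sk^-1)) ?invr_ge0 ?(ltW sk0)//.
  pose hs := \sum_i `|h i 0|; have hs0 : 0 <= hs by exact: sumr_ge0.
  have hsb : hs <= d%:R * (m / sN).
    apply: (@le_trans _ _ (\sum_(i < d) (m / sN))); last by rewrite sumr_const card_ord mulr_natl.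
    by apply: ler_sum => i _; apply: le_trans (norm_coord _ _ _) hm.
  have sR0 : 0 <= \sum_(N.+1 <= j < k.+1) R3 j by exact: sumr_ge0.
  have sR : \sum_(N.+1 <= j < k.+1) R3 j <= k%:R * m.
    rewrite -ler_pdivrMl ?ltr0n//; apply: le_trans Wk.
    have NkS : (N.+1 <= k.+1)%N by [].
    rewrite ler_wpM2l ?invr_ge0// [leRHS](big_cat_nat (ltn0Sn N) NkS)/= lerDr.
    exact: sumr_ge0.
  apply: (@le_trans _ _ (sk^-1 * (d%:R * (k%:R * m * (d%:R * (m / sN)) ^+ 2)))).
    rewrite ler_pM2l ?invr_gt0//; apply: enorm_coord_le.
      by rewrite mulr_ge0 ?sqr_ge0// mulr_ge0.
    move=> i; rewrite summxE; apply: le_trans (ler_norm_sum _ _ _) _.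
    apply: (@le_trans _ _ (\sum_(N.+1 <= j < k.+1) R3 j * hs ^+ 2)).
      by apply: ler_sum => j _; exact: taylor.
    rewrite -mulr_suml; apply: ler_pM => //; first exact: sqr_ge0.
    by rewrite ler_pXn2r ?nnegrE// mulr_ge0.
  by rewrite -sk2 le_eqVlt; apply/orP; left; apply/eqP; field; rewrite !gt_eqF.
have h6 : enorm V6 <= l * m * (c^-1 * (d%:R * m)) * sN^-1.
  rewrite /V6 enormN; apply: le_trans (Ibt _) _.
  apply: (@le_trans _ _ (l * (m / sN) * (c^-1 * (d%:R * m)))).
    rewrite ler_wpM2l ?mulr_ge0//; apply: le_trans (pd_inv_opb c0 Itc _) _.
    by rewrite ler_wpM2l ?invr_ge0 ?(ltW c0)// eZ.
  by rewrite le_eqVlt; apply/orP; left; apply/eqP; field; rewrite !gt_eqF.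
have s1 : sk / sN ^+ 2 <= a by rewrite /a lerDr addr_ge0// invr_ge0 ltW.
have s0 : 0 <= sk / sN ^+ 2 by rewrite divr_ge0 ?sqr_ge0 ?ltW.
have s2 : sN / sk <= a by rewrite /a -addrA lerDl addr_ge0// invr_ge0 ltW.
have s3 : sN^-1 <= a by rewrite /a addrAC lerDr addr_ge0.
have wk (x q y : R) : 0 <= q -> x <= q * y -> y <= a -> x <= q * a.
  by move=> q0 xq ya; apply: le_trans xq _; rewrite ler_wpM2l.
have cI0 : 0 <= c^-1 by rewrite invr_ge0 ltW.
rewrite /onestep_const 5!mulrDl.
apply: le_trans (enormD _ _) (lerD _ (wk _ _ _ _ h6 s3)); last by rewrite !mulr_ge0.
apply: le_trans (enormD _ _) (lerD _ (wk _ _ _ _ h5 s1)); last by rewrite mulr_ge0 ?exprn_ge0.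
apply: le_trans (enormD _ _) (lerD _ (wk _ _ _ _ h4 s3)); last by rewrite !mulr_ge0 ?exprn_ge0.
apply: le_trans (enormD _ _) (lerD _ (wk _ _ _ _ h3 s2)); last by rewrite !mulr_ge0.
by apply: le_trans (enormD _ _) (lerD (wk _ _ _ _ h1 s1) (wk _ _ _ _ h2 s2)); rewrite !mulr_ge0.
Qed.

End OneStepAlgebra.

Lemma powRN_small (R : realType) (a e : R) : 0 < a -> 0 < e ->
  exists n0, (0 < n0)%N /\ forall n, (n0 <= n)%N -> (n%:R : R) `^ (- a) <= e.
Proof.
move=> a0 e0; exists (Num.truncn (e^-1 `^ a^-1)).+1; split => // n nn.
have n0 : 0 < n%:R :> R by rewrite ltr0n (leq_trans _ nn).
have h : e^-1 `^ a^-1 <= n%:R.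
  by apply/ltW/(lt_le_trans (truncnS_gt _)); rewrite ler_nat.
rewrite powRN invf_ple ?posrE ?powR_gt0//.
have -> : e^-1 = (e^-1 `^ a^-1) `^ a by rewrite -powRrM mulVf ?gt_eqF// powRr1// invr_ge0 ltW.
by apply: ge0_ler_powR; rewrite ?nnegrE ?(ltW a0) ?powR_ge0 ?(ltW n0).
Qed.

(** * Growth of N and k *)

Section Rates.
Variables (R : realType) (delta s : R).
Hypotheses (d12 : 1 / 2 < delta < 1) (s01 : 0 < s <= 1).

Lemma ler_of_sqr (x e : R) : 0 <= e -> x ^+ 2 <= e ^+ 2 -> x <= e.
Proof.
move=> e0 h; have [x0|/ltW x0] := leP x 0; first exact: le_trans e0.
by rewrite -(@ler_pXn2r _ 2)// nnegrE.
Qed.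

Lemma kof_large k0 : exists n0, forall n, (n0 <= n)%N -> (k0 <= kof s n)%N.
Proof.
have [s0 s1] := andP s01; exists (Num.truncn (k0%:R / s)).+1 => n nn.
rewrite /kof -(@natrK R k0) le_truncn// mulrC -ler_pdivrMr//.
by apply/ltW/(lt_le_trans (truncnS_gt _)); rewrite ler_nat.
Qed.

(** The squares of the three terms are of order n^-(1 - delta), n^-delta and n^-(2 delta - 1); the
    first needs delta < 1 and the last delta > 1/2. Integer parts cost a factor 2 once n^delta and s
    n are at least 2. *)
Lemma rates (e : R) : 0 < e -> exists n0, forall n, (n0 <= n)%N ->
  [/\ (0 < Nof delta n)%N, (Nof delta n <= kof s n)%N &
    Num.sqrt ((Nof delta n)%:R : R) / Num.sqrt (kof s n)%:R + (Num.sqrt (Nof delta n)%:R)^-1 +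
    Num.sqrt (kof s n)%:R / Num.sqrt (Nof delta n)%:R ^+ 2 <= e].
Proof.
move=> e0; have [d1 d2] := andP d12; have [s0 s1] := andP s01.
have dl0 : 0 < delta by apply: lt_trans d1; rewrite divr_gt0.
pose e1 := e / 3; have e10 : 0 < e1 by rewrite divr_gt0.
have e12 : 0 < e1 ^+ 2 by rewrite exprn_gt0.
have p1 : 0 < Num.min (1 / 2 : R) (e1 ^+ 2 / 2) by rewrite lt_min !divr_gt0.
have [n1 [n10 H1]] := powRN_small dl0 p1.
have p2 : 0 < s / 2 * Num.min 1 (e1 ^+ 2) by rewrite mulr_gt0 ?divr_gt0// lt_min ltr01.
have d1' : 0 < 1 - delta by rewrite subr_gt0.
have [n2 [n20 H2]] := powRN_small d1' p2.
have p3 : 0 < e1 ^+ 2 / 4 by rewrite divr_gt0.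
have d2' : 0 < 2 * delta - 1 by lra.
have [n3 [n30 H3]] := powRN_small d2' p3.
have [n4 H4] := kof_large 1.
exists (n1 + n2 + n3 + n4 + (Num.truncn (2 / s)).+1)%N => n nn.
have {}H1 := H1 n (leq_trans (leq_trans (leq_addr _ _) (leq_trans (leq_addr _ _) (leq_trans (leq_addr _ _) (leq_addr _ _)))) nn).
have {}H2 := H2 n (leq_trans (leq_trans (leq_addl _ _) (leq_trans (leq_addr _ _) (leq_trans (leq_addr _ _) (leq_addr _ _)))) nn).
have {}H3 := H3 n (leq_trans (leq_trans (leq_addl _ _) (leq_trans (leq_addr _ _) (leq_addr _ _))) nn).
have {}H4 := H4 n (leq_trans (leq_trans (leq_addl _ _) (leq_addr _ _)) nn).
have nS : 2 / s <= n%:R.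
  apply/ltW/(lt_le_trans (truncnS_gt _)); rewrite ler_nat.
  exact: leq_trans (leq_addl _ _) nn.
have n0 : 0 < n%:R :> R by apply: lt_le_trans nS; rewrite divr_gt0.
set N := Nof delta n; set k := kof s n.
pose x : R := n%:R `^ delta; have x0 : 0 < x by rewrite powR_gt0.
have Nx : N%:R <= x by rewrite truncn_le// powR_ge0.
have xN : x < N%:R + 1 by rewrite natr1 truncnS_gt.
have ks : k%:R <= s * n%:R by rewrite truncn_le// mulr_ge0 ?(ltW s0) ?(ltW n0).
have sk : s * n%:R < k%:R + 1 by rewrite natr1 truncnS_gt.
move: H1; rewrite le_min powRN -/x => /andP[H1 H1'].
have x2 : 2 <= x by move: H1; rewrite invf_ple ?posrE ?divr_gt0// div1r invrK.
have sn2 : 2 <= s * n%:R by rewrite mulrC -ler_pdivrMr.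
have N2 : x / 2 <= N%:R by lra.
have k2 : s * n%:R / 2 <= k%:R by lra.
have NR0 : 0 < N%:R :> R by apply: lt_le_trans N2; rewrite divr_gt0.
have kR0 : 0 < k%:R :> R by rewrite ltr0n.
have xn : x / n%:R = n%:R `^ (- (1 - delta)).
  by rewrite opprB powRD ?powRN ?powRr1 ?(ltW n0)// (gt_eqF n0) implybT.
have nx2 : n%:R / x ^+ 2 = n%:R `^ (- (2 * delta - 1)).
  rewrite opprB powRD; last by rewrite (gt_eqF n0) implybT.
  by rewrite powRr1 ?(ltW n0)// powRN mulrC [2 * delta]mulrC powRrM powR_mulrn ?powR_ge0// mulrC.
rewrite -xn in H2; rewrite -nx2 in H3.
have Nk : N%:R / k%:R <= Num.min 1 (e1 ^+ 2).
  rewrite ler_pdivrMr//; apply: le_trans Nx _.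
  move: H2; set mn := Num.min _ _ => H2; have mn0 : 0 < mn by rewrite lt_min ltr01.
  rewrite ler_pdivrMr// in H2; apply: le_trans H2 _.
  by rewrite mulrAC mulrC ler_pM2l//; lra.
move: Nk; rewrite le_min => /andP[Nk1 Nk2].
split.
- by rewrite -(ltr_nat R).
- by move: Nk1; rewrite ler_pdivrMr// mul1r ler_nat.
rewrite (_ : e = e1 + e1 + e1); last by rewrite /e1; lra.
apply: lerD; first apply: lerD; apply: ler_of_sqr; rewrite ?(ltW e10)//.
- by rewrite exprMn exprVn !sqr_sqrtr// ltW.
- rewrite exprVn sqr_sqrtr ?(ltW NR0)//; apply: le_trans (_ : 2 * x^-1 <= _).
    rewrite -[X in X * _]invrK -invfM lef_pV2 ?posrE ?mulr_gt0 ?invr_gt0//.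
    by rewrite mulrC.
  by rewrite -ler_pdivlMl// mulrC.
- rewrite exprMn exprVn !sqr_sqrtr ?(ltW NR0) ?(ltW kR0)//.
  apply: (@le_trans _ _ (n%:R / (x / 2) ^+ 2)).
    apply: ler_pM; rewrite ?invr_ge0 ?sqr_ge0//.
      by apply: le_trans ks _; rewrite ler_piMl ?(ltW n0).
    by rewrite lef_pV2 ?posrE ?exprn_gt0 ?divr_gt0// ler_pXn2r ?nnegrE ?divr_ge0 ?(ltW x0) ?(ltW NR0).
  have -> : n%:R / (x / 2) ^+ 2 = 4 * (n%:R / x ^+ 2) by field; rewrite gt_eqF.
  by move: H3; lra.
Qed.

End Rates.

Lemma expRN_dist (R : realType) (x y : R) : 0 <= x -> 0 <= y -> `|expR (- x) - expR (- y)| <= `|x - y|.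
Proof.
wlog xy : x y / x <= y => [H x0 y0|x0 y0].
  have [xy|/ltW yx] := leP x y; first exact: H.
  by rewrite distrC [leRHS]distrC; exact: H.
have x0y : 0 <= x <= y by rewrite x0.
have /andP[h1 h2] := expRN_lip x0y.
by rewrite ger0_norm// [leRHS]distrC ger0_norm ?subr_ge0.
Qed.

(** Resolvent identity: the difference of the inverses is A^-1 (B - A) B^-1. *)
Lemma qform_invmx_dist (R : realType) d (A B : 'M[R]_d) (c : R) : A^T = A -> 0 < c ->
  (forall v, c * dotc v v <= qform A v) -> (forall v, c * dotc v v <= qform B v) ->
  forall v, `|qform (invmx A) v - qform (invmx B) v| <= c^-1 * (d%:R ^+ 2 * `|A - B|) * c^-1 * enorm v ^+ 2.
Proof.
move=> As c0 Ac Bc v; have cV0 : 0 <= c^-1 by rewrite invr_ge0 ltW.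
have -> : qform (invmx A) v - qform (invmx B) v = dotc (invmx A *m v) ((B - A) *m (invmx B *m v)).
  rewrite mulmxBl dotcBr mulKVmx ?(pd_unitmx c0 Bc)// dotc_mx As mulKVmx ?(pd_unitmx c0 Ac)//.
  by rewrite !qformE (dotcC v).
apply: le_trans (cauchy_schwarz _ _) _.
have h1 := pd_inv_opb c0 Ac v; have h0 := pd_inv_opb c0 Bc v.
have h2 := opb_norm (B - A) (invmx B *m v); rewrite distrC in h2.
rewrite (_ : _ * enorm v ^+ 2 = (c^-1 * enorm v) * (d%:R ^+ 2 * `|A - B| * (c^-1 * enorm v))); last by ring.
apply: ler_pM; [exact: enorm_ge0|exact: enorm_ge0|exact: h1|apply: le_trans h2 _].
by rewrite ler_wpM2l// mulr_ge0// sqr_ge0.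
Qed.

(** * Uniform limit theorems in the model *)

Section Model.
Variables (R : realType) (d : nat) (Theta : set 'cV[R]_d) (S : 'cV[R]_d -> R -> R) (g : R -> R).
Context dO (Omega : measurableType dO) (P : 'cV[R]_d -> probability Omega R) (X : nat -> Omega -> R).
Variables (delta : R) (est : nat -> (nat -> R) -> 'cV[R]_d).
Hypotheses (oT : open Theta) (cT : convex_set_cV Theta)
  (mX : forall j, measurable_fun setT (X j)) (Sm : forall t, measurable_fun setT (S t))
  (iY : forall t, Theta t -> mutual_indep (P t) (innov S X t))
  (Yg : forall t, Theta t -> forall j, (0 < j)%N -> has_density (P t) (innov S X t j) g)
  (estT : forall N w, Theta (thetabar est X N w))
  (mest : forall N i j, measurable_fun setT (fun w => thetabar est X N w i j))
  (est_tight : tight_unif_compacts Theta P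
      (fun N t w => Num.sqrt (N%:R : R) *: (thetabar est X N w - t)))
  (S3 : forall x, C3_on Theta (fun t => S t x)) (g0 : forall x, 0 < g x) (g3 : C3_R g).
Variables (R1 R2 R3 : R -> R -> R) (C : R).
Hypotheses (mR1 : measurable_fun setT (fun p : R * R => R1 p.1 p.2))
  (mR2 : measurable_fun setT (fun p : R * R => R2 p.1 p.2))
  (mR3 : measurable_fun setT (fun p : R * R => R3 p.1 p.2))
  (ellR : forall t x x', Theta t ->
             (forall i, `|ldot S g t x x' i 0| <= R1 x x') /\
             (forall i j, `|lddot S g t x x' i j| <= R2 x x') /\
             (forall i j k, `|ldddot S g t x x' i j k| <= R3 x x'))
  (RC : forall t, Theta t -> forall j, (0 < j)%N ->
             [/\ (\int[P t]_w ((R1 (X j.-1 w) (X j w)) ^+ 2)%:E < C%:E)%E,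
                 (\int[P t]_w ((R2 (X j.-1 w) (X j w)) ^+ 2)%:E < C%:E)%E &
                 (\int[P t]_w ((R3 (X j.-1 w) (X j w)) ^+ 2)%:E < C%:E)%E]).
Local Notation I := (fisher P X S g).
Hypothesis clt : forall t, Theta t ->
  forall (dO' : measure_display) (Omega' : measurableType dO')
         (Q : probability Omega' R) (zeta : Omega' -> 'cV[R]_d),
  std_gauss_vec Q zeta -> cvg_in_law (P t) (fun n => normscore S g X n t) Q (fun w => sqrtmx (I t) *m zeta w).
Hypothesis hess_tight : tight_unif_compacts Theta P
  (fun n t w => (Num.sqrt (n%:R : R))^-1 *: \sum_(1 <= j < n.+1)
      (lddot S g t (X j.-1 w) (X j w) + I t)).
Variables (L cI MI : R).
Hypotheses (IL : forall t1 t2, Theta t1 -> Theta t2 -> `|I t1 - I t2| <= L * `|t1 - t2|)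
  (cI0 : 0 < cI)
  (Ic : forall t (v : 'cV[R]_d), Theta t -> qform 1%:M v = 1 -> cI <= qform (I t) v)
  (IM : forall t (v : 'cV[R]_d), Theta t -> qform 1%:M v = 1 -> qform (I t) v <= MI).
Hypotheses (d12 : 1 / 2 < delta < 1) (d0 : (0 < d)%N).

Let R1C t j : Theta t -> (\int[P t]_w ((R1 (X j w) (X j.+1 w)) ^+ 2)%:E <= C%:E)%E.
Proof. by move=> Tt; have [/ltW] := RC Tt (ltn0Sn j). Qed.
Let R2C t j : Theta t -> (\int[P t]_w ((R2 (X j w) (X j.+1 w)) ^+ 2)%:E <= C%:E)%E.
Proof. by move=> Tt; have [_ /ltW] := RC Tt (ltn0Sn j). Qed.
Let R3C t j : Theta t -> (\int[P t]_w ((R3 (X j w) (X j.+1 w)) ^+ 2)%:E <= C%:E)%E.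
Proof. by move=> Tt; have [_ _ /ltW] := RC Tt (ltn0Sn j). Qed.
Let ldotR1 t x x' i : Theta t -> `|ldot S g t x x' i 0| <= R1 x x'.
Proof. by move=> Tt; have [] := ellR x x' Tt. Qed.
Let lddotR2 t x x' i j : Theta t -> `|lddot S g t x x' i j| <= R2 x x'.
Proof. by move=> Tt; have [_ []] := ellR x x' Tt. Qed.
Let ldddotR3 t x x' i j k : Theta t -> `|ldddot S g t x x' i j k| <= R3 x x'.
Proof. by move=> Tt; have [_ [_]] := ellR x x' Tt. Qed.

Lemma fisher_sym t : (I t)^T = I t.
Proof. by apply/matrixP => i j; rewrite !mxE; apply: eq_Rintegral => w _; rewrite mulrC. Qed.

Let Ilow t v : Theta t -> cI * dotc v v <= qform (I t) v.
Proof. by move=> Tt; apply: nondeg_qform => u; exact: Ic. Qed.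

Let Iup t v : Theta t -> qform (I t) v <= MI * dotc v v.
Proof.
move=> Tt; have : - MI * dotc v v <= qform (- 1 *: I t) v.
  by apply: nondeg_qform => u u1; rewrite qformZl mulN1r lerN2; exact: IM.
by rewrite qformZl mulN1r mulNr lerN2.
Qed.

Let Ige0 t v : Theta t -> 0 <= qform (I t) v.
Proof. by move=> Tt; apply: le_trans (Ilow v Tt); rewrite mulr_ge0 ?dotc_ge0 ?ltW. Qed.

Lemma dotc_delta (i : 'I_d) (v : 'cV[R]_d) : dotc (delta_mx i 0) v = v i 0.
Proof.
rewrite dotcE (bigD1 i)//= big1 ?addr0 ?mxE ?eqxx ?mul1r// => j ji.
by rewrite mxE (negbTE ji) mul0r.
Qed.

(** [nu] is built at [t0] but agrees with the innovation law at every parameter, all having density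
    g. The dimension must be positive, as the moments of the score are read off a diagonal entry of
    the information. *)
Lemma innov_law t0 : Theta t0 -> exists nu : probability R R,
  (forall t j A, Theta t -> (0 < j)%N -> measurable A -> nu A = P t (innov S X t j @^-1` A)) /\
  [/\ L1 nu (fun e => score g e ^+ 2), L1 nu (score1 g), \int[nu]_e score g e = 0,
      \int[nu]_e score1 g e = - \int[nu]_e (score g e ^+ 2) & 0 < \int[nu]_e (score g e ^+ 2)].
Proof.
move=> Tt0; exists (law (P t0) (measurable_innov Sm t0 mX 1)); split.
  by move=> t j A Tt j0 mA; rewrite lawE (Yg Tt0 (ltn0Sn 0) mA) (Yg Tt j0 mA).
apply: (score_moments oT S3 g0 g3 Sm mX Tt0 (iY Tt0) (Yg Tt0 (ltn0Sn 0)) (i := Ordinal d0)).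
- have := Ilow (delta_mx (Ordinal d0) 0) Tt0; rewrite dotc_delta mxE !eqxx mulr1 qformE dotc_delta.
  by rewrite -delta_coord mxE; exact: lt_le_trans.
- apply: le_lt_trans (ltry C); apply: le_trans (R1C 0 Tt0); apply: integral_mono => w.
  rewrite lee_fin -real_normK ?num_real// ler_pXn2r ?nnegrE ?(le_trans _ (ldotR1 _ _ (Ordinal d0) Tt0))//.
- apply: le_lt_trans (ltry C); apply: le_trans (R2C 0 Tt0); apply: integral_mono => w.
  rewrite lee_fin -real_normK ?num_real// ler_pXn2r ?nnegrE ?(le_trans _ (lddotR2 _ _ (Ordinal d0) (Ordinal d0) Tt0))//.
Qed.

Lemma char_fisher K (U eps : R) : compact K -> K `<=` Theta -> 0 <= U -> 0 < eps ->
  exists n0, forall n, (n0 <= n)%N -> forall t, K t -> forall (u : 'cV[R]_d) c, \sum_i `|u i 0| <= U ->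
  `|\int[P t]_w cos (dotc u (normscore S g X n t w) + c) - expR (- (qform (I t) u / 2)) * cos c| <= eps.
Proof.
move=> cK KT U0 eps0; have [[t0 Kt0]|K0] := pselect (K !=set0); last first.
  by exists 0%N => n _ t Kt; case: K0; exists t.
have [nu [nuE [s2 s1 sm s1m sp]]] := innov_law (KT _ Kt0).
exact: (char_unif oT S3 g0 g3 Sm mX iY nuE s2 s1 sm s1m sp mR1 mR2 ldotR1 lddotR2 R1C R2C Ige0 Iup hess_tight).
Qed.

Lemma measurable_normscore n t i : Theta t -> measurable_fun setT (fun w => normscore S g X n t w i 0).
Proof.
move=> Tt; rewrite (_ : (fun w => _) = fun w => (Num.sqrt n%:R)^-1 *
    \sum_(k < n) ldot S g t (X k w) (X k.+1 w) i 0).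
  apply: measurable_funM; first exact: measurable_cst.
  by apply: measurable_sum => k; exact: (measurable_ldot oT S3 g0 g3 Sm mX k i Tt).
apply/funext => w; rewrite /normscore mxE summxE.
by rewrite (big_pred_shift (fun j' k' => ldot S g t (X j' w) (X k' w) i 0)).
Qed.

(** Orthogonality of the scores bounds the second moment of each coordinate by |C| for all n and all
    of [Theta]; Markov's inequality does the rest. *)
Lemma normscore_tight eta : 0 < eta -> exists m, 0 < m /\ forall t n, Theta t ->
  (P t [set w | (m < `|normscore S g X n t w|)%R] <= eta%:E)%E.
Proof.
(* Markov's bound at the level q + 1 is q eta / (q + 1)^2, at most eta. *)
move=> eta0; pose q := d%:R * `|C| / eta; have q0 : 0 <= q by apply: divr_ge0; [rewrite mulr_ge0|exact: ltW].
exists (q + 1); split; first by rewrite ltr_wpDl.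
move=> t n Tt; have m0 : 0 < q + 1 by rewrite ltr_wpDl.
have [nu [nuE [s2 s1 sm s1m sp]]] := innov_law Tt.
have nuE' j A := @nuE t j A Tt.
have l1 x x' i := ldotR1 x x' i Tt.
have Z2 i : L1 (P t) (fun w => normscore S g X n t w i 0 ^+ 2) /\
    \int[P t]_w (normscore S g X n t w i 0 ^+ 2) <= `|C|.
  have uU : \sum_j `|(delta_mx i 0 : 'cV[R]_d) j 0| <= 1.
    rewrite (bigD1 i)//= big1 ?addr0 ?mxE ?eqxx ?normr1// => j ji.
    by rewrite mxE (negbTE ji) normr0.
  have ZE w : normscore S g X n t w i 0 =
      (Num.sqrt n%:R)^-1 * (\sum_(j < n) xi S g X t (delta_mx i 0) j w)
      - (Num.sqrt n%:R)^-1 * (\sum_(j < 0) xi S g X t (delta_mx i 0) j w).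
    by rewrite big_ord0 mulr0 subr0 -dotc_normscore dotc_delta.
  have mx j := measurable_xi oT S3 g0 g3 Sm mX Tt (delta_mx i 0) j.
  have x2 j := xi_sqr oT S3 g0 g3 Sm mX Tt mR1 l1 (fun j => R1C j Tt) uU j.
  have x2C j : \int[P t]_w (xi S g X t (delta_mx i 0) j w ^+ 2) <= `|C|.
    by apply: le_trans (x2 j).2 _; rewrite expr1n mul1r ler_norm.
  have mo i' j := @mart_orth _ _ _ _ _ oT S3 g0 g3 Sm _ _ _ _ _ mX Tt (iY Tt) _ nuE' s2 sm _ _ mR1 l1
    (fun j => R1C j Tt) _ _ uU i' j.
  have [I2 E2] := orthogonal_incr n mx (fun j => (x2 j).1) x2C mo (leq0n n).
  rewrite (funext (fun w => congr1 (fun x => x ^+ 2) (ZE w))); split => //.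
  apply: le_trans E2 _; rewrite subn0.
  have [->|n0] := posnP n; first by rewrite mul0r mulr0.
  by rewrite mulfV ?mulr1// pnatr_eq0 -lt0n.
pose f w := \sum_i normscore S g X n t w i 0 ^+ 2.
have If : L1 (P t) f by apply: L1_sum => i _; exact: (Z2 i).1.
have Ef : \int[P t]_w f w <= d%:R * `|C|.
  rewrite Ex_sum; last by move=> i _; exact: (Z2 i).1.
  apply: (@le_trans _ _ (\sum_(i < d) `|C|)); first by apply: ler_sum => i _; exact: (Z2 i).2.
  by rewrite sumr_const card_ord mulr_natl.
have h := Ex_markov If (fun w => sumr_ge0 _ (fun i _ => sqr_ge0 _)) (exprn_gt0 2 m0) Ef.
apply: (@le_trans _ _ (P t [set w | (q + 1) ^+ 2 < f w])).
  apply: le_measure; rewrite ?inE.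
  - by apply: measurable_gt; apply: measurable_mx_norm => i j; rewrite ord1; exact: measurable_normscore.
  - by apply: measurable_gt; exact: L1_measurable If.
  move=> w /=; set z := normscore S g X n t w => h'.
  have -> : f w = enorm z ^+ 2 by rewrite enormE dotcE; apply: eq_bigr => i _; rewrite expr2.
  rewrite ltr_pXn2r ?nnegrE ?(ltW m0) ?enorm_ge0//.
  exact: lt_le_trans h' (norm_le_enorm z).
apply: le_trans h _; rewrite lee_fin ler_pdivrMr ?exprn_gt0// [leRHS]mulrC -ler_pdivrMr// -/q.
have h2 := sqr_ge0 q; move: q0 h2; clearbody q; nra.
Qed.

Section Limit.
Context dO' (Omega' : measurableType dO') (Q : probability Omega' R) (zeta : Omega' -> 'cV[R]_d).
Hypothesis gz : std_gauss_vec Q zeta.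
Let mz i : measurable_fun setT (fun w => zeta w i 0). Proof. by case: gz. Qed.

Lemma gauss_char_zeta t0 w b : Theta t0 ->
  \int[Q]_x cos (dotc w (zeta x) + b) = expR (- (dotc w w / 2)) * cos b.
Proof.
move=> Tt0; apply: (gauss_char (fisher_sym t0) cI0 (fun v => Ilow v Tt0) (clt Tt0 gz)) => U eps U0 eps0.
have sT : [set t0] `<=` Theta by move=> _ ->.
have [n0 H] := char_fisher (@compact_set1 _ t0) sT U0 eps0.
by exists n0 => n nn u c uU; exact: H.
Qed.

Lemma lim_tight eta : 0 < eta -> exists m, 0 < m /\ forall t, Theta t ->
  (Q [set w | (m < `|sqrtmx (invmx (I t)) *m zeta w|)%R] <= eta%:E)%E.
Proof.
move=> eta0; have [m [m0 H]] := gauss_tight Q mz eta0.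
exists (Num.sqrt cI^-1 * d%:R * m); split.
  by apply: mulr_gt0 => //; apply: mulr_gt0; rewrite ?sqrtr_gt0 ?invr_gt0 ?ltr0n.
move=> t Tt; apply: (tight_opb mz (sqrtr_ge0 _)) => //.
exact: (sqrtmx_inv_opb (fisher_sym t) cI0 (fun v => Ilow v Tt)).
Qed.

Lemma score_cvg_unif K f (C' eps : R) : compact K -> K `<=` Theta -> continuous f -> (forall x, `|f x| <= C') ->
  0 < eps -> exists n0, forall n, (n0 <= n)%N -> forall t, K t ->
  `|\int[P t]_w f (invmx (I t) *m normscore S g X n t w) - \int[Q]_w f (sqrtmx (invmx (I t)) *m zeta w)| <= eps.
Proof.
move=> cK KT cf fC eps0; have [eta1 [eta10 H1]] := law_close cf fC eps0.
have [m1 [m10 Hm1]] := normscore_tight eta10; have [m2 [m20 Hm2]] := lim_tight eta10.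
pose M := Num.max (cI^-1 * d%:R * m1) m2.
have M0 : 0 < M by rewrite lt_max m20 orbT.
have [s [eta2 [eta20 H2]]] := H1 M M0.
(* Moving I(t)^-1 from the score to the frequencies changes p into I(t)^-1 p. This U bounds their l1
   norms for all t at once. *)
pose U := \sum_(p <- s) d%:R * (cI^-1 * enorm p.1.2).
have cV0 : 0 <= cI^-1 by rewrite invr_ge0 ltW.
have p0 (p : R * 'cV[R]_d * R) : 0 <= d%:R * (cI^-1 * enorm p.1.2) by rewrite !mulr_ge0 ?enorm_ge0.
have U0 : 0 <= U by exact: sumr_ge0.
have [n0 Hn] := char_fisher cK KT U0 eta20; exists n0 => n nn t Kt.
have Tt := KT t Kt; have Ict v := Ilow v Tt.
have mZ i : measurable_fun setT (fun w => normscore S g X n t w i 0) by exact: measurable_normscore.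
apply: H2.
- by move=> i; exact: measurable_mulmx.
- by move=> i; exact: measurable_mulmx.
- have h := tight_opb mZ cV0 (pd_inv_opb cI0 Ict) (Hm1 t n Tt).
  apply: le_trans h; apply: le_measure; rewrite ?inE.
  + by apply: measurable_gt; apply: measurable_mx_norm => i j; rewrite ord1; exact: measurable_mulmx.
  + by apply: measurable_gt; apply: measurable_mx_norm => i j; rewrite ord1; exact: measurable_mulmx.
  + by move=> w /=; apply: le_lt_trans; rewrite le_max lexx.
- apply: le_trans (Hm2 t Tt); apply: le_measure; rewrite ?inE.
  + by apply: measurable_gt; apply: measurable_mx_norm => i j; rewrite ord1; exact: measurable_mulmx.
  + by apply: measurable_gt; apply: measurable_mx_norm => i j; rewrite ord1; exact: measurable_mulmx.
  + by move=> w /=; apply: le_lt_trans; rewrite le_max lexx orbT.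
- move=> p ps.
  rewrite (gauss_char_inv (fun w b => gauss_char_zeta w b Tt) p.1.2 p.2 (fisher_sym t) cI0 Ict).
  have -> : qform (invmx (I t)) p.1.2 = qform (I t) (invmx (I t) *m p.1.2).
    by rewrite !qformE mulKVmx ?(pd_unitmx cI0 Ict)// dotcC.
  under eq_Rintegral do rewrite dotc_mx (invmx_sym (fisher_sym t)).
  apply: Hn => //; apply: (@le_trans _ _ (d%:R * (cI^-1 * enorm p.1.2))).
    apply: (@le_trans _ _ (\sum_(i < d) (cI^-1 * enorm p.1.2))).
      by apply: ler_sum => i _; apply: le_trans (coord_le_enorm _ _) _; exact: (pd_inv_opb cI0 Ict).
    by rewrite sumr_const card_ord mulr_natl.
  rewrite /U (big_rem p ps)/= lerDl; exact: sumr_ge0.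
Qed.

(** Works with characteristic functions, which see I(t) only through the quadratic form of its
    inverse, Lipschitz in t; the square root itself is a classical choice. *)
Lemma lim_cvg_unif t0 f (C' eps : R) : Theta t0 -> continuous f -> (forall x, `|f x| <= C') -> 0 < eps ->
  exists r, 0 < r /\ forall t, Theta t -> `|t - t0| <= r ->
  `|\int[Q]_w f (sqrtmx (invmx (I t)) *m zeta w) - \int[Q]_w f (sqrtmx (invmx (I t0)) *m zeta w)| <= eps.
Proof.
move=> Tt0 cf fC eps0; have [eta1 [eta10 H1]] := law_close cf fC eps0.
have [m [m0 Hm]] := lim_tight eta10; have [s [eta2 [eta20 H2]]] := H1 m m0.
have cV0 : 0 <= cI^-1 by rewrite invr_ge0 ltW.
pose D := cI^-1 * (d%:R ^+ 2 * `|L|) * cI^-1; have D0 : 0 <= D by rewrite !mulr_ge0 ?sqr_ge0.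
pose e2 := \sum_(p <- s) enorm p.1.2 ^+ 2; have e20 : 0 <= e2 by apply: sumr_ge0 => p _; exact: sqr_ge0.
have De1 : 0 < D * e2 + 1 by rewrite ltr_wpDl// mulr_ge0.
exists (eta2 / (D * e2 + 1)); split; first by rewrite divr_gt0.
move=> t Tt tt0; apply: H2.
- by move=> i; exact: measurable_mulmx.
- by move=> i; exact: measurable_mulmx.
- exact: Hm.
- exact: Hm.
move=> p ps; have Ict v := Ilow v Tt; have Ict0 v := Ilow v Tt0.
have E t' (Tt' : Theta t') := gauss_char_inv (fun w b => gauss_char_zeta w b Tt0) p.1.2 p.2
  (fisher_sym t') cI0 (fun v => Ilow v Tt').
rewrite [X in `|X - _|](E t Tt) [X in `|_ - X|](E t0 Tt0).
set v := p.1.2; rewrite -mulrBl normrM; apply: (@le_trans _ _ `|qform (invmx (I t)) v - qform (invmx (I t0)) v|).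
  have q0 t' : Theta t' -> 0 <= qform (invmx (I t')) v.
    move=> Tt'; have [c' [c'0 Hc]] := pd_inv_pd cI0 (fun v => Ilow v Tt').
    by apply: le_trans (Hc v); rewrite mulr_ge0 ?dotc_ge0 ?ltW.
  apply: (@le_trans _ _ `|expR (- (qform (invmx (I t)) v / 2)) - expR (- (qform (invmx (I t0)) v / 2))|).
    by rewrite ler_piMr// cos_max.
  apply: le_trans (expRN_dist _ _) _; rewrite ?divr_ge0 ?q0//.
  by rewrite -mulrBl normrM (ger0_norm (_ : 0 <= 2^-1))// ler_piMr//; lra.
apply: le_trans (qform_invmx_dist (fisher_sym t) cI0 Ict Ict0 v) _.
apply: (@le_trans _ _ (D * enorm v ^+ 2 * `|t - t0|)).
  have h2 : `|I t - I t0| <= `|L| * `|t - t0|.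
    by apply: le_trans (IL Tt Tt0) _; rewrite ler_wpM2r// ler_norm.
  rewrite (_ : D * enorm v ^+ 2 * `|t - t0| = cI^-1 * (d%:R ^+ 2 * (`|L| * `|t - t0|)) * cI^-1 * enorm v ^+ 2); last first.
    by rewrite /D; ring.
  rewrite ler_wpM2r ?sqr_ge0// ler_wpM2r// ler_wpM2l// ler_wpM2l ?sqr_ge0//.
apply: (@le_trans _ _ ((D * e2 + 1) * `|t - t0|)).
  rewrite ler_wpM2r// (@le_trans _ _ (D * e2)) ?lerDl// ler_wpM2l// /e2 (big_rem p ps)/= lerDl.
  by apply: sumr_ge0 => p' _; exact: sqr_ge0.
by rewrite mulrC -ler_pdivlMr.
Qed.

End Limit.

Let tb N w := thetabar est X N w.
Let Y n t w : 'M[R]_d := (Num.sqrt (n%:R : R))^-1 *: \sum_(1 <= j < n.+1) (lddot S g t (X j.-1 w) (X j w) + I t).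
Let W n w : R := n%:R^-1 * \sum_(1 <= j < n.+1) `|R3 (X j.-1 w) (X j w)|.

Lemma third_order_tight eta : 0 < eta -> exists m, 0 < m /\ forall t n, Theta t ->
  measurable [set w | m < W n w] /\ (P t [set w | (m < W n w)%R] <= eta%:E)%E.
Proof.
move=> eta0; pose C1 := 1 + `|C|; have C10 : 0 < C1 by rewrite ltr_pwDl.
exists (C1 / eta); split; first by rewrite divr_gt0.
move=> t n Tt.
have I3 j : L1 (P t) (fun w => `|R3 (X j w) (X j.+1 w)|) /\ \int[P t]_w `|R3 (X j w) (X j.+1 w)| <= C1.
  have mr : measurable_fun setT (fun w => R3 (X j w) (X j.+1 w)).
    apply: (@measurableT_comp _ _ _ _ _ _ (fun p : R * R => R3 p.1 p.2) _ (fun w => (X j w, X j.+1 w))) => //.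
    exact: measurable_fun_pair.
  have [I2 E2] := L1_nonneg (measurable_funX 2 mr) (fun w => sqr_ge0 _) (R3C j Tt).
  have I1 : L1 (P t) (fun w => 1 + R3 (X j w) (X j.+1 w) ^+ 2) by apply: L1D => //; exact: L1_cst.
  have le1 w : `|R3 (X j w) (X j.+1 w)| <= 1 + R3 (X j w) (X j.+1 w) ^+ 2.
    by rewrite -real_normK ?num_real//; have := sqr_ge0 (`|R3 (X j w) (X j.+1 w)| - 1); have := sqr_ge0 `|R3 (X j w) (X j.+1 w)|; nra.
  have In : L1 (P t) (fun w => `|R3 (X j w) (X j.+1 w)|).
    by apply: (L1_dom _ I1) => [|w]; [exact: (measurableT_comp (@normr_measurable _ _) mr)|rewrite normr_id].
  split => //; apply: le_trans (Ex_le In I1 le1) _.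
  rewrite ExD ?Ex_cst//; last exact: L1_cst.
  by rewrite lerD2l; apply: le_trans E2 (ler_norm _).
have WE : W n = fun w => n%:R^-1 * \sum_(j < n) `|R3 (X j w) (X j.+1 w)|.
  by apply/funext => w; rewrite /W (big_pred_shift (fun i j => (`|R3 (X i w) (X j w)| : R^o))).
have IW : L1 (P t) (W n) by rewrite WE; apply/L1Z/L1_sum => j _; exact: (I3 j).1.
split; first by apply: measurable_gt; exact: L1_measurable IW.
have W0 w : 0 <= W n w by rewrite mulr_ge0 ?invr_ge0// sumr_ge0.
have EW : \int[P t]_w W n w <= C1.
  rewrite WE ExZ; last by apply: L1_sum => j _; exact: (I3 j).1.
  rewrite Ex_sum; last by move=> j _; exact: (I3 j).1.
  have [->|n0] := posnP n; first by rewrite invr0 mul0r ltW.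
  rewrite ler_pdivrMl ?ltr0n//; apply: (@le_trans _ _ (\sum_(j < n) C1)).
    by apply: ler_sum => j _; exact: (I3 j).2.
  by rewrite sumr_const card_ord mulr_natl.
have := Ex_markov IW W0 (divr_gt0 C10 eta0) EW.
by rewrite invf_div mulrCA divff ?mulr1// gt_eqF.
Qed.

(** Six events at level eta / 6 are united. The exceptional set may vary with t, N and k, but the
    bound m does not. *)
Lemma remainder_tight K eta : compact K -> K `<=` Theta -> 0 < eta -> exists m, 0 < m /\
  forall t N k, K t -> exists B, [/\ measurable B, (P t B <= eta%:E)%E &
  forall w, ~ B w -> [/\ `|normscore S g X N t w| <= m, `|normscore S g X k t w| <= m,
    `|Y N t w| <= m, `|Y k t w| <= m & `|Num.sqrt (N%:R : R) *: (tb N w - t)| <= m /\ W k w <= m]].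
Proof.
move=> cK KT eta0; pose e := eta / 6; have e0 : 0 < e by rewrite divr_gt0.
have [m1 [m10 H1]] := normscore_tight e0.
have [m2 [m20 H2]] := hess_tight cK KT e0.
have [m3 [m30 H3]] := est_tight cK KT e0.
have [m4 [m40 H4]] := third_order_tight e0.
exists (m1 + m2 + m3 + m4); split; first by rewrite !addr_gt0.
move=> t N k Kt; have Tt := KT t Kt.
pose A n := [set w | m1 < `|normscore S g X n t w|].
pose A' n := [set w | m2 < `|Y n t w|].
pose B3 := [set w | m3 < `|Num.sqrt (N%:R : R) *: (tb N w - t)|].
pose B4 := [set w | m4 < W k w].
have mA n : measurable (A n).
  by apply: measurable_gt; apply: measurable_mx_norm => i j; rewrite ord1; exact: measurable_normscore.
have mA' n : measurable (A' n).
  by apply: measurable_gt; apply: measurable_mx_norm => i j; exact: (measurable_normhess oT S3 g0 g3 Sm mX).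
have mB3 : measurable B3.
  apply: measurable_gt; apply: measurable_mx_norm => i j.
  rewrite (_ : (fun w => _) = fun w => Num.sqrt N%:R * (tb N w i j - t i j)); last first.
    by apply/funext => w; rewrite !mxE.
  apply: measurable_funM; first exact: measurable_cst.
  by apply: measurable_funB; [exact: mest|exact: measurable_cst].
have [mB4 PB4] := H4 t k Tt.
exists (A N `|` A k `|` A' N `|` A' k `|` B3 `|` B4); split.
- by do ![apply: measurableU => //].
- have U2 (E F : set Omega) (r : R) : measurable E -> measurable F -> (P t E <= r%:E)%E -> (P t F <= e%:E)%E ->
      (P t (E `|` F) <= (r + e)%:E)%E.
    by move=> mE mF PE PF; apply: le_trans (measureU2 _ mE mF) _; rewrite EFinD leeD.
  rewrite (_ : eta = e + e + e + e + e + e); last by rewrite /e; lra.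
  have mU2 := measurableU _ _ (mA N) (mA k).
  have mU3 := measurableU _ _ mU2 (mA' N).
  have mU4 := measurableU _ _ mU3 (mA' k).
  have mU5 := measurableU _ _ mU4 mB3.
  have PU2 := U2 _ _ _ (mA N) (mA k) (H1 t N Tt) (H1 t k Tt).
  have PU3 := U2 _ _ _ mU2 (mA' N) PU2 (H2 N t Kt).
  have PU4 := U2 _ _ _ mU3 (mA' k) PU3 (H2 k t Kt).
  exact: (U2 _ _ _ mU5 mB4 (U2 _ _ _ mU4 mB3 PU4 (H3 N t Kt)) PB4).
- have out (x y m : R) : ~ (x < y) -> x <= m -> y <= m.
    by move=> /negP; rewrite -leNgt => yx xm; exact: le_trans yx xm.
  have [? ? ? ?] : [/\ m1 <= m1 + m2 + m3 + m4, m2 <= m1 + m2 + m3 + m4, m3 <= m1 + m2 + m3 + m4 &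
    m4 <= m1 + m2 + m3 + m4] by split; lra.
  move=> w nB; split; last split.
  + by apply: (out m1) => // h; apply: nB; do 5 left.
  + by apply: (out m1) => // h; apply: nB; do 4 left; right.
  + by apply: (out m2) => // h; apply: nB; do 3 left; right.
  + by apply: (out m2) => // h; apply: nB; do 2 left; right.
  + by apply: (out m3) => // h; apply: nB; left; right.
  + by apply: (out m4) => // h; apply: nB; right.
Qed.

(** Off the exceptional set, [onestep_bound] puts the normalised estimator within [dl] of I(t)^-1
    Z_k, which stays in a fixed ball, and uniform continuity of f applies; on that set |f| <= C' is
    used. *)
Lemma onestep_unif (dO' : measure_display) (Omega' : measurableType dO') (Q : probability Omega' R)
    (zeta : Omega' -> 'cV[R]_d) K f (C' eps s : R) : std_gauss_vec Q zeta ->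
  compact K -> K `<=` Theta -> continuous f -> (forall x, `|f x| <= C') -> 0 < eps -> 0 < s <= 1 ->
  exists n0, forall n, (n0 <= n)%N -> forall t, K t ->
  `|\int[P t]_w f (Num.sqrt ((kof s n)%:R : R) *: (onestep P X S g est delta s n w - t)) -
    \int[Q]_w f (sqrtmx (invmx (I t)) *m zeta w)| <= eps.
Proof.
move=> gz cK KT cf fC eps0 s01.
have C'0 : 0 <= C' by apply: le_trans (fC 0); exact: normr_ge0.
have eps2 : 0 < eps / 2 by rewrite divr_gt0.
have eps4 : 0 < eps / 4 by rewrite divr_gt0.
have cV0 : 0 <= cI^-1 by rewrite invr_ge0 ltW.
have [n1 Hn1] := score_cvg_unif gz cK KT cf fC eps2.
have [n2 Hn2] := kof_large s01 n1.
(* Makes 2 C' eta, the contribution of the exceptional set, at most eps / 4. *)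
pose eta := eps / (8 * (C' + 1)); have C'10 : 0 < C' + 1 by rewrite ltr_wpDl.
have eta0 : 0 < eta by rewrite divr_gt0// mulr_gt0.
have [m [m0 Hm]] := remainder_tight cK KT eta0.
pose M1 := cI^-1 * d%:R * m.
have [dl [dl0 Hdl]] := compact_uniform_continuity cf (@compact_cball R d 0 M1) eps4.
pose l := d%:R ^+ 2 * `|L|; have l0 : 0 <= l by rewrite mulr_ge0 ?sqr_ge0.
pose kap := cI^-1 * onestep_const d cI l `|MI| m.
have kap1 : 0 < `|kap| + 1 by rewrite ltr_wpDl.
have [n3 Hn3] := rates d12 s01 (divr_gt0 dl0 kap1).
exists (n2 + n3)%N => n nn t Kt; have Tt := KT t Kt.
have nk := Hn2 n (leq_trans (leq_addr _ _) nn).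
have [N0 Nk rate] := Hn3 n (leq_trans (leq_addl _ _) nn).
set N := Nof delta n in N0 Nk rate *; set k := kof s n in nk Nk rate *.
have h1 := Hn1 k nk t Kt.
have [B [mB PB good]] := Hm t N k Kt.
pose G w := invmx (I t) *m normscore S g X k t w.
have mG i : measurable_fun setT (fun w => G w i 0).
  by apply: measurable_mulmx => j; exact: measurable_normscore.
have IG : L1 (P t) (fun w => f (G w)).
  by apply: (@L1_bounded _ _ _ _ _ C') => //; exact: (measurable_continuous_cV mG cf fC).
pose F w := f (Num.sqrt (k%:R : R) *: (onestep P X S g est delta s n w - t)).
have FG w : ~ B w -> `|F w - f (G w)| <= eps / 4.
  move=> /good [ZN Zk YN Yk [qN Wk]].
  have Gm : `|G w| <= M1.
    apply: le_trans (norm_opb _ cV0 (pd_inv_opb cI0 (fun v => Ilow v Tt))) _.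
    by rewrite /M1 ler_wpM2l// mulr_ge0.
  rewrite /F distrC; apply: Hdl; first by rewrite /= subr0.
  set tbw := tb N w in qN.
  have Tb : Theta tbw by exact: estT.
  have sN0 : 0 < Num.sqrt (N%:R : R) by rewrite sqrtr_gt0 ltr0n.
  have hm : `|tbw - t| <= m / Num.sqrt N%:R.
    by rewrite ler_pdivlMr// mulrC; move: qN; rewrite normrZ (gtr0_norm sN0).
  have Ibt : opb (I tbw - I t) (l * (m / Num.sqrt N%:R)).
    move=> v; apply: le_trans (opb_norm _ v) _; rewrite ler_wpM2r ?enorm_ge0// /l -mulrA ler_wpM2l ?sqr_ge0//.
    apply: le_trans (IL Tb Tt) _; apply: (@le_trans _ _ (`|L| * `|tbw - t|)).
      by rewrite ler_wpM2r// ler_norm.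
    by rewrite ler_wpM2l.
  have taylor j i : `|(ldot S g tbw (X j.-1 w) (X j w) - ldot S g t (X j.-1 w) (X j w) -
      lddot S g t (X j.-1 w) (X j w) *m (tbw - t)) i 0| <= `|R3 (X j.-1 w) (X j w)| * (\sum_i `|(tbw - t) i 0|) ^+ 2.
    have := ldot_taylor oT cT S3 g0 g3 i Tt Tb (fun t' Tt' i j' k' => ldddotR3 (X j.-1 w) (X j w) i j' k' Tt').
    rewrite !mxE => h; apply: le_trans h _; rewrite ler_wpM2r ?sqr_ge0//; exact: ler_norm.
  have ItM : opb (I t) `|MI|.
    apply: (psd_opb (fisher_sym t) cI0) => // v; first exact: Ilow.
    by apply: le_trans (Iup v Tt) _; rewrite ler_wpM2r ?dotc_ge0// ler_norm.
  have bd := @onestep_bound _ _ (I tbw) (I t) cI l `|MI| m (tbw - t) N k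
    (fun j => ldot S g t (X j.-1 w) (X j w)) (fun j => ldot S g tbw (X j.-1 w) (X j w))
    (fun j => lddot S g t (X j.-1 w) (X j w)) (fun j => `|R3 (X j.-1 w) (X j w)|)
    cI0 l0 (normr_ge0 _) (ltW m0) N0 Nk (fun j => normr_ge0 _) (fun v => Ilow v Tb) (fun v => Ilow v Tt)
    ItM hm Ibt taylor ZN Zk YN Yk Wk.
  rewrite distrC; apply: le_trans (norm_le_enorm _) _.
  rewrite /onestep -/N -/k -/(tb N w) -/tbw addrAC; apply: le_trans bd _.
  rewrite -/kap; apply: (@le_trans _ _ ((`|kap| + 1) * (dl / (`|kap| + 1)))).
    apply: (@le_trans _ _ (`|kap| * (dl / (`|kap| + 1)))).
      apply: (@le_trans _ _ (`|kap| * (Num.sqrt N%:R / Num.sqrt k%:R + (Num.sqrt N%:R)^-1 + Num.sqrt k%:R / Num.sqrt N%:R ^+ 2))).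
        by rewrite ler_wpM2r ?ler_norm// !addr_ge0 ?divr_ge0 ?invr_ge0 ?sqrtr_ge0 ?sqr_ge0.
      by rewrite ler_wpM2l.
    by rewrite ler_wpM2r ?lerDl// divr_ge0 ?(ltW dl0) ?(ltW kap1).
  by rewrite mulrCA divff ?mulr1// gt_eqF.
have h2 := Rintegral_close (F := F) IG mB (fun w => fC _) (fun w => fC _) C'0 (ltW eps4) PB FG.
have h3 : 2 * C' * eta <= eps / 4.
  have -> : 2 * C' * eta = eps / 4 * (C' / (C' + 1)) by rewrite /eta; field; rewrite gt_eqF.
  by rewrite ler_piMr ?(ltW eps4)// ler_pdivrMr// mul1r lerDl.
move: h1 h2; rewrite -/(G _) => h1 h2.
rewrite -[X in `|X|](subrKA (\int[P t]_w f (G w))); apply: le_trans (ler_normD _ _) _.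
by rewrite (_ : eps = (eps / 4 + eps / 4) + eps / 2); [apply: lerD => //; apply: le_trans h2 _; rewrite lerD2l|lra].
Qed.

End Model.

Lemma enorm0 (R : realType) d : enorm (0 : 'cV[R]_d) = 0.
Proof. by rewrite -(scale0r (0 : 'cV[R]_d)) enormZ normr0 mul0r. Qed.

Theorem theorem1
  (R : realType) (d : nat) (Theta : set 'cV[R]_d)
  (S : 'cV[R]_d -> R -> R) (g : R -> R) (pi_dens : 'cV[R]_d -> R -> R)
  (dO : measure_display) (Omega : measurableType dO)
  (P : 'cV[R]_d -> probability Omega R) (X : nat -> Omega -> R)
  (delta : R) (est : nat -> (nat -> R) -> 'cV[R]_d)
  (* Theta open, convex, bounded *)
  (HTo : open Theta) (HTc : convex_set_cV Theta) (HTb : bounded_set_cV Theta)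
  (* the observations are random variables; S(theta, .) is Borel *)
  (HXm : forall j, measurable_fun setT (X j))
  (HSm : forall t, measurable_fun setT (S t))
  (* the model X_j = S(theta, X_{j-1}) + eps_j, eps_j i.i.d. with density g,
     independent of X_0 *)
  (Hmod_indep : forall t, Theta t -> mutual_indep (P t) (innov S X t))
  (Hmod_dens : forall t, Theta t -> forall j, (0 < j)%N -> has_density (P t) (innov S X t j) g)
  (* R(1): strict stationarity, unique invariant law with density pi(theta, .) *)
  (HR1_stat : forall t, Theta t -> strictly_stationary (P t) X)
  (HR1_dens : forall t, Theta t -> has_density (P t) (X 0%N) (pi_dens t))
  (HR1_inv : forall t, Theta t -> forall A : set R, measurable A ->
      P t (X 0%N @^-1` A) =
      (\int[P t]_w (\int[@lebesgue_measure R]_(y in A) (g (y - S t (X 0%N w)))%:E))%E)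
  (HR1_uniq : forall t, Theta t -> forall mu : probability R R,
      invariant_for mu (fun x y => g (y - S t x)) ->
      forall A : set R, measurable A ->
        mu A = (\int[@lebesgue_measure R]_(x in A) (pi_dens t x)%:E)%E)
  (* R(2): the preliminary estimator is a function of X_0..X_N, Theta-valued,
     measurable, and sqrt N (theta_bar_N - theta) is tight uniformly on compacts *)
  (HR2_fun : forall N (x y : nat -> R), (forall i, (i <= N)%N -> x i = y i) -> est N x = est N y)
  (HR2_val : forall N w, Theta (thetabar est X N w))
  (HR2_meas : forall N i j, measurable_fun setT (fun w => thetabar est X N w i j))
  (HR2_tight : tight_unif_compacts Theta P
      (fun N t w => Num.sqrt (N%:R : R) *: (thetabar est X N w - t)))
  (* R(3) *)
  (HR3_S : forall x, C3_on Theta (fun t => S t x))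
  (HR3_gpos : forall x, 0 < g x)
  (HR3_g : C3_R g)
  (HR3_bnd : exists (R1 R2 R3 : R -> R -> R) (C : R),
      [/\ measurable_fun setT (fun p : R * R => R1 p.1 p.2),
          measurable_fun setT (fun p : R * R => R2 p.1 p.2),
          measurable_fun setT (fun p : R * R => R3 p.1 p.2),
          (forall t x x', Theta t ->
             (forall i, `|ldot S g t x x' i 0| <= R1 x x') /\
             (forall i j, `|lddot S g t x x' i j| <= R2 x x') /\
             (forall i j k, `|ldddot S g t x x' i j k| <= R3 x x')) &
          (forall t, Theta t -> forall j, (0 < j)%N ->
             [/\ (\int[P t]_w ((R1 (X j.-1 w) (X j w)) ^+ 2)%:E < C%:E)%E,
                 (\int[P t]_w ((R2 (X j.-1 w) (X j w)) ^+ 2)%:E < C%:E)%E &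
                 (\int[P t]_w ((R3 (X j.-1 w) (X j w)) ^+ 2)%:E < C%:E)%E])])
  (* R(4): LLN, CLT, uniform tightness *)
  (HR4_lln : forall t, Theta t ->
      cvg_in_prob (P t)
        (fun n w => (n%:R : R)^-1 *: \sum_(1 <= j < n.+1)
            (ldot S g t (X j.-1 w) (X j w) *m (ldot S g t (X j.-1 w) (X j w))^T))
        (fisher P X S g t))
  (HR4_clt : forall t, Theta t ->
      forall (dO' : measure_display) (Omega' : measurableType dO')
             (Q : probability Omega' R) (zeta : Omega' -> 'cV[R]_d),
      std_gauss_vec Q zeta ->
      cvg_in_law (P t)
        (fun n w => (Num.sqrt (n%:R : R))^-1 *: \sum_(1 <= j < n.+1) ldot S g t (X j.-1 w) (X j w))
        Q (fun w => sqrtmx (fisher P X S g t) *m zeta w))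
  (HR4_tight : tight_unif_compacts Theta P
      (fun n t w => (Num.sqrt (n%:R : R))^-1 *: \sum_(1 <= j < n.+1)
          (lddot S g t (X j.-1 w) (X j w) + fisher P X S g t)))
  (* R(5): Lipschitz, uniformly non-degenerate and bounded Fisher information *)
  (HR5_lip : exists L : R, forall t1 t2, Theta t1 -> Theta t2 ->
      `|fisher P X S g t1 - fisher P X S g t2| <= L * `|t1 - t2|)
  (HR5_nondeg : exists c : R, 0 < c /\ forall t (lam : 'cV[R]_d), Theta t ->
      qform 1%:M lam = 1 -> c <= qform (fisher P X S g t) lam)
  (HR5_bnd : exists M : R, forall t (lam : 'cV[R]_d), Theta t ->
      qform 1%:M lam = 1 -> qform (fisher P X S g t) lam <= M)
  (* 1/2 < delta < 1 *)
  (Hdelta : 1 / 2 < delta < 1) :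
  (* asymptotic normality *)
  (forall t, Theta t -> forall s : R, 0 < s <= 1 ->
     forall (dO' : measure_display) (Omega' : measurableType dO')
            (Q : probability Omega' R) (zeta : Omega' -> 'cV[R]_d),
     std_gauss_vec Q zeta ->
     cvg_in_law (P t)
       (fun n w => Num.sqrt ((kof s n)%:R : R) *: (onestep P X S g est delta s n w - t))
       Q (fun w => sqrtmx (invmx (fisher P X S g t)) *m zeta w))
  /\
  (* asymptotic efficiency for bounded loss functions *)
  (forall s : R, 0 < s <= 1 -> forall t0, Theta t0 ->
     forall W : 'cV[R]_d -> R, loss_function W -> (exists M : R, forall x, W x <= M) ->
     forall (dO' : measure_display) (Omega' : measurableType dO')
            (Q : probability Omega' R) (zeta : Omega' -> 'cV[R]_d),
     std_gauss_vec Q zeta ->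
     exists (Lim : R -> R) (rho0 : R), 0 < rho0 /\
       (forall rho, 0 < rho < rho0 ->
          (fun n => sup [set Rintegral (P t) setT
                          (fun w => W (Num.sqrt ((kof s n)%:R : R) *:
                                         (onestep P X S g est delta s n w - t)))
                        | t in [set t | Theta t /\ enorm (t - t0) < rho]])
          @ \oo --> Lim rho) /\
       Lim rho @[rho --> 0^'+] -->
         Rintegral Q setT (fun w => W (sqrtmx (invmx (fisher P X S g t0)) *m zeta w))).
Proof.
have [R1 [R2 [R3 [C [mR1 mR2 mR3 ellR RC]]]]] := HR3_bnd.
have [L IL] := HR5_lip; have [cI [cI0 Ic]] := HR5_nondeg; have [MI IM] := HR5_bnd.
(* In dimension 0 all vectors coincide and both integrals equal f 0; the general argument starts
   from a coordinate of the score. *)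
have triv : d = 0%N -> forall x y : 'cV[R]_d, x = y.
  by move=> d0 x y; apply/matrixP => i; have := ltn_ord i; rewrite {2}d0.
have E0 dT (T : measurableType dT) (Q : probability T R) (f : 'cV[R]_d -> R) (Y : T -> 'cV[R]_d) :
    d = 0%N -> \int[Q]_w f (Y w) = f 0.
  move=> d0; rewrite -[RHS](Ex_cst Q); apply: eq_Rintegral => w _; congr f; exact: triv.
pose phi (dO' : measure_display) (Omega' : measurableType dO') (Q : probability Omega' R)
  (zeta : Omega' -> 'cV[R]_d) f t := \int[Q]_w f (sqrtmx (invmx (fisher P X S g t)) *m zeta w).
have U (dO' : measure_display) (Omega' : measurableType dO') (Q : probability Omega' R)
    (zeta : Omega' -> 'cV[R]_d) (K : set 'cV[R]_d) (f : 'cV[R]_d -> R) (C' eps s : R) : std_gauss_vec Q zeta ->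
    compact K -> K `<=` Theta -> continuous f -> (forall x, `|f x| <= C') -> 0 < eps -> 0 < s <= 1 ->
    exists n0, forall n, (n0 <= n)%N -> forall t, K t ->
    `|\int[P t]_w f (Num.sqrt ((kof s n)%:R : R) *: (onestep P X S g est delta s n w - t)) -
      phi _ _ Q zeta f t| <= eps.
  have [d0|d0] := posnP d; last first.
    exact: (onestep_unif HTo HTc HXm HSm Hmod_indep Hmod_dens HR2_val HR2_meas HR2_tight HR3_S HR3_gpos HR3_g
      mR1 mR2 mR3 ellR RC HR4_clt HR4_tight IL cI0 Ic IM Hdelta d0).
  move=> _ _ _ _ _ eps0 _; exists 0%N => n _ t _; rewrite /phi.
  by rewrite !(E0 _ _ _ _ _ d0) subrr normr0 ltW.
have V (dO' : measure_display) (Omega' : measurableType dO') (Q : probability Omega' R)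
    (zeta : Omega' -> 'cV[R]_d) (t0 : 'cV[R]_d) (f : 'cV[R]_d -> R) (C' eps : R) : std_gauss_vec Q zeta ->
    Theta t0 -> continuous f -> (forall x, `|f x| <= C') -> 0 < eps ->
    exists r, 0 < r /\ forall t, Theta t -> `|t - t0| <= r -> `|phi _ _ Q zeta f t - phi _ _ Q zeta f t0| <= eps.
  have [d0|d0] := posnP d; last first.
    move=> gz Tt0 cf fC eps0.
    apply: (lim_cvg_unif HTo HXm HSm Hmod_indep Hmod_dens HR3_S HR3_gpos HR3_g
      mR1 mR2 ellR RC HR4_clt HR4_tight IL cI0 Ic IM d0 gz Tt0 cf fC eps0).
  move=> _ _ _ _ eps0; exists 1; split => // t _ _; rewrite /phi.
  by rewrite !(E0 _ _ _ _ _ d0) subrr normr0 ltW.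
split.
  move=> t Tt s s01 dO' Omega' Q zeta gz f cf [M fM]; apply/cvgrPdist_le => eps eps0.
  have sT : [set t] `<=` Theta by move=> _ ->.
  have [n0 H] := U _ _ Q zeta _ f M eps s gz (@compact_set1 _ t) sT cf fM eps0 s01.
  by exists n0 => // n /= nn; rewrite distrC; exact: H.
move=> s s01 t0 Tt0 W [W0 Wge0 Wsym cW Wconv] [M WM] dO' Omega' Q zeta gz.
have WM' x : `|W x| <= M by rewrite ger0_norm.
have [e /= e0 eT] := (@nbhs_ballP R _ t0 Theta).1 (open_nbhs_nbhs (conj HTo Tt0)).
pose r0 := e / 2; have r00 : 0 < r0 by rewrite divr_gt0.
pose K := [set t : 'cV[R]_d | `|t - t0| <= r0].
have cK : compact K by exact: compact_cball.
have KT : K `<=` Theta.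
  move=> t tK; apply: eT; rewrite -ball_normE /= distrC.
  by apply: le_lt_trans tK _; rewrite /r0; lra.
pose B rho := [set t : 'cV[R]_d | Theta t /\ enorm (t - t0) < rho].
have Bt0 rho : 0 < rho -> B rho t0 by move=> rho0; split => //; rewrite subrr enorm0.
have phiM t : `|phi _ _ Q zeta W t| <= M.
  pose F w := W (sqrtmx (invmx (fisher P X S g t)) *m zeta w).
  have FM w : - M <= F w <= M by rewrite -ler_norml; exact: WM'.
  by have := Rintegral_sandwich (L1_cst Q (- M)) (L1_cst Q M) FM; rewrite !Ex_cst ler_norml.
(* The inner limit is the supremum of the limiting risks over the ball; for rho below [r0] the ball
   lies in the compact [K], where convergence is uniform. *)
exists (fun rho => sup [set phi _ _ Q zeta W t | t in B rho]), r0; split => //; split.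
  move=> rho /andP[rho0 rr0]; apply/cvgrPdist_le => eps eps0.
  have [n0 H] := U _ _ Q zeta K W M eps s gz cK KT cW WM' eps0 s01.
  exists n0 => // n /= nn; rewrite distrC; apply: (@sup_close _ _ _ _ _ M).
  - by exists t0; exact: Bt0.
  - move=> t _; pose F w := W (Num.sqrt ((kof s n)%:R : R) *: (onestep P X S g est delta s n w - t)).
    have FM w : - M <= F w <= M by rewrite -ler_norml; exact: WM'.
    have := Rintegral_sandwich (L1_cst (P t) (- M)) (L1_cst (P t) M) FM.
    by rewrite !Ex_cst ler_norml.
  - by move=> t _; exact: phiM.
  - move=> t [Tt tr]; apply: H => //; rewrite /K /=.
    by apply: le_trans (norm_le_enorm _) _; apply: ltW; exact: lt_trans rr0.
apply/cvgrPdist_le => eps eps0.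
have [r [rp Hr]] := V _ _ Q zeta t0 W M eps gz Tt0 cW WM' eps0.
near=> rho.
have rho0 : 0 < rho by near: rho; exact: nbhs_right_gt.
have rhor : rho < r by near: rho; exact: nbhs_right_lt.
(* The target is written as the supremum of a constant over the same ball, so that [sup_close]
   compares two suprema. *)
have -> : \int[Q]_w W (sqrtmx (invmx (fisher P X S g t0)) *m zeta w) = sup [set phi _ _ Q zeta W t0 | t in B rho].
  rewrite (_ : [set _ | _ in _] = [set phi _ _ Q zeta W t0]) ?sup1//.
  by apply/seteqP; split => [_ [t _ <-]//|_ ->]; exists t0 => //; exact: Bt0.
rewrite distrC; apply: (@sup_close _ _ _ _ _ M) => //; first by exists t0; exact: Bt0.
move=> t [Tt tr]; apply: Hr => //; apply: le_trans (norm_le_enorm _) _.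
by apply: ltW; exact: lt_trans tr rhor.
Unshelve. all: by end_near.
Qed.
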